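(* Let $g:\mathcal X\times\mathcal Y\to\mathbb R$ be three times continuously differentiable and a parametric Morse--Bott function. Assume that there exists $L>0$ such that $y\mapsto\partial_y g(x,y)$ is $L$-Lipschitz for every $x\in\mathcal X$, and that for every $x\in\mathcal X$, $g(x,y)\to+\infty$ as $\|y\|\to+\infty$. Let $\phi$ be the flow selection of $g$, and let $(x_0,y_0)\in\mathcal X\times\mathcal Y$. If $\phi(x_0,y_0)$ is a local minimizer of $y\mapsto g(x_0,y)$, then there exists a neighborhood $\mathcal U$ of $x_0$ on which $x\mapsto\phi(x,y_0)$ is differentiable, with differential $\partial_x\phi(x,y_0)=U_\infty(x,y_0)$, where $U_\infty(x,y_0)=\lim_{t\to+\infty}\partial_x\phi_t(x,y_0)$. Moreover, if $y_0$ is a local minimizer of $y\mapsto g(x_0,y)$, then $$\partial_x\phi(x_0,y_0)=-\,\partial^2_{xy}g(x_0,y_0)\,\bigl(\partial^2_{yy}g(x_0,y_0)\bigr)^{\dagger},$$ where $\dagger$ denotes the (Moore--Penrose) pseudo-inverse.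
   Context: $\mathcal X=\mathbb R^p$ and $\mathcal Y=\mathbb R^d$ with $p,d$ positive integers. The set of augmented critical points of $g$ is $\mathcal M:=\{(x,y)\in\mathcal X\times\mathcal Y : \partial_y g(x,y)=0\}$. A twice continuously differentiable $g$ is a parametric Morse--Bott function if for every $(x_0,y_0)\in\mathcal M$ there is an open neighborhood $\mathcal V$ of $(x_0,y_0)$ such that $\mathcal M\cap\mathcal V$ is a connected $C^2$ sub-manifold of $\mathcal X\times\mathcal Y$ of dimension $\dim(\mathcal X)+\dim\mathrm{Ker}(\partial^2_{yy}g(x_0,y_0))$. The gradient flow $(\phi_t(x,y))_{t\ge0}$ is the solution of $\frac{d}{dt}\phi_t(x,y)=-\partial_y g(x,\phi_t(x,y))$, $\phi_0(x,y)=y$. Under the stated assumptions, $\phi_t(x,y)$ converges as $t\to+\infty$ for every $(x,y)$ to a critical point of $g(x,\cdot)$; the flow selection is $\phi(x,y):=\lim_{t\to+\infty}\phi_t(x,y)$. Matrix convention: $\partial_x\phi$ and $\partial_x\phi_t$ are $p\times d$ matrices (transposed Jacobians, entry $(i,j)$ is $\partial\phi_j/\partial x_i$), and $\partial^2_{xy}g$ is the $p\times d$ matrix with entries $\partial^2 g/\partial x_i\partial y_j$. *)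

(* Defs.v *)
From mathcomp Require Import all_boot all_order all_algebra.
From mathcomp Require Import all_classical all_reals all_analysis.

Set Implicit Arguments.
Unset Strict Implicit.
Unset Printing Implicit Defensive.

Import Order.TTheory GRing.Theory Num.Theory.
Import numFieldNormedType.Exports.

Local Open Scope classical_set_scope.
Local Open Scope ring_scope.

(** [R^n] is the row-vector space ['rV[R]_n].  The Jacobian
    ['J f x] of the library acts on row vectors, so its entry (i, j) is
    [d f_j / d x_i]: it is the transpose of the usual Jacobian matrix. *)

(** The norm that the library puts on matrices is the sup norm. *)
Definition enorm (R : realType) (n : nat) (v : 'rV[R]_n) : R :=
  Num.sqrt (\sum_(i < n) v ord0 i ^+ 2).

(** [f] is of class C^k on the open set [A].  As [V] is finite dimensional in
    every use, the continuity of [x |-> 'd f x] for the operator norm amounts to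
    the continuity of all the directional derivatives, and likewise for higher
    orders. *)
Fixpoint Ck_on (R : realType) (V W : normedModType R) (k : nat) (A : set V)
    (f : V -> W) : Prop :=
  match k with
  | 0 => forall x, A x -> {for x, continuous f}
  | k'.+1 => (forall x, A x -> differentiable f x) /\
             forall v : V, Ck_on k' A ('D_v f)
  end.

(** Embedded C^k submanifolds of dimension [m], through straightening charts:
    near each point of [S], a C^k diffeomorphism [Phi] from an open set [W] onto
    an open subset of [R^n], with inverse [Psi], maps [S] onto the slice
    [R^m x {0}].  [E] is meant to be of dimension [n]. *)
Definition is_submanifold (R : realType) (E : normedModType R) (n k m : nat)
    (S : set E) : Prop :=
  (m <= n)%N /\
  forall s, S s ->
    exists (W : set E) (Phi : E -> 'rV[R]_n) (Psi : 'rV[R]_n -> E),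
      [/\ open W /\ W s,
          open (Phi @` W),
          forall z, W z -> Psi (Phi z) = z,
          Ck_on k W Phi /\ Ck_on k (Phi @` W) Psi
        & Phi @` (S `&` W) =
          Phi @` W `&` [set u | forall j : 'I_n, (m <= j)%N -> u ord0 j = 0]].

Definition is_local_minimizer (R : realType) (V : normedModType R)
    (f : V -> R) (a : V) : Prop :=
  \forall y \near a, f a <= f y.

(** The Moore--Penrose pseudo-inverse over the reals, as the matrix determined
    by the four Penrose equations. *)
Definition is_pseudo_inverse (R : realType) (m n : nat)
    (A : 'M[R]_(m, n)) (B : 'M[R]_(n, m)) : Prop :=
  [/\ A *m B *m A = A,
      B *m A *m B = B,
      (A *m B)^T = A *m B
    & (B *m A)^T = B *m A].

Definition pseudo_inverse (R : realType) (m n : nat) (A : 'M[R]_(m, n)) :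
    'M[R]_(n, m) :=
  xget 0 [set B | is_pseudo_inverse A B].

Section ParametricFunction.
Context {R : realType} {p d : nat}.
Implicit Types (g : 'rV[R]_p * 'rV[R]_d -> R) (x : 'rV[R]_p) (y : 'rV[R]_d).

Definition grad_y g x y : 'rV[R]_d :=
  \row_(j < d) 'D_(delta_mx ord0 j) (fun y' => g (x, y')) y.

Definition hess_yy g x y : 'M[R]_d := 'J (fun y' => grad_y g x y') y.

(** Entry (i, j) is [d^2 g / d x_i d y_j]. *)
Definition hess_xy g x y : 'M[R]_(p, d) := 'J (fun x' => grad_y g x' y) x.

Definition augmented_critical g : set ('rV[R]_p * 'rV[R]_d) :=
  [set z | grad_y g z.1 z.2 = 0].

(** [kermx] is the kernel for the action on row vectors, that is
    [Ker (hess_yy g x y)] since the Hessian of a C^2 function is symmetric. *)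
Definition parametric_Morse_Bott g : Prop :=
  Ck_on 2 setT g /\
  forall z0 : 'rV[R]_p * 'rV[R]_d, augmented_critical g z0 ->
    exists V : set ('rV[R]_p * 'rV[R]_d),
      [/\ open V, V z0,
          connected (augmented_critical g `&` V)
        & is_submanifold (p + d) 2 (p + \rank (kermx (hess_yy g z0.1 z0.2)))
            (augmented_critical g `&` V)].

Definition grad_y_lipschitz g (L : R) : Prop :=
  forall x y y', enorm (grad_y g x y - grad_y g x y') <= L * enorm (y - y').

Definition coercive (f : 'rV[R]_d -> R) : Prop :=
  forall A : R, exists r : R, forall y, r <= enorm y -> A <= f y.

(** [phi t x y], only meaningful for [0 <= t], is the gradient flow of
    [g (x, _)] started at [y]; at [t = 0] the derivative is one-sided. *)
Definition is_gradient_flow g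
    (phi : R -> 'rV[R]_p -> 'rV[R]_d -> 'rV[R]_d) : Prop :=
  forall x y,
    [/\ phi 0 x y = y,
        h^-1 *: (phi h x y - phi 0 x y) @[h --> 0^'+]
          --> - grad_y g x (phi 0 x y)
      & forall t : R, 0 < t ->
          is_derive t 1 (fun s : R => phi s x y) (- grad_y g x (phi t x y))].

Definition flow_selection (phi : R -> 'rV[R]_p -> 'rV[R]_d -> 'rV[R]_d) x y :
    'rV[R]_d :=
  lim (phi t x y @[t --> +oo]).

End ParametricFunction.

(* Main.v *)
Require Import Defs.
From HB Require Import structures.
From mathcomp Require Import all_boot all_order all_algebra.
From mathcomp Require Import all_classical all_reals all_analysis.
From mathcomp Require Import ring lra.
Set Implicit Arguments.
Unset Strict Implicit.
Unset Printing Implicit Defensive.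
Import Order.TTheory GRing.Theory Num.Theory.
Import numFieldNormedType.Exports.
Local Open Scope classical_set_scope.
Local Open Scope ring_scope.

(** Write [F] for the gradient of [g] in its second variable [y], [H] for its
    Hessian in [y], [B] for the mixed Hessian, and let [P] and [Q] be the
    orthogonal projections onto the image and the kernel of [H] at a critical
    point [z0].

    The dimension required by the Morse--Bott condition is the largest one that
    the tangent space of the critical set can have, so that this tangent space
    projects onto the product of the parameter space and of the kernel of
    [H z0]: near [z0] there is a critical point over every parameter and every
    kernel component ([critical_fibers]).  Comparing a point with this critical
    point gives three estimates.  The gradient is almost in the image of [H z0]
    and controls the distance to the critical set ([gradient_kernel_small]); the
    objective satisfies the Lojasiewicz inequality with exponent 1/2
    ([lojasiewicz]); and if [H z0] is positive semidefinite, [H] is coercive on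
    the differences of two gradients up to a term that is small when one of the
    gradients is ([gradient_difference_coercive]).

    By the Lojasiewicz inequality every trajectory has finite length, hence
    converges to a critical point ([flow_cvg]).  At a fixed time the flow is
    differentiable in the parameter because a composition of [n] Euler steps is
    affine up to a relative error of order [1 / n] ([flow_differentiable]).  Near
    a local minimizer the gradient decays exponentially along the trajectories,
    and so does the difference of the gradients along two trajectories, with a
    factor proportional to their initial distance ([flow_decay],
    [gradient_pair_decay]).  Integrating, the flow selection differs from the
    flow at a large time [s] by a map whose Lipschitz constant near [x0] is
    [c * expR (- b * s)].  A limit of differentiable maps in this Lipschitz sense
    is differentiable, and its Jacobian is the limit of the Jacobians
    ([selection_differentiable]).

    At a local minimizer [y0] the flow is at rest, and the Jacobian [J] of the
    selection is determined by two relations.  Differentiating the equation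
    [F (x, sel x) = 0] gives [J *m H z0 = - B].  Integrating the estimate that the
    gradient is almost in the image of [H z0] along the trajectories gives
    [J *m Q = 0].  Hence [J = J *m P = J *m H z0 *m pseudo_inverse (H z0)], which
    is [- (B *m pseudo_inverse (H z0))]. *)

(** * One-variable calculus *)

Section Calculus.
Context {R : realType}.
Implicit Types (a b t : R).

Lemma is_derive_continuous {W : normedModType R} (f : R -> W) t (df : W) :
  is_derive t 1 f df -> {for t, continuous f}.
Proof.
by move=> fdf; apply/differentiable_continuous/derivable1_diffP/ex_derive.
Qed.

Lemma is_derive_cvg_right {W : normedModType R} (f : R -> W) t (df : W) :
  is_derive t 1 f df -> f s @[s --> t^'+] --> f t.
Proof. by move=> /is_derive_continuous fc; exact: cvg_at_right_filter. Qed.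

Lemma is_derive_within_continuous {W : normedModType R} (f f' : R -> W) a b :
  a < b -> (forall t, a < t -> t <= b -> is_derive t 1 f (f' t)) ->
  f s @[s --> a^'+] --> f a -> {within `[a, b], continuous f}.
Proof.
move=> ab df fa; apply/continuous_within_itvP => //; split => //.
- move=> t; rewrite in_itv/= => /andP[at_ tb].
  exact: is_derive_continuous (df t at_ (ltW tb)).
- by apply: cvg_at_left_filter; exact: is_derive_continuous (df b ab (lexx _)).
Qed.

(** At the left end point only right continuity is required, as for a trajectory at
    its initial time. *)
Lemma derive_mean_value (f f' : R -> R) a b : a < b ->
  (forall t, a < t -> t <= b -> is_derive t 1 f (f' t)) ->
  f s @[s --> a^'+] --> f a ->
  exists2 c, a < c < b & f b - f a = f' c * (b - a).
Proof.
move=> ab df fa.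
have [||c] := @MVT R f f' a b ab.
- by move=> t; rewrite in_itv/= => /andP[at_ tb]; exact: df (ltW tb).
- exact: (is_derive_within_continuous ab df fa).
by rewrite in_itv/= => cab e; exists c.
Qed.

Lemma derive_le0_nincr (f f' : R -> R) a b : a <= b ->
  (forall t, a < t -> t <= b -> is_derive t 1 f (f' t)) ->
  (forall t, a < t -> t <= b -> f' t <= 0) ->
  f s @[s --> a^'+] --> f a -> f b <= f a.
Proof.
rewrite le_eqVlt => /predU1P[-> //|ab] df f'0 fa.
have [c /andP[ac cb] e] := derive_mean_value ab df fa.
by rewrite -subr_le0 e mulr_le0_ge0 ?f'0 ?subr_ge0 // ltW.
Qed.

Lemma is_derive_expR_affine (c T t : R) :
  is_derive t 1 (fun s => expR (c * (s - T))) (c * expR (c * (t - T))).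
Proof.
have hb : is_derive t 1 (fun s : R => c * (s - T)) c.
  by apply: is_derive_eq; rewrite /GRing.scale/= ?subr0 ?mulr1 ?mulr0 ?addr0.
by rewrite mulrC; exact: (@is_derive1_comp R expR (fun s : R => c * (s - T)) t _ c).
Qed.

Lemma is_derive_coord {V : normedModType R} {m n} (M : V -> 'M[R]_(m, n))
    (x v : V) (dM : 'M[R]_(m, n)) i j :
  is_derive x v M dM -> is_derive x v (fun y => M y i j) (dM i j).
Proof.
move=> h; have Mx : derivable M x v := @ex_derive _ _ _ _ _ _ _ h.
apply: DeriveDef; first by move/derivable_mxP: Mx; apply.
by rewrite -(@derive_val _ _ _ _ _ _ _ h) derive_mx // mxE.
Qed.

End Calculus.

(** * Sup norm and Euclidean product on matrices *)

Section Norms.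
Context {R : realType}.

Lemma mx_entry_le {m n} (A : 'M[R]_(m, n)) i j : `|A i j| <= `|A|.
Proof.
rewrite [leRHS]/Num.Def.normr/= mx_normrE.
exact: (le_bigmax _ (fun ij => `|A ij.1 ij.2|) (i, j)).
Qed.

Lemma mx_norm_le {m n} (A : 'M[R]_(m, n)) c :
  0 <= c -> (forall i j, `|A i j| <= c) -> `|A| <= c.
Proof.
move=> c0 Ac; rewrite [leLHS]/Num.Def.normr/= mx_normrE.
by apply: bigmax_le => // -[i j] _; exact: Ac.
Qed.

Lemma mx_norm_attained {n} (v : 'rV[R]_n) : v != 0 -> exists i, `|v| = `|v ord0 i|.
Proof.
move=> v0; have : mx_norm v != 0 by rewrite -[mx_norm v]/(`|v|) normr_eq0.
by move=> /mx_norm_neq0[[i j] e]; exists j; rewrite [LHS]e/= ord1.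
Qed.

Lemma mulmx_norm {k m n} (A : 'M[R]_(k, m)) (B : 'M[R]_(m, n)) :
  `|A *m B| <= m%:R * `|A| * `|B|.
Proof.
apply: mx_norm_le => [|i j]; first by rewrite !mulr_ge0.
rewrite mxE (le_trans (ler_norm_sum _ _ _)) //.
rewrite (@le_trans _ _ (\sum_(l < m) `|A| * `|B|)) //.
  by apply: ler_sum => l _; rewrite normrM ler_pM // mx_entry_le.
by rewrite sumr_const card_ord -[leLHS]mulr_natl mulrA.
Qed.

Lemma mulmx_norm_le {k m n} (B : 'M[R]_(m, n)) (c : R) :
  `|B| <= c -> forall A : 'M[R]_(k, m), `|A *m B| <= m%:R * c * `|A|.
Proof.
move=> Bc A; rewrite (le_trans (mulmx_norm _ _)) //.
by rewrite mulrAC ler_wpM2r // ler_wpM2l.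
Qed.

Definition dot {n} (u v : 'rV[R]_n) : R := \sum_i u ord0 i * v ord0 i.

Lemma dotE {n} (u v : 'rV[R]_n) : dot u v = (u *m v^T) ord0 ord0.
Proof. by rewrite mxE; apply: eq_bigr => i _; rewrite mxE. Qed.

Lemma dotC {n} (u v : 'rV[R]_n) : dot u v = dot v u.
Proof. by apply: eq_bigr => i _; rewrite mulrC. Qed.

Lemma dotDl {n} (u v w : 'rV[R]_n) : dot (u + v) w = dot u w + dot v w.
Proof. by rewrite !dotE mulmxDl mxE. Qed.

Lemma dotDr {n} (u v w : 'rV[R]_n) : dot w (u + v) = dot w u + dot w v.
Proof. by rewrite dotC dotDl !(dotC _ w). Qed.

Lemma dotNl {n} (u v : 'rV[R]_n) : dot (- u) v = - dot u v.
Proof. by rewrite !dotE mulNmx mxE. Qed.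

Lemma dotNr {n} (u v : 'rV[R]_n) : dot u (- v) = - dot u v.
Proof. by rewrite dotC dotNl dotC. Qed.

Lemma dotZl {n} k (u v : 'rV[R]_n) : dot (k *: u) v = k * dot u v.
Proof. by rewrite !dotE -scalemxAl mxE. Qed.

Lemma dotZr {n} k (u v : 'rV[R]_n) : dot u (k *: v) = k * dot u v.
Proof. by rewrite dotC dotZl dotC. Qed.

Lemma dot0l {n} (v : 'rV[R]_n) : dot 0 v = 0.
Proof. by rewrite dotE mul0mx mxE. Qed.

Lemma dot_mulmx {m n} (u : 'rV[R]_m) (A : 'M[R]_(m, n)) (v : 'rV[R]_n) :
  dot (u *m A) v = dot u (v *m A^T).
Proof. by rewrite !dotE trmx_mul trmxK mulmxA. Qed.

Lemma dot_ge0 {n} (u : 'rV[R]_n) : 0 <= dot u u.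
Proof. by apply: sumr_ge0 => i _; rewrite -expr2 sqr_ge0. Qed.

Lemma norm_dot {n} (u v : 'rV[R]_n) : `|dot u v| <= n%:R * `|u| * `|v|.
Proof.
rewrite dotE (le_trans (mx_entry_le _ _ _)) // (le_trans (mulmx_norm _ _)) //.
rewrite ler_wpM2l ?mulr_ge0 //.
by apply: mx_norm_le => // i j; rewrite mxE mx_entry_le.
Qed.

Lemma norm_le_dot {n} (u : 'rV[R]_n) : `|u| ^+ 2 <= dot u u.
Proof.
have [->|/mx_norm_attained[i ->]] := eqVneq u 0.
  by rewrite normr0 expr0n dot_ge0.
rewrite real_normK ?num_real // /dot (bigD1 i) //= -expr2 lerDl.
by apply: sumr_ge0 => j _; rewrite -expr2 sqr_ge0.
Qed.

Lemma dot_le_norm {n} (u : 'rV[R]_n) : dot u u <= n%:R * `|u| ^+ 2.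
Proof. by rewrite (le_trans (ler_norm _)) // (le_trans (norm_dot _ _)) // -mulrA. Qed.

Lemma enorm_sqr {n} (u : 'rV[R]_n) : enorm u ^+ 2 = dot u u.
Proof.
rewrite /enorm sqr_sqrtr; first by apply: eq_bigr => i _; rewrite expr2.
by apply: sumr_ge0 => i _; rewrite sqr_ge0.
Qed.

Lemma is_derive_dot {V : normedModType R} {n} (u v : V -> 'rV[R]_n)
    (x h : V) (du dv : 'rV[R]_n) :
  is_derive x h u du -> is_derive x h v dv ->
  is_derive x h (fun y => dot (u y) (v y)) (dot du (v x) + dot (u x) dv).
Proof.
move=> hu hv.
have -> : (fun y => dot (u y) (v y)) =
    \sum_(i < n) ((fun y => u y ord0 i) * (fun y => v y ord0 i)).
  by apply/funext => y; rewrite fct_sumE.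
have hi i : is_derive x h ((fun y => u y ord0 i) * (fun y => v y ord0 i))
    (du ord0 i * v x ord0 i + u x ord0 i * dv ord0 i).
  have h1 := is_derive_coord ord0 i hu; have h2 := is_derive_coord ord0 i hv.
  apply: is_derive_eq; rewrite /GRing.scale/= addrC.
  by rewrite [X in X + _]mulrC.
by apply: is_derive_eq (is_derive_sum hi) _; rewrite big_split.
Qed.

(** The length of the curve is bounded by the total decrease of [M]: an affine [M]
    covers bounded speed, an exponential one integrable speed, and a function of
    the objective covers the trajectories of a gradient flow.  As the norm is the
    sup norm, the comparison is made on each coordinate. *)
Lemma length_le {n} (u u' : R -> 'rV[R]_n) (M M' : R -> R) (a b : R) :
  a <= b ->
  (forall t, a < t -> t <= b -> is_derive t 1 u (u' t)) ->
  u s @[s --> a^'+] --> u a ->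
  (forall t, a < t -> t <= b -> is_derive t 1 M (M' t)) ->
  M s @[s --> a^'+] --> M a ->
  (forall t, a < t -> t <= b -> `|u' t| <= - M' t) ->
  `|u b - u a| <= M a - M b.
Proof.
move=> ab du ua dM Ma le.
have MaMb : M b <= M a.
  apply: (derive_le0_nincr ab dM) => // t at_ tb.
  by rewrite -oppr_ge0 (le_trans _ (le t at_ tb)).
apply: mx_norm_le => [|i j]; first by rewrite subr_ge0.
have ucoord : u s i j @[s --> a^'+] --> u a i j.
  by apply: (@cvg_comp _ _ _ u (fun A : 'rV[R]_n => A i j) _ _ _ ua); exact: coord_continuous.
rewrite !mxE ler_norml opprB !lerBrDr addrAC; apply/andP; split.
- have : (M b - u b i j) <= (M a - u a i j); last by lra.
  apply: (@derive_le0_nincr _ (fun t => M t - u t i j) (fun t => M' t - u' t i j)) => //.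
  + move=> t at_ tb; have h1 := dM t at_ tb.
    have h2 := is_derive_coord i j (du t at_ tb); exact: is_deriveB.
  + move=> t at_ tb; have := le t at_ tb; have := mx_entry_le (u' t) i j.
    by rewrite ler_norml => /andP[? _] ?; lra.
  + exact: cvgB.
- have : (M b + u b i j) <= (M a + u a i j); last by lra.
  apply: (@derive_le0_nincr _ (fun t => M t + u t i j) (fun t => M' t + u' t i j)) => //.
  + move=> t at_ tb; have h1 := dM t at_ tb.
    have h2 := is_derive_coord i j (du t at_ tb); exact: is_deriveD.
  + move=> t at_ tb; have := le t at_ tb; have := mx_entry_le (u' t) i j.
    by rewrite ler_norml => /andP[_ ?] ?; lra.
  + exact: cvgD.
Qed.

Lemma speed_le {n} (u u' : R -> 'rV[R]_n) (C a b : R) :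
  a <= b ->
  (forall t, a < t -> t <= b -> is_derive t 1 u (u' t)) ->
  u s @[s --> a^'+] --> u a ->
  (forall t, a < t -> t <= b -> `|u' t| <= C) ->
  `|u b - u a| <= C * (b - a).
Proof.
move=> ab du ua le.
have dM (t : R) : is_derive t 1 (fun s => - (C * s)) (- C).
  by apply: is_derive_eq; rewrite /GRing.scale/= ?mulr0 ?addr0 mulr1.
rewrite (le_trans (length_le ab du ua (fun t _ _ => dM t)
  (is_derive_cvg_right (dM a)) _)) //; last by lra.
by move=> t at_ tb; rewrite opprK le.
Qed.

(** The function [(f t + c / k) * expR (- k * (t - a))] is nonincreasing. *)
Lemma gronwall (f f' : R -> R) (a b k c : R) : a <= b -> 0 < k ->
  (forall t, a < t -> t <= b -> is_derive t 1 f (f' t)) ->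
  f s @[s --> a^'+] --> f a ->
  (forall t, a < t -> t <= b -> f' t <= k * f t + c) ->
  f b + c / k <= (f a + c / k) * expR (k * (b - a)).
Proof.
move=> ab k0 df fa le.
have dE (t : R) : is_derive t 1 (fun s => expR (- k * (s - a))) (expR (- k * (t - a)) * (- k)).
  by rewrite mulrC; exact: is_derive_expR_affine.
have := @derive_le0_nincr _ (fun t => (f t + c / k) * expR (- k * (t - a)))
  (fun t => (f t + c / k) * (expR (- k * (t - a)) * (- k)) +
            expR (- k * (t - a)) * (f' t)) a b ab.
have e0 : expR (- k * (a - a)) = 1 by rewrite subrr mulr0 expR0.
rewrite e0 mulr1 mulNr => /(_ _ _ _)/wrap[||| h].
- move=> t at_ tb; have h1 := df t at_ tb; have h2 := dE t.
  have h3 : is_derive t 1 (fun s => f s + c / k) (f' t).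
    by apply: is_derive_eq; rewrite addr0.
  by apply: is_derive_eq; rewrite /GRing.scale.
- move=> t at_ tb; rewrite mulrCA -mulrDr pmulr_rle0 ?expR_gt0 //.
  have := le t at_ tb; have : c / k * k = c by rewrite divfK ?gt_eqF.
  by nra.
- rewrite -[X in _ --> X]mulr1 -e0; apply: cvgM; first by apply: cvgD => //; exact: cvg_cst.
  exact: is_derive_cvg_right (dE a).
rewrite -ler_pdivrMr ?expR_gt0 // -expRN; exact: h.
Qed.

End Norms.

(** * Mean value inequalities and local Lipschitz bounds *)

Section MeanValue.
Context {R : realType}.

Lemma is_derive_line {V W : normedModType R} (f : V -> W) (x v : V) (t : R) :
  derivable f (x + t *: v) v ->
  is_derive t 1 (fun s => f (x + s *: v)) ('D_v f (x + t *: v)).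
Proof.
have e : (fun h : R => h^-1 *: (((fun s => f (x + s *: v)) \o shift t) (h *: 1)
    - f (x + t *: v))) =
  (fun h : R => h^-1 *: ((f \o shift (x + t *: v)) (h *: v) - f (x + t *: v))).
  apply/funext => h /=; congr (_ *: (f _ - _)).
  by rewrite [h%:A]mulr1 scalerDl addrCA.
move=> df; split; first by rewrite /derivable e.
by rewrite /derive e.
Qed.

Lemma segment_mean_value {V : normedModType R} (f : V -> R) (a b : V) :
  (forall t : R, 0 <= t <= 1 -> derivable f (b + t *: (a - b)) (a - b)) ->
  exists2 t : R, 0 < t < 1 & f a - f b = 'D_(a - b) f (b + t *: (a - b)).
Proof.
move=> df.
have dl (t : R) : 0 <= t <= 1 -> is_derive t 1 (fun s => f (b + s *: (a - b)))
    ('D_(a - b) f (b + t *: (a - b))) by move=> /df; exact: is_derive_line.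
have [t t01 e] := derive_mean_value (@ltr01 R)
  (fun t t0 t1 => dl t (introT andP (conj (ltW t0) t1)))
  (is_derive_cvg_right (dl 0 (introT andP (conj (lexx _) ler01)))).
exists t => //; move: e.
by rewrite scale1r scale0r addr0 subr0 mulr1 addrCA subrr addr0.
Qed.

Lemma segment_mean_value_le {V : normedModType R} {m} (f : V -> 'rV[R]_m)
    (a b : V) (w : 'rV[R]_m) :
  (forall t : R, 0 <= t <= 1 -> derivable f (b + t *: (a - b)) (a - b)) ->
  exists2 t : R, 0 < t < 1 &
    `|f a - f b - w| <= `|'D_(a - b) f (b + t *: (a - b)) - w|.
Proof.
move=> df; have [->|] := eqVneq (f a - f b - w) 0.
  by exists 2^-1; [apply/andP; split; lra|rewrite normr0].
move=> /mx_norm_attained[i ->].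
have [|t t01 e] := @segment_mean_value V (fun x => f x ord0 i) a b.
  by move=> t /df /derivable_mxP; apply.
exists t => //.
have t01' : 0 <= t <= 1 by case/andP: t01 => *; rewrite !ltW.
have := is_derive_coord ord0 i (derivableP (df t t01')) => h.
apply: le_trans (mx_entry_le _ ord0 i).
by rewrite !mxE e (@derive_val _ _ _ _ _ _ _ h).
Qed.

Lemma is_derive_fst {V W1 W2 : normedModType R} (f : V -> W1 * W2) (x v : V) :
  derivable f x v -> is_derive x v (fun y => (f y).1) ('D_v f x).1.
Proof.
move=> df; have h : (fun h : R => h^-1 *: ((f (h *: v + x)).1 - (f x).1)) @ 0^' --> ('D_v f x).1.
  exact: (cvg_comp _ _ df (@cvg_fst _ _ _ _ _)).
by apply: DeriveDef; [apply/cvg_ex; exists ('D_v f x).1|exact: cvg_lim h].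
Qed.

Lemma is_derive_snd {V W1 W2 : normedModType R} (f : V -> W1 * W2) (x v : V) :
  derivable f x v -> is_derive x v (fun y => (f y).2) ('D_v f x).2.
Proof.
move=> df; have h : (fun h : R => h^-1 *: ((f (h *: v + x)).2 - (f x).2)) @ 0^' --> ('D_v f x).2.
  exact: (cvg_comp _ _ df (@cvg_snd _ _ _ _ _)).
by apply: DeriveDef; [apply/cvg_ex; exists ('D_v f x).2|exact: cvg_lim h].
Qed.

(** Vector-valued functions satisfy no mean value equality.  The inequality holds
    when the norm is a maximum of coordinates: the point is the one given by a
    coordinate at which the norm is attained. *)
Definition mean_value_space (W : normedModType R) : Prop :=
  forall (V : normedModType R) (f : V -> W) (a b : V) (w : W),
  (forall t : R, 0 <= t <= 1 -> derivable f (b + t *: (a - b)) (a - b)) ->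
  exists2 t : R, 0 < t < 1 &
    `|f a - f b - w| <= `|'D_(a - b) f (b + t *: (a - b)) - w|.

Lemma mean_value_space_rV m : mean_value_space 'rV[R]_m.
Proof. by move=> V f a b w; exact: segment_mean_value_le. Qed.

Lemma mean_value_space_pair (W1 W2 : normedModType R) :
  mean_value_space W1 -> mean_value_space W2 -> mean_value_space (W1 * W2)%type.
Proof.
move=> mv1 mv2 V f a b w df.
have [l|l] := leP `|(f a - f b - w).1| `|(f a - f b - w).2|.
- have [|t t01 h] := mv2 V (fun x => (f x).2) a b w.2.
    by move=> t /df /is_derive_snd h; exact: (@ex_derive _ _ _ _ _ _ _ h).
  have t01' : 0 <= t <= 1 by case/andP: t01 => *; rewrite !ltW.
  exists t => //; rewrite [leLHS]prod_normE /= max_r //; apply: le_trans h _.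
  rewrite (@derive_val _ _ _ _ _ _ _ (is_derive_snd (df t t01'))).
  by rewrite [leRHS]prod_normE /= le_max lexx orbT.
- have [|t t01 h] := mv1 V (fun x => (f x).1) a b w.1.
    by move=> t /df /is_derive_fst h; exact: (@ex_derive _ _ _ _ _ _ _ h).
  have t01' : 0 <= t <= 1 by case/andP: t01 => *; rewrite !ltW.
  exists t => //; rewrite [leLHS]prod_normE /= (max_l (ltW l)); apply: le_trans h _.
  rewrite (@derive_val _ _ _ _ _ _ _ (is_derive_fst (df t t01'))).
  by rewrite [leRHS]prod_normE /= le_max lexx.
Qed.

Lemma segment_in_ball {V : normedModType R} (c a b : V) (r t : R) :
  0 <= t <= 1 -> `|a - c| <= r -> `|b - c| <= r -> `|b + t *: (a - b) - c| <= r.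
Proof.
move=> /andP[t0 t1] ar br.
have -> : b + t *: (a - b) - c = t *: (a - c) + (1 - t) *: (b - c).
  rewrite scalerBl scale1r [RHS]addrCA -scalerBr addrAC; congr (_ + _ *: _).
  by rewrite opprB addrA subrK.
rewrite (le_trans (ler_normD _ _)) // !normrZ (ger0_norm t0).
rewrite ger0_norm ?subr_ge0 //.
have : t * `|a - c| <= t * r by rewrite ler_wpM2l.
have : (1 - t) * `|b - c| <= (1 - t) * r by rewrite ler_wpM2l ?subr_ge0.
lra.
Qed.

End MeanValue.

(** The setting in which bounds on finitely many partial derivatives control a
    whole differential. *)
Definition coordinates {R : realType} {V : normedModType R} {I : finType}
    (e : I -> V) (c : V -> I -> R) : Prop :=
  (forall v, v = \sum_i c v i *: e i) /\ (forall v i, `|c v i| <= `|v|).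

Section Coordinates.
Context {R : realType}.

Lemma coordinates_rV n :
  coordinates (fun i : 'I_n => delta_mx ord0 i : 'rV[R]_n) (fun v i => v ord0 i).
Proof.
split=> [v|v i]; first exact: row_sum_delta.
exact: mx_entry_le.
Qed.

Definition pair_basis p d (k : 'I_p + 'I_d) : 'rV[R]_p * 'rV[R]_d :=
  match k with
  | inl i => (delta_mx ord0 i, 0)
  | inr j => (0, delta_mx ord0 j)
  end.

Definition pair_coord p d (z : 'rV[R]_p * 'rV[R]_d) (k : 'I_p + 'I_d) : R :=
  match k with
  | inl i => z.1 ord0 i
  | inr j => z.2 ord0 j
  end.

Lemma sum_pair {V W : zmodType} {I : finType} (a : I -> V) (b : I -> W) :
  \sum_i (a i, b i) = (\sum_i a i, \sum_i b i).
Proof. by elim/big_ind3: _ => // x1 x2 x3 y1 y2 y3 -> ->. Qed.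

Lemma norm_fst {V W : normedModType R} (z : V * W) : `|z.1| <= `|z|.
Proof. by rewrite prod_normE /= le_max lexx. Qed.

Lemma norm_snd {V W : normedModType R} (z : V * W) : `|z.2| <= `|z|.
Proof. by rewrite prod_normE /= le_max lexx orbT. Qed.

Lemma coordinates_pair p d : coordinates (@pair_basis p d) (@pair_coord p d).
Proof.
split=> [[x y]|z [i|j]]; last 2 first.
- exact: le_trans (mx_entry_le _ _ _) (norm_fst z).
- exact: le_trans (mx_entry_le _ _ _) (norm_snd z).
rewrite big_sumType /=.
have -> : \sum_i x ord0 i *: ((delta_mx ord0 i, 0) : 'rV[R]_p * 'rV[R]_d) = (x, 0).
  rewrite {2}(row_sum_delta x) (eq_bigr (fun i => (x ord0 i *: delta_mx ord0 i, 0))).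
    by rewrite sum_pair big1_eq.
  by move=> i _; congr (_, _); rewrite scaler0.
have -> : \sum_i y ord0 i *: ((0, delta_mx ord0 i) : 'rV[R]_p * 'rV[R]_d) = (0, y).
  rewrite {2}(row_sum_delta y) (eq_bigr (fun i => (0, y ord0 i *: delta_mx ord0 i))).
    by rewrite sum_pair big1_eq.
  by move=> i _; congr (_, _); rewrite scaler0.
by congr (_, _); rewrite ?addr0 ?add0r.
Qed.

Context {V : normedModType R} {I : finType} {e : I -> V} {c : V -> I -> R}.
Hypothesis ec : coordinates e c.

Lemma derive_coordinates {W : normedModType R} (f : V -> W) x v :
  differentiable f x -> 'D_v f x = \sum_i c v i *: 'D_(e i) f x.
Proof.
move=> df; rewrite deriveE // {1}(ec.1 v) linear_sum.
by apply: eq_bigr => i _; rewrite linearZ deriveE.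
Qed.

(** Along a segment near [u0] the partial derivatives are close to those at [u0],
    hence so is the differential in the mean value inequality. *)
Lemma strictly_differentiable {W : normedModType R} (f : V -> W) (A : set V)
    (u0 : V) (eps : R) : mean_value_space W -> open A -> Ck_on 1 A f -> A u0 -> 0 < eps ->
  exists2 del : R, 0 < del & forall a b, `|a - u0| < del -> `|b - u0| < del ->
    [/\ A a, A b & `|f a - f b - 'd f u0 (a - b)| <= eps * `|a - b|].
Proof.
move=> mvW oA [df cf] Au0 eps0.
pose k : R := (#|I|.+1)%:R.
have k0 : 0 < k by rewrite ltr0n.
have near_i : \forall x \near u0,
    A x /\ forall i, `|'D_(e i) f x - 'D_(e i) f u0| <= eps / k.
  apply: filterI; first exact: open_nbhs_nbhs.
  apply: filter_forall => i.
  have := cf (e i) u0 Au0 => /cvgrPdist_le /(_ (eps / k)).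
  rewrite divr_gt0 // => /(_ isT); apply: filterS => x.
  by rewrite distrC.
move/nbhs_ballP: near_i => [del /= del0 hdel].
exists del => // a b aD bD.
have inA x : `|x - u0| < del -> A x /\ forall i, `|'D_(e i) f x - 'D_(e i) f u0| <= eps / k.
  by move=> xD; apply: hdel; rewrite -ball_normE /= distrC.
split; [exact: (inA a aD).1|exact: (inA b bD).1|].
have seg (t : R) : 0 <= t <= 1 -> `|b + t *: (a - b) - u0| < del.
  move=> t01; apply: le_lt_trans (_ : Num.max `|a - u0| `|b - u0| < del).
    by apply: segment_in_ball => //; rewrite le_max lexx ?orbT.
  by rewrite gt_max aD bD.
have [|t /andP[t0 t1]] := mvW V f a b ('d f u0 (a - b)).
  by move=> t /seg /inA[At _]; apply/diff_derivable/df.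
move=> le; apply: le_trans le _.
have t01 : 0 <= t <= 1 by rewrite !ltW.
have [Ax hx] := inA _ (seg t t01).
rewrite -deriveE; last exact: df.
rewrite !derive_coordinates; [|exact: df..].
rewrite -sumrB (le_trans (ler_norm_sum _ _ _)) //.
rewrite (@le_trans _ _ (\sum_(i : I) `|a - b| * (eps / k))) //.
  apply: ler_sum => i _; rewrite -scalerBr normrZ ler_pM //.
  exact: ec.2.
rewrite sumr_const -[leLHS]mulr_natl mulrCA mulrC ler_wpM2r //.
rewrite mulrCA ger_pMr // ler_pdivrMr // mul1r.
by rewrite ler_nat leqnSn.
Qed.

Hypothesis cpt : forall r : R, compact [set v : V | `|v| <= r].

Lemma continuous_bounded_ball {W : normedModType R} (f : V -> W) (r : R) :
  continuous f -> exists2 C : R, 0 <= C & forall v, `|v| <= r -> `|f v| <= C.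
Proof.
move=> cf; have [r0|r0] := ltP r 0.
  by exists 0 => // v vr; have := le_lt_trans vr r0; rewrite normr_lt0.
have : compact (f @` [set v : V | `|v| <= r]).
  by apply: continuous_compact => //; apply: continuous_subspaceT.
move=> /compact_bounded[M [_ hM]].
have hb v : `|v| <= r -> `|f v| <= `|M| + 1.
  move=> vr; apply: hM; last by exists v.
  by rewrite (le_lt_trans (ler_norm M)) // ltrDl.
by exists (`|M| + 1) => //; rewrite addr_ge0.
Qed.

Lemma C1_lipschitz_ball (f : V -> R) (r : R) : Ck_on 1 setT f ->
  exists2 C : R, 0 <= C & forall a b, `|a| <= r -> `|b| <= r ->
    `|f a - f b| <= C * `|a - b|.
Proof.
move=> [df cf].
have /choice[C hC] (i : I) : exists C : R, 0 <= C /\ forall v, `|v| <= r -> `|'D_(e i) f v| <= C.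
  have [|C C0 hC] := @continuous_bounded_ball _ ('D_(e i) f) r; last by exists C.
  by move=> x; exact: cf.
exists (\sum_i C i); first by apply: sumr_ge0 => i _; case: (hC i).
move=> a b ar br.
have [t|t /andP[t0 t1] ->] := @segment_mean_value R V f a b.
  by move=> _; exact/diff_derivable/df.
have xr : `|b + t *: (a - b)| <= r.
  have := @segment_in_ball R V 0 a b r t; rewrite !subr0; apply => //.
  by rewrite !ltW.
rewrite derive_coordinates; last exact: df.
rewrite (le_trans (ler_norm_sum _ _ _)) // mulr_suml; apply: ler_sum => i _.
by rewrite normrZ mulrC ler_pM //; [case: (hC i) => _; apply|exact: ec.2].
Qed.

Lemma C1_mx_lipschitz_ball {m n} (f : V -> 'M[R]_(m, n)) (r : R) :
  (forall i j, Ck_on 1 setT (fun v => f v i j)) ->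
  exists2 C : R, 0 <= C & forall a b, `|a| <= r -> `|b| <= r ->
    `|f a - f b| <= C * `|a - b|.
Proof.
move=> cf.
have /choice[C hC] (ij : 'I_m * 'I_n) : exists C : R, 0 <= C /\
    forall a b, `|a| <= r -> `|b| <= r ->
    `|f a ij.1 ij.2 - f b ij.1 ij.2| <= C * `|a - b|.
  by have [C C0 hC] := @C1_lipschitz_ball _ r (cf ij.1 ij.2); exists C.
exists (\sum_ij C ij); first by apply: sumr_ge0 => i _; case: (hC i).
move=> a b ar br; apply: mx_norm_le => [|i j].
  by rewrite mulr_ge0 // sumr_ge0 // => k _; case: (hC k).
rewrite !mxE; have [_ /(_ a b ar br)/= h] := hC (i, j); apply: le_trans h _.
rewrite ler_wpM2r // (bigD1 (i, j)) //= lerDl.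
by apply: sumr_ge0 => k _; case: (hC k).
Qed.

End Coordinates.

Section CompactBalls.
Context {R : realType}.

Lemma compact_ball_rV n (r : R) : compact [set v : 'rV[R]_n | `|v| <= r].
Proof.
apply: bounded_closed_compact.
  by exists r; split; [exact: num_real|move=> M rM v /= vr; rewrite (le_trans vr) // ltW].
rewrite (_ : [set v | _] = (fun v : 'rV[R]_n => `|v|) @^-1` [set x : R | x <= r]) //.
apply: closed_comp => [x _|]; first exact: norm_continuous.
exact: closed_le.
Qed.

Lemma compact_ball_pair p d (r : R) :
  compact [set z : 'rV[R]_p * 'rV[R]_d | `|z| <= r].
Proof.
rewrite (_ : [set z | _] = [set v | `|v| <= r] `*` [set v | `|v| <= r]).
  by apply: compact_setX; exact: compact_ball_rV.
by apply/seteqP; split => -[x y] /=; rewrite prod_normE /= ge_max => /andP.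
Qed.

End CompactBalls.

(** * Second-order calculus of the objective *)

Section Schwarz.
Context {R : realType}.

Lemma is_derive_comp {V W : normedModType R} (f : V -> W) (u : R -> V) (t : R) (du : V) :
  differentiable f (u t) -> is_derive t 1 u du ->
  is_derive t 1 (fun s => f (u s)) ('D_du f (u t)).
Proof.
move=> df hu.
have du' : differentiable u t by apply/derivable1_diffP; exact: ex_derive.
have dfu : differentiable (f \o u) t by exact: differentiable_comp.
apply: DeriveDef; first by apply/derivable1_diffP.
rewrite -[LHS]/('D_1 (f \o u) t) deriveE // diff_comp //= deriveE //; congr ('d f (u t) _).
by rewrite -deriveE // derive_val.
Qed.

(** Schwarz's theorem: both iterated derivatives are limits of the same second
    difference quotient. *)
Lemma derive_swap {V : normedModType R} (f : V -> R) (v w x : V) :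
  Ck_on 2 setT f -> 'D_v ('D_w f) x = 'D_w ('D_v f) x.
Proof.
move=> [df d2f].
(* the two mean value points lie in the square spanned by s v and s w *)
have second_difference (v1 w1 : V) (s : R) : 0 < s -> exists c : R * R,
    [/\ 0 <= c.1 <= s, 0 <= c.2 <= s &
    f (x + s *: v1 + s *: w1) - f (x + s *: v1) - f (x + s *: w1) + f x =
    s ^+ 2 * 'D_v1 ('D_w1 f) (x + c.1 *: v1 + c.2 *: w1)].
  move=> s0.
  pose h (t : R) := f (x + s *: v1 + t *: w1) - f (x + t *: w1).
  have dh (t : R) : is_derive t 1 h ('D_w1 f (x + s *: v1 + t *: w1) - 'D_w1 f (x + t *: w1)).
    by apply: is_deriveB; apply: is_derive_line; apply/diff_derivable/df.
  have [c2 /andP[c20 c2s]] := derive_mean_value s0 (fun t _ _ => dh t) (is_derive_cvg_right (dh 0)).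
  rewrite /h !scale0r !addr0 => e1.
  pose k (t : R) := 'D_w1 f (x + c2 *: w1 + t *: v1).
  have dk (t : R) : is_derive t 1 k ('D_v1 ('D_w1 f) (x + c2 *: w1 + t *: v1)).
    by apply: is_derive_line; apply/diff_derivable; have [/(_ _ I)] := d2f w1.
  have [c1 /andP[c10 c1s]] := derive_mean_value s0 (fun t _ _ => dk t) (is_derive_cvg_right (dk 0)).
  rewrite /k !scale0r !addr0 subr0 => e2.
  exists (c1, c2); split; rewrite ?ltW //=.
  rewrite (addrAC x (c1 *: v1)) expr2 mulrC mulrA -e2 (addrAC x (c2 *: w1)).
  by move: e1; rewrite subr0 => <-; ring.
suff key (e : R) : 0 < e -> `|'D_v ('D_w f) x - 'D_w ('D_v f) x| <= e.
  by apply/eqP; rewrite -subr_eq0 -normr_le0; apply/ler_addgt0Pl => e e0; rewrite addr0 key.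
have triangle (A B M : R) : `|A - M| <= e / 2 -> `|B - M| <= e / 2 -> `|A - B| <= e.
  by clear; rewrite !ler_norml => /andP[? ?] /andP[? ?]; apply/andP; split; lra.
move=> e0.
have e20 : 0 < e / 2 by rewrite divr_gt0.
have near_v : \forall y \near x, `|'D_v ('D_w f) x - 'D_v ('D_w f) y| <= e / 2.
  by have [_ /(_ v x I)/cvgrPdist_le] := d2f w; apply.
have near_w : \forall y \near x, `|'D_w ('D_v f) x - 'D_w ('D_v f) y| <= e / 2.
  by have [_ /(_ w x I)/cvgrPdist_le] := d2f v; apply.
move/nbhs_ballP: near_v => [d1 /= d10 hd1]; move/nbhs_ballP: near_w => [d2 /= d20 hd2].
pose del := Num.min d1 d2.
have del0 : 0 < del by rewrite lt_min d10 d20.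
pose s := del / (`|v| + `|w| + 1).
have k0 : 0 < `|v| + `|w| + 1 by rewrite ltr_wpDl // addr_ge0.
have s0 : 0 < s by rewrite divr_gt0.
have inb (c1 c2 : R) : 0 <= c1 <= s -> 0 <= c2 <= s -> ball x del (x + c1 *: v + c2 *: w).
  move=> /andP[c10 c1s] /andP[c20 c2s]; rewrite -ball_normE /= -addrA opprD addNKr normrN.
  rewrite (le_lt_trans (ler_normD _ _)) // !normrZ !ger0_norm //.
  apply: (@le_lt_trans _ _ (s * `|v| + s * `|w|)).
    by apply: lerD; apply: ler_wpM2r.
  by rewrite -mulrDr /s mulrAC ltr_pdivrMr // ltr_pM2l // ltrDl.
have [[c1 c2] /= [c1s c2s e1]] := second_difference v w s s0.
have [[c3 c4] /= [c3s c4s e2]] := second_difference w v s s0.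
have /mulfI/(_ _ _ _) inj : s ^+ 2 != 0 by rewrite expf_neq0 // gt_eqF.
have e3 : 'D_v ('D_w f) (x + c1 *: v + c2 *: w) = 'D_w ('D_v f) (x + c3 *: w + c4 *: v).
  apply: inj; rewrite -e1 -e2 (addrAC x) -!addrA; congr (_ + _).
  by rewrite addrCA.
have in1 := inb _ _ c1s c2s; have in2 := inb _ _ c4s c3s.
apply: (triangle _ _ ('D_w ('D_v f) (x + c4 *: v + c3 *: w))).
  rewrite (addrAC x (c4 *: v)) -e3; apply: hd1; apply: le_ball in1.
  by rewrite ge_min lexx.
by apply: hd2; apply: le_ball in2; rewrite ge_min lexx orbT.
Qed.

Lemma Ck_onW {V W : normedModType R} k (A : set V) (f : V -> W) :
  Ck_on k.+1 A f -> Ck_on k A f.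
Proof.
elim: k f => [|k ih] f [df d2f]; first by move=> x Ax; exact/differentiable_continuous/df.
by split => // v; apply: ih.
Qed.

End Schwarz.

Section Objective.
Context {R : realType} {p d : nat} (g : 'rV[R]_p * 'rV[R]_d -> R).
Hypothesis gC3 : Ck_on 3 setT g.
Local Notation E := ('rV[R]_p * 'rV[R]_d)%type.
Local Notation dx i := ((delta_mx ord0 i, 0) : E).
Local Notation dy j := ((0, delta_mx ord0 j) : E).

(** Uncurried, so that the differentials in both variables are those of one
    function on the product space. *)
Definition gradient (z : E) : 'rV[R]_d := grad_y g z.1 z.2.
Definition hessian (z : E) : 'M[R]_d := hess_yy g z.1 z.2.
Definition cross_hessian (z : E) : 'M[R]_(p, d) := hess_xy g z.1 z.2.

Lemma derive_snd {W : normedModType R} (f : E -> W) x (y v : 'rV[R]_d) :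
  'D_v (fun y' => f (x, y')) y = 'D_((0, v) : E) f (x, y).
Proof.
have e : (fun h : R => h^-1 *: (((fun y' => f (x, y')) \o shift y) (h *: v) - f (x, y))) =
    (fun h : R => h^-1 *: ((f \o shift ((x, y) : E)) (h *: ((0, v) : E)) - f (x, y))).
  apply/funext => h /=; congr (_ *: (f _ - _)).
  by congr (_, _); rewrite /= scaler0 add0r.
by rewrite /derive e.
Qed.

Lemma derive_fst {W : normedModType R} (f : E -> W) (x v : 'rV[R]_p) y :
  'D_v (fun x' => f (x', y)) x = 'D_((v, 0) : E) f (x, y).
Proof.
have e : (fun h : R => h^-1 *: (((fun x' => f (x', y)) \o shift x) (h *: v) - f (x, y))) =
    (fun h : R => h^-1 *: ((f \o shift ((x, y) : E)) (h *: ((v, 0) : E)) - f (x, y))).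
  apply/funext => h /=; congr (_ *: (f _ - _)).
  by congr (_, _); rewrite /= scaler0 add0r.
by rewrite /derive e.
Qed.

Lemma differentiable_snd {W : normedModType R} (f : E -> W) x (y : 'rV[R]_d) :
  differentiable f (x, y) -> differentiable (fun y' => f (x, y')) y.
Proof.
move=> df; apply: (@differentiable_comp _ _ _ _ (fun y' => (x, y')) f) => //.
Qed.

Lemma differentiable_fst {W : normedModType R} (f : E -> W) (x : 'rV[R]_p) y :
  differentiable f (x, y) -> differentiable (fun x' => f (x', y)) x.
Proof.
move=> df; apply: (@differentiable_comp _ _ _ _ (fun x' => (x', y)) f) => //.
Qed.

Lemma gradientE z j : gradient z ord0 j = 'D_(dy j) g z.
Proof. by case: z => x y; rewrite /gradient /grad_y mxE /= derive_snd. Qed.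

Lemma gradient_differentiable z : differentiable gradient z.
Proof.
have -> : gradient = \sum_(j < d) (fun z => 'D_(dy j) g z *: (delta_mx ord0 j : 'rV[R]_d)).
  apply/funext => y; rewrite fct_sumE [LHS]row_sum_delta.
  by apply: eq_bigr => j _; rewrite gradientE.
apply: differentiable_sum => j; apply: differentiableZl.
by have [_ /(_ (dy j))[/(_ _ I)]] := gC3.
Qed.

Lemma derive_gradient z v j : ('D_v gradient z) ord0 j = 'D_v ('D_(dy j) g) z.
Proof.
have h := @diff_derivable _ _ _ gradient z v (gradient_differentiable z).
rewrite derive_mx // mxE; congr ('D_v _ z).
by apply/funext => y; rewrite gradientE.
Qed.

Lemma hessianE z i j : hessian z i j = 'D_(dy i) ('D_(dy j) g) z.
Proof.
case: z => x y; rewrite /hessian /hess_yy /jacobian mxE /=.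
have h : differentiable (grad_y g x) y.
  exact: (@differentiable_snd _ gradient x y (gradient_differentiable _)).
by rewrite -(deriveE _ h) -derive_gradient -derive_snd.
Qed.

Lemma cross_hessianE z i j : cross_hessian z i j = 'D_(dx i) ('D_(dy j) g) z.
Proof.
case: z => x y; rewrite /cross_hessian /hess_xy /jacobian mxE /=.
have h : differentiable (fun x' => grad_y g x' y) x.
  exact: (@differentiable_fst _ gradient x y (gradient_differentiable _)).
by rewrite -(deriveE _ h) -derive_gradient -derive_fst.
Qed.

Lemma hessian_sym z : (hessian z)^T = hessian z.
Proof.
apply/matrixP => i j; rewrite mxE !hessianE derive_swap //.
exact: Ck_onW.
Qed.

Lemma derive_gradientE z (v : E) :
  'D_v gradient z = v.1 *m cross_hessian z + v.2 *m hessian z.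
Proof.
apply/rowP => j; rewrite derive_gradient.
have [_ /(_ (dy j))[/(_ z I) dg _]] := gC3.
rewrite (derive_coordinates (coordinates_pair p d)) // big_sumType /= !mxE.
by congr (_ + _); apply: eq_bigr => i _; rewrite ?cross_hessianE ?hessianE.
Qed.

Lemma derive_objectiveE z (v : 'rV[R]_d) : 'D_((0, v) : E) g z = dot (gradient z) v.
Proof.
have [dg _] := gC3.
rewrite (derive_coordinates (coordinates_pair p d)); last exact: dg.
rewrite big_sumType /= big1 ?add0r; last by move=> i _; rewrite mxE scale0r.
by apply: eq_bigr => j _; rewrite gradientE mulrC.
Qed.

Lemma is_derive_pair_cst (x : 'rV[R]_p) (u : R -> 'rV[R]_d) (t : R) du :
  is_derive t 1 u du -> is_derive t 1 (fun s => (x, u s) : E) (0, du).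
Proof.
move=> hu; have du' : differentiable u t by apply/derivable1_diffP; exact: ex_derive.
have dp : differentiable (fun s => (x, u s) : E) t.
  by apply: differentiable_pair => //; exact: differentiable_cst.
apply: DeriveDef; first by apply/derivable1_diffP.
rewrite deriveE // diff_pair //= ?diff_cst //; congr (_, _).
by rewrite -deriveE // derive_val.
Qed.

Lemma is_derive_gradient (x : 'rV[R]_p) (u : R -> 'rV[R]_d) (t : R) du :
  is_derive t 1 u du ->
  is_derive t 1 (fun s => gradient (x, u s)) (du *m hessian (x, u t)).
Proof.
move=> /(is_derive_pair_cst x) hu.
have := is_derive_comp (gradient_differentiable (x, u t)) hu.
by rewrite derive_gradientE /= mul0mx add0r.
Qed.

Lemma is_derive_objective (x : 'rV[R]_p) (u : R -> 'rV[R]_d) (t : R) du :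
  is_derive t 1 u du ->
  is_derive t 1 (fun s => g (x, u s)) (dot (gradient (x, u t)) du).
Proof.
move=> /(is_derive_pair_cst x) hu.
by rewrite -derive_objectiveE; apply: is_derive_comp hu; have [+ _] := gC3; apply.
Qed.

Lemma hessian_C1 i j : Ck_on 1 setT (fun z => hessian z i j).
Proof.
rewrite (_ : (fun z => _) = 'D_(dy i) ('D_(dy j) g)); last by apply/funext => z; rewrite hessianE.
by have [_ /(_ (dy j))[_ /(_ (dy i))]] := gC3.
Qed.

Lemma cross_hessian_C1 i j : Ck_on 1 setT (fun z => cross_hessian z i j).
Proof.
rewrite (_ : (fun z => _) = 'D_(dx i) ('D_(dy j) g)); last by apply/funext => z; rewrite cross_hessianE.
by have [_ /(_ (dy j))[_ /(_ (dx i))]] := gC3.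
Qed.

Lemma gradient_C1 i j : Ck_on 1 setT (fun z => gradient z i j).
Proof.
rewrite ord1 (_ : (fun z => _) = 'D_(dy j) g); last by apply/funext => z; rewrite gradientE.
by apply: Ck_onW; have [_ /(_ (dy j))] := gC3.
Qed.

(** The uniform bounds on bounded sets in which the smoothness of the objective is
    used. *)
Record local_bounds (r C : R) : Prop := {
  bounds_gt0 : 0 < C;
  hessian_bound : forall z, `|z| <= r -> `|hessian z| <= C;
  gradient_bound : forall z, `|z| <= r -> `|gradient z| <= C;
  hessian_lipschitz : forall z z', `|z| <= r -> `|z'| <= r ->
    `|hessian z - hessian z'| <= C * `|z - z'|;
  gradient_lipschitz : forall z z', `|z| <= r -> `|z'| <= r ->
    `|gradient z - gradient z'| <= C * `|z - z'|;
  gradient_taylor : forall z z', `|z| <= r -> `|z'| <= r ->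
    `|gradient z - gradient z' -
       ((z - z').1 *m cross_hessian z' + (z - z').2 *m hessian z')|
    <= C * `|z - z'| ^+ 2;
  gradient_second_difference : forall z z' (u : 'rV[R]_d),
    `|z| <= r -> `|z'| <= r -> `|u| <= r ->
    `|gradient (z + (0, u)) - gradient (z' + (0, u)) - (gradient z - gradient z')|
    <= C * `|z - z'| * `|u|;
  objective_taylor : forall x y y', `|x| <= r -> `|y| <= r -> `|y'| <= r ->
    `|g (x, y') - g (x, y) - dot (gradient (x, y)) (y' - y)| <= C * `|y' - y| ^+ 2
}.

Lemma norm_pair_le (V W : normedModType R) (a : V) (b : W) (r : R) :
  `|a| <= r -> `|b| <= r -> `|(a, b) : V * W| <= r.
Proof. by move=> ar br; rewrite prod_normE /= ge_max ar br. Qed.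

Lemma norm_pair0l (V W : normedModType R) (b : W) : `|(0, b) : V * W| = `|b|.
Proof. by rewrite prod_normE /= normr0 max_r. Qed.

(** The second derivatives are of class C^1, hence bounded and Lipschitz on balls.
    The radius is doubled so as to contain the translates [z + (0, u)]. *)
Lemma local_bounds_ex r : exists C, local_bounds r C.
Proof.
pose r2 : R := `|r| + `|r|.
have rr2 : r <= r2 by rewrite (le_trans (ler_norm r)) // lerDl.
have cp : forall s, compact [set v : E | `|v| <= s] := @compact_ball_pair R p d.
have lip m n (f : E -> 'M[R]_(m, n)) : (forall i j, Ck_on 1 setT (fun z => f z i j)) ->
    exists2 C : R, 0 <= C & (forall z, `|z| <= r2 -> `|f z| <= C) /\
      (forall a b, `|a| <= r2 -> `|b| <= r2 -> `|f a - f b| <= C * `|a - b|).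
  move=> fC; have [C C0 hC] := C1_mx_lipschitz_ball (coordinates_pair p d) cp r2 fC.
  have r20 : 0 <= r2 by rewrite addr_ge0.
  exists (C + `|f 0| + C * r2); first by rewrite !addr_ge0 // mulr_ge0.
  split=> [z zr|a b ar br].
    rewrite -[f z](subrK (f 0)) (le_trans (ler_normD _ _)) // addrC -addrA addrCA addrA.
    rewrite -addrA lerD // ler_wpDl //; apply: le_trans (hC z 0 zr _) _; rewrite ?normr0 ?subr0 //.
    by rewrite ler_wpM2l.
  by rewrite (le_trans (hC a b ar br)) // ler_wpM2r // -addrA lerDl addr_ge0 // mulr_ge0.
have [CF CF0 [Fb Fl]] := lip _ _ _ gradient_C1.
have [CH CH0 [Hb Hl]] := lip _ _ _ hessian_C1.
have [CB CB0 [Bb Bl]] := lip _ _ _ cross_hessian_C1.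
have pC : 0 <= p%:R * CB by rewrite mulr_ge0.
have dC : 0 <= d%:R * CH by rewrite mulr_ge0.
have dF : 0 <= d%:R * CF by rewrite mulr_ge0.
pose C := 1 + CF + CH + p%:R * CB + d%:R * CH + d%:R * CF.
have CFC : CF <= C by rewrite /C; lra.
have CHC : CH <= C by rewrite /C; lra.
have dHC : d%:R * CH <= C by rewrite /C; lra.
have dFC : d%:R * CF <= C by rewrite /C; lra.
have pdC : p%:R * CB + d%:R * CH <= C by rewrite /C; lra.
have up z : `|z : E| <= r -> `|z| <= r2 by move=> zr; exact: le_trans rr2.
exists C; split.
- by rewrite /C; lra.
- by move=> z /up/Hb h; exact: le_trans CHC.
- by move=> z /up/Fb h; exact: le_trans CFC.
- by move=> z z' /up zr /up z'r; rewrite (le_trans (Hl _ _ zr z'r)) // ler_wpM2r.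
- by move=> z z' /up zr /up z'r; rewrite (le_trans (Fl _ _ zr z'r)) // ler_wpM2r.
- move=> z z' /up zr /up z'r.
  have [|t /andP[t0 t1] le] := @segment_mean_value_le R _ _ gradient z z'
      ((z - z').1 *m cross_hessian z' + (z - z').2 *m hessian z').
    by move=> t _; exact/diff_derivable/gradient_differentiable.
  apply: le_trans le _; set c := z' + _.
  have cr : `|c| <= r2.
    have := @segment_in_ball R _ 0 z z' r2 t; rewrite !subr0; apply => //.
    by rewrite !ltW.
  have cz : `|c - z'| <= `|z - z'|.
    rewrite /c addrC addKr normrZ gtr0_norm // ler_piMl // ltW //.
  rewrite derive_gradientE opprD addrACA -!mulmxBr.
  rewrite (le_trans (ler_normD _ _)) // expr2 mulrA.
  rewrite (@le_trans _ _ ((p%:R * CB + d%:R * CH) * `|z - z'| * `|z - z'|)) //; last first.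
    by rewrite ler_wpM2r // ler_wpM2r.
  rewrite !mulrDl; apply: lerD; rewrite (le_trans (mulmx_norm _ _)) //.
    rewrite mulrAC -!mulrA ler_wpM2l // mulrA.
    rewrite ler_pM //; first by rewrite (le_trans (Bl _ _ cr z'r)) // ler_wpM2l.
    exact: norm_fst.
  rewrite mulrAC -!mulrA ler_wpM2l // mulrA.
  rewrite ler_pM //; first by rewrite (le_trans (Hl _ _ cr z'r)) // ler_wpM2l.
  exact: norm_snd.
- move=> z z' u zr z'r ur.
  have zE (z1 : E) (y : 'rV[R]_d) : z1 + (0, y) = (z1.1, z1.2 + y).
    by case: z1 => a b; congr (_, _); rewrite /= addr0.
  pose f (t : R) : 'rV[R]_d :=
    gradient (z.1, z.2 + t *: u) - gradient (z'.1, z'.2 + t *: u).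
  have dl (y : 'rV[R]_d) (t : R) : is_derive t 1 (fun s => y + s *: u) u.
    have := @is_derive_line R _ _ (@id 'rV[R]_d) y u t (@derivable_id _ _ _ _).
    by rewrite derive_id.
  have df (t : R) : is_derive t 1 f (u *m hessian (z.1, z.2 + t *: u)
      - u *m hessian (z'.1, z'.2 + t *: u)).
    by apply: is_deriveB; apply: is_derive_gradient.
  have [|t /andP[t0 t1]] := @segment_mean_value_le R _ _ f 1 0 0.
    by move=> t _; rewrite subr0; exact: (@ex_derive _ _ _ _ _ _ _ (df _)).
  rewrite !subr0 add0r [t *: 1]mulr1 (@derive_val _ _ _ _ _ _ _ (df _)) /f.
  rewrite !scale1r !scale0r !addr0 => le.
  rewrite !zE; move: le; rewrite -!surjective_pairing => le.
  apply: le_trans le _; rewrite -mulmxBr (le_trans (mulmx_norm _ _)) //.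
  have ball (z1 : E) : `|z1| <= r -> `|(z1.1, z1.2 + t *: u) : E| <= r2.
    move=> z1r; rewrite -zE (le_trans (ler_normD _ _)) // lerD //.
      by rewrite (le_trans z1r) // ler_norm.
    rewrite norm_pair0l normrZ gtr0_norm // (le_trans _ (le_trans ur (ler_norm r))) //.
    by rewrite ler_piMl // ltW.
  have := Hl _ _ (ball _ zr) (ball _ z'r).
  rewrite -(zE z) -(zE z') (_ : z + _ - _ = z - z'); last by rewrite opprD addrACA subrr addr0.
  move=> le.
  rewrite mulrAC ler_wpM2r //.
  rewrite (@le_trans _ _ (d%:R * (CH * `|z - z'|))) ?ler_wpM2l //.
  by rewrite mulrA ler_wpM2r.
- move=> x y y' xr yr y'r.
  have [|t /andP[t0 t1]] := @segment_mean_value R _ (fun y => g (x, y)) y' y.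
    move=> t _; apply/diff_derivable/differentiable_snd.
    by have [+ _] := gC3; apply.
  rewrite derive_snd derive_objectiveE => ->.
  rewrite -dotNl -dotDl (le_trans (norm_dot _ _)) // expr2 mulrA ler_wpM2r //.
  have br : `|(x, y + t *: (y' - y)) : E| <= r2.
    apply: up; apply: norm_pair_le => //.
    have := @segment_in_ball R _ 0 y' y r t; rewrite !subr0; apply => //.
    by rewrite !ltW.
  have yr2 : `|(x, y) : E| <= r2 by apply: up; exact: norm_pair_le.
  have := Fl _ _ br yr2.
  rewrite (_ : (x, _) - (x, y) = (0, t *: (y' - y)) :> E); last first.
    by congr (_, _); rewrite /= ?subrr // addrC addKr.
  rewrite norm_pair0l normrZ gtr0_norm // => le.
  rewrite (@le_trans _ _ (d%:R * (CF * (t * `|y' - y|)))) ?ler_wpM2l //.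
  rewrite mulrA ler_pM //; first by rewrite mulr_ge0 // ltW.
  by rewrite ler_piMl // ltW.
Qed.

End Objective.

(** * Pseudo-inverse of a symmetric matrix *)

Section PseudoInverse.
Context {R : realType}.

Lemma dot_eq0 {n} (u : 'rV[R]_n) : dot u u = 0 -> u = 0.
Proof.
move=> u0; apply/eqP; rewrite -normr_eq0 -sqrf_eq0 eq_le sqr_ge0 andbT.
by rewrite -u0 norm_le_dot.
Qed.

Lemma gram_unitmx {m n} (A : 'M[R]_(m, n)) : row_free A -> A *m A^T \in unitmx.
Proof.
move=> fA; rewrite -row_free_unit; apply: inj_row_free => v vAA.
apply: (row_free_inj fA); rewrite mul0mx; apply: dot_eq0.
by rewrite dot_mulmx -mulmxA vAA dotC dot0l.
Qed.

Lemma pseudo_inverseP {m n} (A : 'M[R]_(m, n)) :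
  is_pseudo_inverse A (pseudo_inverse A).
Proof.
suff [B AB] : exists B, is_pseudo_inverse A B by apply: (@xgetI _ _ _ _ AB).
(* the Penrose equations are solved through a full rank factorization *)
have [r [C [D [eA fC fD]]]] : exists r (C : 'M[R]_(m, r)) (D : 'M[R]_(r, n)),
    [/\ C *m D = A, row_free C^T & row_free D].
  exists (\rank A), (col_base A), (row_base A); split.
  - exact: mulmx_base.
  - by rewrite /row_free mxrank_tr; exact: col_base_full.
  - exact: row_base_free.
have uD : D *m D^T \in unitmx by exact: gram_unitmx.
have uC : C^T *m C \in unitmx by rewrite -[X in _ *m X]trmxK; exact: gram_unitmx.
pose B := D^T *m invmx (D *m D^T) *m invmx (C^T *m C) *m C^T.
have AB : A *m B = C *m invmx (C^T *m C) *m C^T.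
  by rewrite -eA /B !mulmxA -(mulmxA C D) (mulmxK uD).
have BA : B *m A = D^T *m invmx (D *m D^T) *m D.
  by rewrite -eA /B -!mulmxA (mulmxA (C^T)) (mulmxA (invmx (C^T *m C))) mulVmx // mul1mx.
have sC : (invmx (C^T *m C))^T = invmx (C^T *m C) by rewrite trmx_inv trmx_mul trmxK.
have sD : (invmx (D *m D^T))^T = invmx (D *m D^T) by rewrite trmx_inv trmx_mul trmxK.
exists B; split.
- by rewrite AB -eA -!mulmxA (mulmxA (C^T)) (mulmxA (invmx _)) mulVmx // mul1mx.
- by rewrite BA /B -!mulmxA (mulmxA D) (mulmxA (D *m _)) mulmxV // mul1mx.
- by rewrite AB !trmx_mul trmxK sC mulmxA.
- by rewrite BA !trmx_mul trmxK sD mulmxA.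
Qed.

(** The orthogonal projections onto the image and onto the kernel of a symmetric
    matrix. *)
Definition image_proj {n} (H : 'M[R]_n) : 'M[R]_n := H *m pseudo_inverse H.
Definition kernel_proj {n} (H : 'M[R]_n) : 'M[R]_n := 1%:M - image_proj H.

Context {n : nat} (H : 'M[R]_n).
Hypothesis H_sym : H^T = H.
Local Notation P := (image_proj H).
Local Notation Q := (kernel_proj H).

Lemma image_proj_tr : P^T = P.
Proof. by case: (pseudo_inverseP H). Qed.

Lemma image_proj_mull : P *m H = H.
Proof. by case: (pseudo_inverseP H). Qed.

Lemma image_proj_mulr : H *m P = H.
Proof. by rewrite -[X in X *m _]H_sym -image_proj_tr -trmx_mul image_proj_mull. Qed.

Lemma image_proj_idem : P *m P = P.
Proof. by rewrite {2}/image_proj mulmxA image_proj_mull. Qed.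

Lemma kernel_proj_mull : Q *m H = 0.
Proof. by rewrite mulmxBl mul1mx image_proj_mull subrr. Qed.

Lemma kernel_proj_mulr : H *m Q = 0.
Proof. by rewrite mulmxBr mulmx1 image_proj_mulr subrr. Qed.

Lemma kernel_proj_idem : Q *m Q = Q.
Proof.
by rewrite {1}/kernel_proj mulmxBl mul1mx /image_proj /kernel_proj mulmxBr mulmx1 image_proj_idem subrr subr0.
Qed.

Lemma image_kernel_split m (v : 'M[R]_(m, n)) : v = v *m P + v *m Q.
Proof. by rewrite -mulmxDr addrC subrK mulmx1. Qed.

Lemma image_kernel_proj0 : P *m Q = 0.
Proof. by rewrite mulmxBr mulmx1 image_proj_idem subrr. Qed.

Lemma kernel_image_proj0 : Q *m P = 0.
Proof. by rewrite mulmxBl mul1mx image_proj_idem subrr. Qed.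

Lemma rank_kernel_proj : \rank Q = \rank (kermx H).
Proof.
have e : kermx H *m Q = kermx H.
  by rewrite mulmxBr mulmx1 mulmxA mulmx_ker mul0mx subr0.
apply/eqP; rewrite eqn_leq; apply/andP; split; apply: mxrankS.
  by apply/sub_kermxP; exact: kernel_proj_mull.
by rewrite -e submxMl.
Qed.

Lemma image_proj_bound (v : 'rV[R]_n) :
  `|v *m P| <= n%:R * `|pseudo_inverse H| * `|v *m H|.
Proof. by rewrite mulmxA (le_trans (mulmx_norm _ _)) // mulrAC. Qed.

End PseudoInverse.

(** * Critical points over every direction of the kernel *)

Section MorseBott.
Context {R : realType}.

(** An inverse function argument without injectivity: [Gam] is a right inverse of
    the differential [Lam] on the image of the projection [B], in which [h] takes
    its values.  A preimage of [q] is [u *m (B *m Gam)], where [u] is the fixed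
    point of a contraction. *)
Lemma locally_onto {N : nat} (h : 'rV[R]_N -> 'rV[R]_N) (Lam Gam B : 'M[R]_N)
    (eps : R) :
  h 0 = 0 -> B *m B = B -> (forall s, h s *m B = h s) -> B *m Gam *m Lam = B ->
  (forall e : R, 0 < e -> exists2 del : R, 0 < del & forall a b,
     `|a| < del -> `|b| < del -> `|h a - h b - (a - b) *m Lam| <= e * `|a - b|) ->
  0 < eps ->
  exists2 del : R, 0 < del & forall q : 'rV[R]_N, q *m B = q -> `|q| < del ->
    exists2 a, `|a| < eps & h a = q.
Proof.
move=> h0 BB hB BGL strict eps0.
pose c : R := N%:R * `|B *m Gam| + 1.
have c0 : 0 < c by rewrite ltr_wpDl // mulr_ge0.
have [|del del0 hdel] := strict (2 * c)^-1; first by rewrite invr_gt0 mulr_gt0.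
pose r := Num.min del eps / (2 * c).
have m0 : 0 < Num.min del eps by rewrite lt_min del0 eps0.
have r0 : 0 < r by rewrite divr_gt0 // mulr_gt0.
exists (r / 2) => [|q qB qr]; first by rewrite divr_gt0.
pose a (u : 'rV[R]_N) := u *m (B *m Gam).
have aB u v : a u - a v = a (u - v) by rewrite /a mulmxBl.
have ac u : `|a u| <= c * `|u|.
  rewrite (le_trans (mulmx_norm _ _)) // mulrAC ler_wpM2r // lerDl //.
have aL u : a u *m Lam = u *m B by rewrite /a -mulmxA BGL.
have ar u : `|u| <= r -> `|a u| < Num.min del eps.
  have cr : c * r = Num.min del eps / 2.
    by rewrite /r invfM mulrCA; congr (_ * _); rewrite mulrCA mulfV ?mulr1 ?gt_eqF.
  move=> ur; apply: (le_lt_trans (ac u)); apply: (@le_lt_trans _ _ (c * r)).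
    by rewrite ler_wpM2l // ltW.
  by rewrite cr ltr_pdivrMr // ltr_pMr // ltr1n.
have adel u : `|u| <= r -> `|a u| < del by move=> /ar; rewrite lt_min => /andP[].
pose K (u : 'rV[R]_N) := q - (h (a u) - u *m B).
have KB u v : `|u| <= r -> `|v| <= r -> `|K u - K v| <= 2^-1 * `|u - v|.
  move=> ur vr.
  have -> : K u - K v = - (h (a u) - h (a v) - (a u - a v) *m Lam).
    rewrite aB aL mulmxBl /K; move: (h (a u)) (h (a v)) (u *m B) (v *m B) => *.
    by apply/rowP => i; rewrite !mxE; ring.
  rewrite normrN (le_trans (hdel _ _ (adel u ur) (adel v vr))) // aB.
  rewrite invfM -mulrA ler_wpM2l // ler_pdivrMl //; exact: ac.
have K0 : K 0 = q by rewrite /K /a !mul0mx h0 !subr0.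
have KU u : `|u| <= r -> `|K u| <= r.
  move=> ur; rewrite -[K u](subrK (K 0)) (le_trans (ler_normD _ _)) // [leRHS]splitr lerD //.
    apply: (le_trans (KB _ _ ur _)); first by rewrite normr0 ltW.
    by rewrite subr0 [leRHS]mulrC ler_wpM2l // invr_ge0.
  by rewrite K0 ltW.
pose U := [set u : 'rV[R]_N | `|u| <= r].
have KUU : {homo K : x / U x >-> U x} by move=> u; exact: KU.
pose KF : {fun U >-> U} := mkfun_fun KUU.
have KFc : is_contraction KF.
  exists (2^-1%:nng); split => /=; first by rewrite invf_lt1 // ltr1n.
  by move=> [u v] /= [uU vU]; exact: KB.
have clU : closed U.
  rewrite (_ : U = (fun v : 'rV[R]_N => `|v|) @^-1` [set x : R | x <= r]) //.
  apply: closed_comp => [x _|]; first exact: norm_continuous.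
  exact: closed_le.
have U0 : U !=set0 by exists 0; rewrite /U /= normr0 ltW.
pose X : completeNormedModType R :=
  HB.pack_for (completeNormedModType R) 'rV[R]_N (Complete.on 'rV[R]_N).
have [u ur uK] := @banach_fixed_point R X U KF KFc clU U0.
have {}uK : u = q - (h (a u) - u *m B) by exact: uK.
have uB : u *m B = u.
  by rewrite [in LHS]uK mulmxBl qB mulmxBl hB -mulmxA BB -uK.
exists (a u); first by have := ar u ur; rewrite lt_min => /andP[].
by move: uK; rewrite uB opprB addrCA -{1}[u]addr0 => /addrI/esym/eqP; rewrite subr_eq0 => /eqP.
Qed.
End MorseBott.

Section CriticalFibers.
Context {R : realType} {p d : nat} (g : 'rV[R]_p * 'rV[R]_d -> R).
Hypothesis gC3 : Ck_on 3 setT g.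
Local Notation E := ('rV[R]_p * 'rV[R]_d)%type.

Lemma near_derive_id {V : normedModType R} (f : V -> V) x v :
  (\near x, f x = x) -> 'D_v f x = v.
Proof. by move=> h; rewrite (near_eq_derive v h) derive_id. Qed.

Lemma diff_left_inverse_inj {V W : normedModType R} (Phi : W -> V) (Psi : V -> W) x v :
  (\near x, Phi (Psi x) = x) -> differentiable Psi x -> differentiable Phi (Psi x) ->
  'd Psi x v = 0 -> v = 0.
Proof.
move=> PP dPsi dPhi v0.
have <- := @near_derive_id V (Phi \o Psi) x v PP.
rewrite deriveE; last exact: differentiable_comp.
by rewrite diff_comp //= v0 linear0.
Qed.

Lemma derive_zero_line {V W : normedModType R} (f : V -> W) x v :
  (\forall t \near (0 : R), f (t *: v + x) = f x) -> 'D_v f x = 0.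
Proof.
move=> fx; apply: cvg_lim => //; apply: cvg_near_cst.
near=> t; rewrite /= (_ : f (t *: v + x) = f x) ?subrr ?scaler0 //.
by near: t; apply: nbhs_dnbhs.
Unshelve. all: by end_near. Qed.

(** Let [Psi] parametrize the critical set.  Its tangent vectors [L (s *m J)] are in
    the kernel of the differential of the gradient, hence such a vector vanishes
    as soon as its parameter component and its kernel component do: the map [T]
    that retains these two components is injective on the tangent space.  By the
    Morse--Bott condition the dimension of the tangent space is that of the range
    of [T], so that [T] maps it onto this range and [locally_onto] applies. *)
Lemma critical_fibers (z0 : E) : parametric_Morse_Bott g -> gradient g z0 = 0 ->
  forall eps : R, 0 < eps -> exists2 del : R, 0 < del &
    forall (x : 'rV[R]_p) (k : 'rV[R]_d), `|x - z0.1| < del -> `|k| < del ->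
    k *m kernel_proj (hessian g z0) = k ->
    exists w : 'rV[R]_d, [/\ w *m image_proj (hessian g z0) = w, `|w| < eps &
      gradient g (x, z0.2 + k + w) = 0].
Proof.
move=> [_ MB] Fz0 eps eps0.
set H := hessian g z0; set Q := kernel_proj H; set P := image_proj H.
have Hsym : H^T = H by exact: hessian_sym.
have [V [oV Vz0 _ [mn chart]]] := MB z0 Fz0.
have [W [Phi [Psi [[oW Wz0] oPW PsiPhi [[dPhi _] CPsi2] slice]]]] := chart z0 (conj Fz0 Vz0).
have CPsi := Ck_onW CPsi2; have [dPsi _] := CPsi2.
set m := (p + \rank (kermx H))%N in mn chart slice.
have [u0 u0E] : exists u, u = Phi z0 by exists (Phi z0).
have Psiu0 : Psi u0 = z0 by rewrite u0E PsiPhi.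
have PWu0 : (Phi @` W) u0 by rewrite u0E; exists z0.
have PP : \near u0, Phi (Psi u0) = u0.
  have : nbhs u0 (Phi @` W) by exact: open_nbhs_nbhs.
  by apply: filterS => u [z Wz <-]; rewrite PsiPhi.
pose J : 'M[R]_(p + d) := pid_mx m.
pose L : {linear 'rV[R]_(p + d) -> E} := 'd Psi u0.
have in_slice (s : 'rV[R]_(p + d)) : forall j : 'I_(p + d), (m <= j)%N -> (u0 + s *m J) ord0 j = 0.
  move=> j mj.
  have [_ /(_ j mj) u0j] : (Phi @` W `&` [set u | forall j : 'I_(p + d), (m <= j)%N -> u ord0 j = 0]) u0.
    by rewrite -slice u0E; exists z0.
  rewrite mxE u0j add0r mxE big1 // => i _; rewrite mxE.
  by case: eqP => [->|]; rewrite ?mulr0 //= ltnNge mj mulr0.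
have crit (s : 'rV[R]_(p + d)) : (Phi @` W) (u0 + s *m J) -> gradient g (Psi (u0 + s *m J)) = 0.
  move=> Ws; have : (Phi @` W `&` [set u | forall j : 'I_(p + d), (m <= j)%N -> u ord0 j = 0]) (u0 + s *m J).
    by split => //; exact: in_slice.
  by rewrite -slice => -[z [[Mz _] Wz] <-]; rewrite PsiPhi.
have LJ_inj s : L (s *m J) = 0 -> s *m J = 0.
  apply: (diff_left_inverse_inj PP); first exact: dPsi.
  by rewrite Psiu0; exact: dPhi.
(* tangent vectors of the critical set are in the kernel of the second differential *)
have LJ_ker s : (L (s *m J)).1 *m cross_hessian g z0 + (L (s *m J)).2 *m H = 0.
  rewrite -(derive_gradientE gC3) deriveE; last exact: gradient_differentiable.
  have <- : 'D_(s *m J) (gradient g \o Psi) u0 = 0.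
    apply: derive_zero_line.
    have : nbhs u0 (Phi @` W) by exact: open_nbhs_nbhs.
    have : (fun t : R => t *: (s *m J) + u0) @ (0 : R) --> u0.
      rewrite -[X in _ --> X]add0r -(scale0r (s *m J)).
      by apply: cvgD; [apply: cvgZl|exact: cvg_cst].
    move=> c nW.
    have nt : \forall t \near (0 : R), (Phi @` W) (t *: (s *m J) + u0) by exact: c.
    apply: filterS nt => t /= Wt.
    by rewrite Psiu0 Fz0 addrC scalemxAl; apply: crit; rewrite -scalemxAl addrC.
  rewrite deriveE; last first.
    by apply: differentiable_comp; [exact: dPsi|exact: gradient_differentiable].
  rewrite (diff_comp (dPsi u0 PWu0)); last exact: gradient_differentiable.
  by rewrite /= Psiu0.
pose T (z : E) : 'rV[R]_(p + d) := row_mx z.1 (z.2 *m Q).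
have TB z z' : T z - T z' = T (z - z').
  by rewrite /T opp_row_mx add_row_mx mulmxBl.
have TD z z' : T z + T z' = T (z + z') by rewrite /T add_row_mx mulmxDl.
have TZ k z : T (k *: z) = k *: T z by rewrite /T scale_row_mx scalemxAl.
pose cT : R := 1 + d%:R * `|Q|.
have T_le z : `|T z| <= cT * `|z|.
  apply: mx_norm_le => [|i j]; first by rewrite mulr_ge0 // addr_ge0 // mulr_ge0.
  rewrite mulrDl mul1r /T; case: (split_ordP j) => k ->.
    rewrite row_mxEl ler_wpDr ?mulr_ge0 //.
    by rewrite (le_trans (mx_entry_le _ _ _)) // norm_fst.
  rewrite row_mxEr ler_wpDl // (le_trans (mx_entry_le _ _ _)) //.
  rewrite (le_trans (mulmx_norm _ _)) // mulrAC ler_wpM2l ?mulr_ge0 //.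
  exact: norm_snd.
have lam_lin : linear (fun s => T (L (s *m J))).
  move=> k a b; rewrite mulmxDl -scalemxAl linearP.
  by rewrite -TD TZ.
have [Lam LamE] : exists Lam : 'M[R]_(p + d), forall s, s *m Lam = T (L (s *m J)).
  pose lam : {linear 'rV[R]_(p + d) -> 'rV[R]_(p + d)} :=
    HB.pack (fun s => T (L (s *m J))) (GRing.isLinear.Build _ _ _ _ _ lam_lin).
  by exists (lin1_mx lam) => s; rewrite mul_rV_lin1.
pose B : 'M[R]_(p + d) := block_mx 1%:M 0 0 Q.
have BB : B *m B = B.
  by rewrite mulmx_block !mulmx0 !mul0mx !addr0 add0r mulmx1 kernel_proj_idem.
have TBT z : T z *m B = T z.
  by rewrite mul_row_block !mulmx0 addr0 add0r mulmx1 -mulmxA kernel_proj_idem.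
have Lam_ker (s : 'rV[R]_(p + d)) : s *m Lam = 0 -> s *m J = 0.
  rewrite LamE => e; have /eq_row_mx[e1 e2] : T (L (s *m J)) = row_mx 0 0.
    by rewrite e row_mx0.
  apply: LJ_inj.
  have := LJ_ker s; rewrite e1 mul0mx add0r => e3.
  have e4 : (L (s *m J)).2 = 0.
    by rewrite [LHS](image_kernel_split H) e2 addr0 mulmxA e3 mul0mx.
  by rewrite [LHS]surjective_pairing e1 e4.
have rankB : \rank B = m.
  by rewrite rank_diag_block_mx mxrank1 rank_kernel_proj.
have Lam_sub : (Lam <= B)%MS.
  apply/row_subP => i; rewrite rowE LamE -TBT.
  exact: submxMl.
have B_sub : (B <= Lam)%MS.
  have kerS : (kermx Lam <= kermx J)%MS.
    apply/row_subP => i; apply/sub_kermxP/Lam_ker.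
    by rewrite -row_mul mulmx_ker row0.
  have := mxrankS kerS; rewrite !mxrank_ker rank_pid_mx // => le.
  suff : (Lam == B)%MS by case/andP.
  rewrite -(mxrank_leqif_eq Lam_sub).2 eqn_leq mxrankS // rankB.
  by rewrite -(subKn (rank_leq_row Lam)) -(subKn mn) leq_sub2l.
pose Gam := pinvmx Lam.
have BGL : B *m Gam *m Lam = B by exact: mulmxKpV.
pose h (s : 'rV[R]_(p + d)) := T (Psi (u0 + s *m J) - z0).
have h0 : h 0 = 0 by rewrite /h mul0mx addr0 Psiu0 subrr -(subrr z0) -TB subrr.
pose cJ : R := (p + d)%:R * `|J| + 1.
have cJ0 : 0 < cJ by rewrite ltr_wpDl // mulr_ge0.
have J_le (s : 'rV[R]_(p + d)) : `|s *m J| <= cJ * `|s|.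
  by rewrite (le_trans (mulmx_norm _ _)) // mulrAC ler_wpM2r // lerDl.
have cT0 : 0 < cT by rewrite ltr_pwDl // mulr_ge0.
have strict (e : R) : 0 < e -> exists2 del : R, 0 < del & forall a b,
    `|a| < del -> `|b| < del -> `|h a - h b - (a - b) *m Lam| <= e * `|a - b|.
  move=> e0; have e10 : 0 < e / (cT * cJ) by rewrite divr_gt0 // mulr_gt0.
  have mvE : mean_value_space E by apply: mean_value_space_pair; exact: mean_value_space_rV.
  have [del del0 hdel] := strictly_differentiable (coordinates_rV _) mvE oPW CPsi PWu0 e10.
  exists (del / cJ) => [|a b ad bd]; first by rewrite divr_gt0.
  have inb s : `|s| < del / cJ -> `|u0 + s *m J - u0| < del.
    rewrite ltr_pdivlMr // mulrC => sd; rewrite addrAC subrr add0r.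
    exact: le_lt_trans sd.
  have [_ _] := hdel _ _ (inb a ad) (inb b bd).
  have -> : u0 + a *m J - (u0 + b *m J) = (a - b) *m J.
    by rewrite mulmxBl opprD addrACA subrr add0r.
  move=> le; rewrite LamE /h !TB.
  have -> : Psi (u0 + a *m J) - z0 - (Psi (u0 + b *m J) - z0) - L ((a - b) *m J) =
     Psi (u0 + a *m J) - Psi (u0 + b *m J) - 'd Psi u0 ((a - b) *m J).
    by rewrite opprB addrA subrK.
  rewrite (le_trans (T_le _)) // (le_trans (ler_wpM2l (ltW cT0) le)) //.
  apply: (@le_trans _ _ (cT * (e / (cT * cJ) * (cJ * `|a - b|)))).
    by rewrite ler_wpM2l ?(ltW cT0) // ler_wpM2l ?(ltW e10) //; exact: J_le.
  by rewrite mulrCA (mulrA cT cJ) mulrA divfK // gt_eqF // mulr_gt0.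
have near_u0 : \forall u \near u0, (Phi @` W) u /\ `|Psi u - z0| < eps / 2.
  apply: filterI; first exact: open_nbhs_nbhs.
  have /differentiable_continuous/cvgrPdist_lt/(_ (eps / 2)) := dPsi u0 PWu0.
  rewrite divr_gt0 // => /(_ isT); apply: filterS => u.
  by rewrite Psiu0 distrC.
move/nbhs_ballP: near_u0 => [r /= r0 hr].
have [del del0 hdel] := locally_onto h0 BB (fun s => TBT _) BGL strict (divr_gt0 r0 cJ0).
exists (Num.min del (eps / 2)) => [|x k]; first by rewrite lt_min del0 divr_gt0.
rewrite !lt_min => /andP[xdel _] /andP[kdel keps] kQ.
pose q : 'rV[R]_(p + d) := row_mx (x - z0.1) k.
have qB : q *m B = q by rewrite mul_row_block !mulmx0 addr0 add0r mulmx1 kQ.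
have qdel : `|q| < del.
  apply: (@le_lt_trans _ _ (Num.max `|x - z0.1| `|k|)); last by rewrite gt_max xdel kdel.
  apply: mx_norm_le => [|i j]; first by rewrite le_max normr_ge0.
  rewrite /q; case: (split_ordP j) => l ->; rewrite ?row_mxEl ?row_mxEr le_max mx_entry_le ?orbT //.
have [a ar ha] := hdel q qB qdel.
have [PWa Psia] : (Phi @` W) (u0 + a *m J) /\ `|Psi (u0 + a *m J) - z0| < eps / 2.
  apply: hr; rewrite -ball_normE /= opprD addNKr normrN (le_lt_trans (J_le _)) //.
  by rewrite mulrC -ltr_pdivlMr.
have Fa := crit _ PWa.
move: ha Psia Fa; rewrite /h; case: (Psi _) => x' y' /eq_row_mx[/= e1 e2] Psia Fa.
have {e1}xx : x' = x by apply: (addIr (- z0.1)).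
have kP : k *m P = 0 by rewrite -kQ -mulmxA kernel_image_proj0 mulmx0.
have wP : (y' - z0.2 - k) *m P = y' - z0.2 - k.
  rewrite [RHS](image_kernel_split H) -/P -/Q.
  by rewrite (mulmxBl (y' - z0.2) k Q) e2 kQ subrr addr0.
exists (y' - z0.2 - k); split => //.
- rewrite (le_lt_trans (ler_normB _ _)) // [ltRHS]splitr ltrD //.
  by apply: le_lt_trans Psia; exact: (norm_snd ((x', y') - z0)).
- have -> : z0.2 + k + (y' - z0.2 - k) = y' by rewrite -(addrA y') -opprD [LHS]addrC subrK.
  by rewrite -xx.
Qed.

End CriticalFibers.

(** * Estimates near a critical point *)

Section NearCritical.
Context {R : realType} {p d : nat} (g : 'rV[R]_p * 'rV[R]_d -> R).
Hypothesis gC3 : Ck_on 3 setT g.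
Hypothesis gMB : parametric_Morse_Bott g.
Local Notation E := ('rV[R]_p * 'rV[R]_d)%type.
Local Notation F := (gradient g).
Variable z0 : E.
Hypothesis Fz0 : F z0 = 0.
Local Notation H0 := (hessian g z0).
Local Notation P := (image_proj H0).
Local Notation Q := (kernel_proj H0).

Let H0_sym : H0^T = H0. Proof. exact: hessian_sym. Qed.

Lemma norm_near (z : E) (r : R) : `|z - z0| < r -> r <= 1 -> `|z| <= `|z0| + 1.
Proof.
move=> zr r1; rewrite -[z](subrK z0) (le_trans (ler_normD _ _)) // addrC lerD2l.
by rewrite ltW // (lt_le_trans zr).
Qed.

Lemma pair_snd_sub (x : 'rV[R]_p) (y y' : 'rV[R]_d) : (x, y) - (x, y') = (0, y - y') :> E.
Proof. by congr (_, _); rewrite /= subrr. Qed.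

Lemma pair_near (x : 'rV[R]_p) (y m : 'rV[R]_d) (r : R) :
  `|(x, y) - z0 : E| < r -> `|m - z0.2| < r -> `|(x, m) - z0 : E| < r.
Proof.
by rewrite !prod_normE /= !gt_max => /andP[-> _] ->.
Qed.

Lemma absorb_half (K eta h f u : R) : 0 < K -> eta * (2 * K) <= 1 -> 0 <= u ->
  h <= f + eta * u -> u <= K * h -> u <= 2 * K * f.
Proof.
move=> K0 etaK u0 hf uh.
have h1 : K * h <= K * (f + eta * u) by rewrite ler_wpM2l // ltW.
have h2 : eta * (2 * K) * u <= 1 * u by rewrite ler_wpM2r.
lra.
Qed.

Lemma sqrD_le (a b : R) : (a + b) ^+ 2 <= 2 * a ^+ 2 + 2 * b ^+ 2.
Proof. by have := sqr_ge0 (a - b); nra. Qed.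

(** Here [D], [Pn] and [Qn] are the norms of a vector and of its image and kernel
    components, [X] is the error made on the kernel component, and [q] and [h] are
    the values at this vector of the form [H0] and of a perturbation of it. *)
Lemma coercive_arith (A c D Pn Qn X C1 q h : R) : 0 < c -> 0 <= D -> 0 <= Pn -> 0 <= Qn ->
  0 <= X -> 0 <= C1 ->
  A <= c / 8 * D ^+ 2 -> `|h| <= c / 8 * D ^+ 2 -> c * Pn ^+ 2 <= q ->
  D <= Pn + Qn -> Qn <= 4^-1 * D + C1 * X ->
  A - 2 * c * C1 ^+ 2 * X ^+ 2 <= q + h.
Proof.
move=> c0 D0 P0 Q0 X0 C0 hA hh hq hD hQ.
have s1 : D ^+ 2 <= 2 * Pn ^+ 2 + 2 * Qn ^+ 2.
  apply: le_trans (sqrD_le _ _); rewrite lerXn2r // nnegrE ?addr_ge0 //.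
have s2 : Qn ^+ 2 <= 2 * (4^-1 * D) ^+ 2 + 2 * (C1 * X) ^+ 2.
  apply: le_trans (sqrD_le _ _); rewrite lerXn2r // nnegrE.
  by rewrite addr_ge0 // mulr_ge0 // invr_ge0.
have s3 : (D ^+ 2) / 4 - 2 * (C1 * X) ^+ 2 <= Pn ^+ 2.
  by move: s1 s2; rewrite exprMn; have := sqr_ge0 D; lra.
have s4 : c * (D ^+ 2 / 4 - 2 * (C1 * X) ^+ 2) <= c * Pn ^+ 2 by rewrite ler_wpM2l // ltW.
move: hh; rewrite ler_norml => /andP[hh _].
rewrite exprMn in s4; lra.
Qed.

(** Taylor's formula at [(x, y')], where the Hessian is close to [H0]. *)
Lemma gradient_near_critical (eta : R) : 0 < eta ->
  exists2 rho : R, 0 < rho <= 1 & forall x y y', `|(x, y) - z0 : E| < rho ->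
    `|(x, y') - z0 : E| < rho ->
    `|F (x, y) - F (x, y') - (y - y') *m H0| <= eta * `|y - y'|.
Proof.
move=> eta0; have [C Cb] := local_bounds_ex gC3 (`|z0| + 1).
have C0 := bounds_gt0 Cb.
pose K : R := C * 2 + d%:R * C + 1.
have dC : 0 <= d%:R * C by rewrite mulr_ge0 // ltW.
have K0 : 0 < K by rewrite /K; lra.
exists (Num.min 1 (eta / K)) => [|x y y' yr y'r].
  by rewrite lt_min ltr01 divr_gt0 // ge_min lexx.
have m1 : Num.min 1 (eta / K) <= 1 by rewrite ge_min lexx.
have zb := norm_near yr m1; have z'b := norm_near y'r m1.
have z0b : `|z0| <= `|z0| + 1 by rewrite lerDl.
have yK : `|(x, y) - z0 : E| <= eta / K by rewrite ltW // (lt_le_trans yr) // ge_min lexx orbT.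
have y'K : `|(x, y') - z0 : E| <= eta / K by rewrite ltW // (lt_le_trans y'r) // ge_min lexx orbT.
have yy' : `|y - y'| <= eta / K + eta / K.
  rewrite -(@norm_pair0l R 'rV[R]_p) -(pair_snd_sub x).
  rewrite (_ : _ - _ = ((x, y) - z0) - ((x, y') - z0)); last by rewrite opprB addrA subrK.
  by rewrite (le_trans (ler_normB _ _)) // lerD.
have := gradient_taylor Cb zb z'b; rewrite pair_snd_sub mul0mx add0r norm_pair0l /= => h1.
have h2 : `|(y - y') *m (hessian g (x, y') - H0)| <= d%:R * (C * (eta / K)) * `|y - y'|.
  apply: mulmx_norm_le; apply: le_trans (hessian_lipschitz Cb z'b z0b) _.
  by rewrite ler_wpM2l // ltW.
have -> : F (x, y) - F (x, y') - (y - y') *m H0 = 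
  (F (x, y) - F (x, y') - (y - y') *m hessian g (x, y')) + (y - y') *m (hessian g (x, y') - H0).
  by rewrite mulmxBr addrA subrK.
rewrite (le_trans (ler_normD _ _)) //.
apply: (@le_trans _ _ (C * (eta / K + eta / K) * `|y - y'| + d%:R * (C * (eta / K)) * `|y - y'|)).
  rewrite lerD // (le_trans h1) // expr2 mulrA ler_wpM2r // ler_wpM2l // ltW //.
rewrite -mulrDl ler_wpM2r //.
have -> : C * (eta / K + eta / K) + d%:R * (C * (eta / K)) = (C * 2 + d%:R * C) * (eta / K) by ring.
by rewrite mulrCA ger_pMr // ler_pdivrMr // mul1r /K lerDl.
Qed.

Lemma image_bound : exists2 K : R, 0 < K & forall v : 'rV[R]_d, `|v *m P| <= K * `|v *m H0|.
Proof.
exists (d%:R * `|pseudo_inverse H0| + 1); first by rewrite ltr_wpDl // mulr_ge0.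
by move=> v; rewrite (le_trans (image_proj_bound _ _)) // ler_wpM2r // lerDl.
Qed.

Lemma kernel_bound : exists2 K : R, 0 < K & forall v : 'rV[R]_d, `|v *m Q| <= K * `|v|.
Proof.
exists (d%:R * `|Q| + 1); first by rewrite ltr_wpDl // mulr_ge0.
by move=> v; rewrite (le_trans (mulmx_norm _ _)) // mulrAC ler_wpM2r // lerDl.
Qed.

(** The point [m] is the critical point given by [critical_fibers] for the kernel
    component of [y - z0.2]. *)
Lemma critical_projection (eps : R) : 0 < eps ->
  exists2 rho : R, 0 < rho & forall x y, `|(x, y) - z0 : E| < rho ->
    exists m : 'rV[R]_d, [/\ F (x, m) = 0, (y - m) *m P = y - m,
      (m - z0.2) *m Q = (y - z0.2) *m Q & `|m - z0.2| < eps].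
Proof.
move=> eps0; have e20 : 0 < eps / 2 by rewrite divr_gt0.
have [del del0 hdel] := critical_fibers gC3 gMB Fz0 e20.
have [K K0 hK] := kernel_bound.
pose r := Num.min del (eps / 2).
have r0 : 0 < r by rewrite lt_min del0.
exists (Num.min r (r / K)) => [|x y]; first by rewrite lt_min r0 divr_gt0.
rewrite lt_min => /andP[zr zrK].
have xr : `|x - z0.1| < r by exact: le_lt_trans (norm_fst ((x, y) - z0)) zr.
have yK : K * `|y - z0.2| < r.
  by rewrite mulrC -ltr_pdivlMr //; exact: le_lt_trans (norm_snd ((x, y) - z0)) zrK.
pose k := (y - z0.2) *m Q.
have kr : `|k| < r by exact: le_lt_trans (hK _) yK.
have kQ : k *m Q = k by rewrite /k -mulmxA kernel_proj_idem.
have [rd re] : r <= del /\ r <= eps / 2 by rewrite /r !ge_min !lexx orbT.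
have [w [wP wr Fw]] := hdel x k (lt_le_trans xr rd) (lt_le_trans kr rd) kQ.
have kP : k *m P = 0 by rewrite -kQ -mulmxA kernel_image_proj0 mulmx0.
have wQ : w *m Q = 0 by rewrite -wP -mulmxA image_kernel_proj0 mulmx0.
have mE : z0.2 + k + w - z0.2 = k + w by rewrite -(addrA z0.2) [LHS]addrC addKr.
exists (z0.2 + k + w); split => //.
- have -> : y - (z0.2 + k + w) = (y - z0.2) *m P - w.
    rewrite !opprD !addrA; congr (_ - w).
    by rewrite [in LHS](image_kernel_split H0 (y - z0.2)) -/k addrK.
  by rewrite mulmxBl -mulmxA image_proj_idem wP.
- by rewrite mE mulmxDl wQ addr0 kQ.
- rewrite mE (le_lt_trans (ler_normD _ _)) // [ltRHS]splitr ltrD //.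
  exact: lt_le_trans kr re.
Qed.

(** For the critical point [m] with the kernel component of [y], the gradient is
    [(y - m) *m H0] up to a small multiple of [y - m].  The main term is in the
    image of [H0], and it controls [y - m], which is in this image too. *)
Lemma gradient_kernel_small : exists2 c : R, 0 < c & forall eps : R, 0 < eps ->
  exists2 rho : R, 0 < rho & forall x y, `|(x, y) - z0 : E| < rho ->
  exists m : 'rV[R]_d, [/\ F (x, m) = 0, `|y - m| <= c * `|F (x, y)|,
    `|m - z0.2| < eps & `|F (x, y) *m Q| <= eps * `|F (x, y)|].
Proof.
have [KP KP0 hKP] := image_bound; have [KQ KQ0 hKQ] := kernel_bound.
exists (2 * KP) => [|eps eps0]; first by rewrite mulr_gt0.
pose eta := Num.min (2 * KP)^-1 (eps / (KQ * (2 * KP))).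
have eta0 : 0 < eta by rewrite lt_min invr_gt0 divr_gt0 ?mulr_gt0.
have [r1 /andP[r10 r11] hr1] := gradient_near_critical eta0.
have e1 : 0 < Num.min eps r1 by rewrite lt_min eps0.
have [r2 r20 hr2] := critical_projection e1.
exists (Num.min r1 r2) => [|x y]; first by rewrite lt_min r10.
rewrite lt_min => /andP[yr1 yr2].
have [m [Fm uP mQ]] := hr2 x y yr2; rewrite lt_min => /andP[meps mr1].
have mnear := pair_near yr1 mr1.
have := hr1 _ _ _ yr1 mnear; rewrite Fm subr0 => h1.
have uF : `|y - m| <= 2 * KP * `|F (x, y)|.
  apply: (@absorb_half KP eta `|(y - m) *m H0|) => //.
  - by rewrite -ler_pdivlMr ?mulr_gt0 // div1r ge_min lexx.
  - rewrite -[_ *m H0](subKr (F (x, y))) (le_trans (ler_normB _ _)) // lerD2l //.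
  - by rewrite -{1}uP; exact: hKP.
exists m; split => //.
have -> : F (x, y) *m Q = (F (x, y) - (y - m) *m H0) *m Q.
  by rewrite mulmxBl -mulmxA (kernel_proj_mulr H0_sym) mulmx0 subr0.
rewrite (le_trans (hKQ _)) //.
apply: (@le_trans _ _ (KQ * (eta * (2 * KP * `|F (x, y)|)))).
  rewrite ler_wpM2l ?(ltW KQ0) // (le_trans h1) // ler_wpM2l // ltW //.
have -> : KQ * (eta * (2 * KP * `|F (x, y)|)) = eta * (KQ * (2 * KP)) * `|F (x, y)| by ring.
rewrite ler_wpM2r // -ler_pdivlMr ?mulr_gt0 //.
by rewrite ge_min lexx orbT.
Qed.

(** Let [m] be the critical point associated with [z2] and [u] the displacement
    from [m] to [z2].  Translating both points by [- u] turns the difference of the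
    gradients into a single gradient, to which [gradient_kernel_small] applies, and
    changes it by a multiple of [`|z1 - z2| * `|u|], with [`|u|] bounded by a
    multiple of the gradient at [z2]. *)
Lemma gradient_difference_kernel (eps : R) : 0 < eps ->
  exists2 rho : R, 0 < rho <= 1 & exists2 C : R, 0 <= C & forall z1 z2 : E,
    `|z1 - z0| < rho -> `|z2 - z0| < rho ->
    `|(F z1 - F z2) *m Q| <= eps * `|F z1 - F z2| + C * (`|F z2| * `|z1 - z2|).
Proof.
move=> eps0; have [KQ KQ0 hKQ] := kernel_bound.
have [c c0 hc] := gradient_kernel_small.
have [C Cb] := local_bounds_ex gC3 (`|z0| + 1); have C0 := bounds_gt0 Cb.
have [s s0 hs] := hc eps eps0.
pose r1 := Num.min s 1.
have r10 : 0 < r1 by rewrite lt_min s0 ltr01.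
have [r1s r11] : r1 <= s /\ r1 <= 1 by rewrite /r1 !ge_min !lexx orbT.
have r14 : 0 < r1 / 4 by rewrite divr_gt0.
have [r2 r20 hr2] := hc (r1 / 4) r14.
exists (Num.min r2 (r1 / 4)).
  rewrite lt_min r20 r14 /= ge_min; apply/orP; right.
  by rewrite ler_pdivrMr // mul1r (le_trans r11) // ler1n.
exists ((eps + KQ) * (C * c)); first by rewrite !mulr_ge0 ?addr_ge0 // ltW.
move=> [x1 y1] [x2 y2]; rewrite !lt_min => /andP[_ z1r] /andP[z2r2 z2r].
have [m [Fm uF mr _]] := hr2 x2 y2 z2r2.
pose u := y2 - m.
have ur : `|u| < r1 / 2.
  rewrite /u -(subrKA z0.2) -[z0.2 - m]opprB (le_lt_trans (ler_normB _ _)) //.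
  have -> : r1 / 2 = r1 / 4 + r1 / 4 by lra.
  by rewrite ltrD //; apply: le_lt_trans z2r; exact: (norm_snd ((x2, y2) - z0)).
have z1E : (x1, y1 - u) + (0, u) = (x1, y1) :> E by congr (_, _); rewrite /= ?addr0 // subrK.
have z2E : (x2, m) + (0, u) = (x2, y2) :> E by congr (_, _); rewrite /= ?addr0 // addrC subrK.
have z12E : (x1, y1 - u) - (x2, m) = (x1, y1) - (x2, y2) :> E.
  by congr (_, _); rewrite /u /= -addrA -opprD subrK.
have z1'r : `|(x1, y1 - u) - z0 : E| < r1.
  have -> : (x1, y1 - u) - z0 = ((x1, y1) - z0) - (0, u) :> E by rewrite -z1E addrAC addrK.
  rewrite (le_lt_trans (ler_normB _ _)) // norm_pair0l.
  have -> : r1 = r1 / 2 + r1 / 2 by lra.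
  rewrite ltrD // (lt_le_trans z1r) //; lra.
have mr1 : `|(x2, m) - z0 : E| < r1.
  apply: (@pair_near _ y2); last by rewrite (lt_le_trans mr) //; lra.
  by rewrite (lt_le_trans z2r) //; lra.
have ub : `|u| <= `|z0| + 1.
  by rewrite ltW // (lt_le_trans ur) // (@le_trans _ _ 1) ?lerDr //; lra.
have := gradient_second_difference Cb (norm_near z1'r r11) (norm_near mr1 r11) ub.
rewrite z1E z2E z12E Fm subr0.
set D := F (x1, y1) - F (x2, y2); set G := F (x1, y1 - u); set Z := `|(x1, y1) - (x2, y2)| => le.
have hG : `|G *m Q| <= eps * `|G|.
  by have [_ [_ _ _]] := hs x1 (y1 - u) (lt_le_trans z1'r r1s).
have hD : `|D - G| <= C * c * (`|F (x2, y2)| * Z).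
  apply: le_trans le _; rewrite -!mulrA ler_wpM2l ?(ltW C0) // [leRHS]mulrA [leRHS]mulrC.
  by rewrite ler_wpM2l // /Z.
have -> : D *m Q = G *m Q + (D - G) *m Q by rewrite -mulmxDl addrC subrK.
rewrite (le_trans (ler_normD _ _)) //.
have hG2 : `|G| <= `|D| + `|D - G| by rewrite -{1}[G](subKr D) (le_trans (ler_normB _ _)).
have := hKQ (D - G); move: hG hG2 hD eps0 KQ0; rewrite -(mulrA (eps + KQ)).
move: (`|G *m Q|) (`|(D - G) *m Q|) (`|D|) (`|G|) (`|D - G|) (C * c * _) => a b dd gg e t.
move=> h1 h2 h3 e0 K0 h4.
have h5 : eps * gg <= eps * (dd + e) by rewrite ler_wpM2l // ltW.
have h6 : (eps + KQ) * e <= (eps + KQ) * t by rewrite ler_wpM2l // addr_ge0 // ltW.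
move: h1 h4 h5 h6; clear; lra.
Qed.

Section Minimum.
Hypothesis H0_pos : forall v : 'rV[R]_d, 0 <= dot v (v *m H0).

(** If the form [H0] is bounded by [l], its positivity at [v - l^-1 *: (v *m H0)]
    bounds the square of [v *m H0] by [l * dot v (v *m H0)]. *)
Lemma hessian_coercive : exists2 c : R, 0 < c &
  forall v : 'rV[R]_d, c * `|v *m P| ^+ 2 <= dot v (v *m H0).
Proof.
have [K K0 hK] := image_bound.
pose l : R := d%:R * (d%:R * `|H0|) + 1.
have l0 : 0 < l by rewrite ltr_wpDl // !mulr_ge0.
have upper w : dot w (w *m H0) <= l * dot w w.
  rewrite (le_trans (ler_norm _)) // (le_trans (norm_dot _ _)) //.
  apply: (@le_trans _ _ (d%:R * (d%:R * `|H0|) * `|w| ^+ 2)).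
    apply: (@le_trans _ _ (d%:R * `|w| * (d%:R * `|w| * `|H0|))).
      by rewrite ler_wpM2l ?mulmx_norm // mulr_ge0.
    by rewrite le_eqVlt; apply/orP; left; apply/eqP; ring.
  rewrite mulrDl mul1r ler_wpDr ?dot_ge0 // ler_wpM2l ?mulr_ge0 //.
  exact: norm_le_dot.
have lower v : dot (v *m H0) (v *m H0) <= l * dot v (v *m H0).
  set w := v *m H0.
  have := H0_pos (v - l^-1 *: w).
  rewrite mulmxBl -/w -scalemxAl !dotDl !dotDr !dotNl !dotNr !dotZl !dotZr opprK.
  have -> : dot v (w *m H0) = dot w w by rewrite -[in RHS]/w {2}/w dot_mulmx H0_sym.
  have := upper w; move: (dot w (w *m H0)) (dot w w) (dot v w) => a b q h1 h2.
  have h3 : l^-1 * (l^-1 * a) <= l^-1 * (l^-1 * (l * b)) by rewrite !ler_wpM2l ?invr_ge0 // ltW.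
  have h4 : l^-1 * (l * b) = b by rewrite mulKf // gt_eqF.
  rewrite h4 in h3.
  have h5 : l^-1 * b <= q by lra.
  by rewrite -ler_pdivrMl.
exists (K ^+ 2 * l)^-1 => [|v]; first by rewrite invr_gt0 mulr_gt0 // exprn_gt0.
rewrite ler_pdivrMl ?mulr_gt0 ?exprn_gt0 // -mulrA.
apply: (@le_trans _ _ (K ^+ 2 * `|v *m H0| ^+ 2)).
  by rewrite -exprMn lerXn2r // nnegrE // mulr_ge0 // ltW.
rewrite ler_wpM2l ?sqr_ge0 //; apply: le_trans (lower v).
exact: norm_le_dot.
Qed.

(** A quarter of its norm and the error term aside, the difference of the gradients
    is in the image of [H0], where [H0] is coercive. *)
Lemma gradient_difference_coercive : exists2 rho : R, 0 < rho <= 1 &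
  exists2 a : R, 0 < a & exists2 C : R, 0 <= C & forall z1 z2 : E,
    `|z1 - z0| < rho -> `|z2 - z0| < rho ->
    a * dot (F z1 - F z2) (F z1 - F z2) - C * (`|F z2| * `|z1 - z2|) ^+ 2
    <= dot (F z1 - F z2) ((F z1 - F z2) *m hessian g z1).
Proof.
have [c c0 hc] := hessian_coercive.
have e4 : 0 < 4^-1 :> R by [].
have [r1 /andP[r10 r11] [C1 C10 h1]] := gradient_difference_kernel e4.
have [C Cb] := local_bounds_ex gC3 (`|z0| + 1); have C0 := bounds_gt0 Cb.
pose M : R := d%:R * (d%:R * C) + 1.
have M0 : 0 < M by rewrite ltr_wpDl // !mulr_ge0 // ltW.
exists (Num.min r1 (c / 8 / M)).
  by rewrite lt_min r10 !divr_gt0 // ge_min r11.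
exists (c / 8 / (d%:R + 1)); first by rewrite !divr_gt0 // ltr_wpDl.
exists (2 * c * C1 ^+ 2); first by rewrite !mulr_ge0 ?sqr_ge0 // ltW.
move=> z1 z2; rewrite !lt_min => /andP[z1r z1M] /andP[z2r _].
have := h1 z1 z2 z1r z2r; set D := F z1 - F z2; set X := `|F z2| * _ => hQ.
have z1b := norm_near z1r r11.
have z0b : `|z0| <= `|z0| + 1 by rewrite lerDl.
have hH : `|dot D (D *m (hessian g z1 - H0))| <= c / 8 * `|D| ^+ 2.
  rewrite (le_trans (norm_dot _ _)) //.
  have hm := mulmx_norm_le (hessian_lipschitz Cb z1b z0b) D.
  apply: (@le_trans _ _ (d%:R * `|D| * (d%:R * (C * `|z1 - z0|) * `|D|))).
    by rewrite ler_wpM2l // mulr_ge0.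
  have -> : d%:R * `|D| * (d%:R * (C * `|z1 - z0|) * `|D|) =
     (d%:R * (d%:R * C)) * `|z1 - z0| * `|D| ^+ 2 by ring.
  rewrite ler_wpM2r ?sqr_ge0 //.
  apply: (@le_trans _ _ (M * `|z1 - z0|)); first by rewrite ler_wpM2r // lerDl.
  by rewrite mulrC -ler_pdivlMr // ltW.
have -> : dot D (D *m hessian g z1) = dot D (D *m H0) + dot D (D *m (hessian g z1 - H0)).
  by rewrite -dotDr -mulmxDr addrC subrK.
have hDD := dot_le_norm D.
have hcD := hc D.
have hsplit : `|D| <= `|D *m P| + `|D *m Q|.
  by rewrite {1}(image_kernel_split H0 D) ler_normD.
have d1 : 0 < d%:R + 1 :> R by rewrite ltr_wpDl.
have hA : c / 8 / (d%:R + 1) * dot D D <= c / 8 * `|D| ^+ 2.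
  rewrite -mulrA ler_wpM2l ?divr_ge0 ?(ltW c0) // ler_pdivrMl //.
  by rewrite (le_trans hDD) // ler_wpM2r ?sqr_ge0 // lerDl.
apply: coercive_arith hA hH hcD hsplit hQ => //.
by rewrite mulr_ge0.
Qed.

End Minimum.
End NearCritical.

(** * Critical values *)

Section CriticalValue.
Context {R : realType}.

(** Over [n] equal steps the increment is at most [n * (C / n ^ 2)]. *)
Lemma quadratic_modulus_cst (f : R -> R) (C : R) : 0 <= C ->
  (forall s t : R, 0 <= s <= 1 -> 0 <= t <= 1 -> `|f s - f t| <= C * (s - t) ^+ 2) ->
  f 1 = f 0.
Proof.
move=> C0 fC; apply/eqP; rewrite -subr_eq0 -normr_le0; apply/ler_addgt0Pl => e e0; rewrite addr0.
pose n := (Num.truncn (C / e)).+1.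
have n0 : 0 < n%:R :> R by rewrite ltr0n.
have nC : C / e < n%:R by exact: truncnS_gt.
have step k : (k <= n)%N -> `|f (k%:R / n%:R) - f 0| <= k%:R * (C / n%:R ^+ 2).
  elim: k => [_|k ih kn]; first by rewrite !mul0r subrr normr0.
  rewrite -(subrKA (f (k%:R / n%:R))) (le_trans (ler_normD _ _)) //.
  have -> : k.+1%:R * (C / n%:R ^+ 2) = C / n%:R ^+ 2 + k%:R * (C / n%:R ^+ 2).
    by rewrite -natr1 mulrDl mul1r addrC.
  rewrite lerD ?ih ?(ltnW kn) //.
  have in01 j : (j <= n)%N -> 0 <= (j%:R / n%:R : R) <= 1.
    by move=> jn; rewrite divr_ge0 // ler_pdivrMr // mul1r ler_nat.
  rewrite (le_trans (fC _ _ _ _)) ?natr1 ?in01 // 1?ltnW //.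
  by rewrite -mulrBl -natr1 addrAC subrr add0r div1r exprVn.
have := step n (leqnn n); rewrite divff ?gt_eqF // => le; apply: le_trans le _.
have -> : n%:R * (C / n%:R ^+ 2) = C / n%:R.
  by rewrite expr2 invfM mulrCA; congr (_ * _); rewrite mulrA divff ?mul1r // gt_eqF.
rewrite ler_pdivrMr //.
by rewrite mulrC -ler_pdivrMr // ltW.
Qed.

Context {p d : nat} (g : 'rV[R]_p * 'rV[R]_d -> R).
Hypothesis gC3 : Ck_on 3 setT g.
Local Notation E := ('rV[R]_p * 'rV[R]_d)%type.
Local Notation F := (gradient g).
Variable z0 : E.
Local Notation H0 := (hessian g z0).

Let zE : (z0.1, z0.2) = z0. Proof. by case: z0. Qed.

(** Otherwise the objective would decrease to first order in the direction opposite
    to the gradient. *)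
Lemma local_min_critical : is_local_minimizer (fun y => g (z0.1, y)) z0.2 -> F z0 = 0.
Proof.
move=> /nbhs_ballP[r /= r0 hr].
have [C Cb] := local_bounds_ex gC3 (`|z0| + 1); have C0 := bounds_gt0 Cb.
apply: dot_eq0; apply/eqP; rewrite eq_le dot_ge0 andbT; apply/ler_addgt0Pl => e e0; rewrite addr0.
set f := F z0.
pose K : R := `|f| + 1.
have K0 : 0 < K by rewrite ltr_wpDl.
pose s := Num.min (Num.min (r / K / 2) (K^-1)) (e / (C * K ^+ 2)).
have rK : 0 < r / K / 2 by rewrite !divr_gt0.
have eC : 0 < e / (C * K ^+ 2) by rewrite divr_gt0 // mulr_gt0 // exprn_gt0.
have Ki : 0 < K^-1 by rewrite invr_gt0.
have s0 : 0 < s by rewrite !lt_min rK eC Ki.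
have [s1 s2 s3] : [/\ s <= r / K / 2, s <= K^-1 & s <= e / (C * K ^+ 2)].
  by rewrite /s !ge_min !lexx !orbT.
have fK : `|f| <= K by rewrite lerDl.
have yE : z0.2 - s *: f - z0.2 = - (s *: f) by rewrite addrAC subrr add0r.
have sf : `|z0.2 - s *: f - z0.2| <= s * K.
  by rewrite yE normrN normrZ gtr0_norm // ler_wpM2l // ltW.
have sK1 : s * K <= 1 by rewrite -ler_pdivlMr // div1r.
have := hr (z0.2 - s *: f); rewrite -ball_normE /= distrC => /(_ _)/wrap[|le].
  rewrite (le_lt_trans sf) // -ltr_pdivlMr // (le_lt_trans s1) // ltr_pdivrMr // ltr_pMr ?divr_gt0 //.
  by rewrite ltr1n.
have b1 : `|z0.1| <= `|z0| + 1 by rewrite (le_trans (norm_fst z0)) // lerDl.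
have b2 : `|z0.2| <= `|z0| + 1 by rewrite (le_trans (norm_snd z0)) // lerDl.
have b3 : `|z0.2 - s *: f| <= `|z0| + 1.
  rewrite -[_ - _](subrK z0.2) (le_trans (ler_normD _ _)) // addrC lerD ?norm_snd //.
  exact: le_trans sf _.
have := objective_taylor Cb b1 b2 b3; rewrite zE -/f yE normrN dotNr dotZr.
rewrite opprK normrZ gtr0_norm // ler_norml => /andP[_ h].
have h1 : s * dot f f <= C * (s * `|f|) ^+ 2.
  by move: h le; rewrite zE; move: (g _) (g _) (dot f f) => a b c; lra.
have h2 : C * (s * `|f|) ^+ 2 <= s * e.
  have -> : C * (s * `|f|) ^+ 2 = s * (s * (C * `|f| ^+ 2)) by ring.
  rewrite ler_wpM2l ?(ltW s0) //; apply: (@le_trans _ _ (s * (C * K ^+ 2))).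
    by rewrite ler_wpM2l ?(ltW s0) // ler_wpM2l ?(ltW C0) // lerXn2r // nnegrE // ltW.
  by rewrite -ler_pdivlMr // mulr_gt0 // exprn_gt0.
by rewrite -(ler_pM2l s0) (le_trans h1).
Qed.

(** On a short segment of direction [v] issued from the minimizer, the objective has
    a nonnegative derivative at some point, and this derivative is proportional to
    [dot v (v *m H0)] up to second order. *)
Lemma local_min_psd : is_local_minimizer (fun y => g (z0.1, y)) z0.2 ->
  forall v : 'rV[R]_d, 0 <= dot v (v *m H0).
Proof.
move=> min0; have Fz0 := local_min_critical min0.
move: min0 => /nbhs_ballP[r /= r0 hr] v.
have [C Cb] := local_bounds_ex gC3 (`|z0| + 1); have C0 := bounds_gt0 Cb.
apply/ler_addgt0Pr => e e0.
pose K : R := `|v| + 1.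
have K0 : 0 < K by rewrite ltr_wpDl.
pose D : R := d%:R * C * K ^+ 3 + 1.
have D0 : 0 < D by rewrite ltr_wpDl // !mulr_ge0 ?exprn_ge0 // ltW.
pose s := Num.min (Num.min (r / K / 2) (K^-1)) (e / D).
have rK : 0 < r / K / 2 by rewrite !divr_gt0.
have eC : 0 < e / D by rewrite divr_gt0.
have Ki : 0 < K^-1 by rewrite invr_gt0.
have s0 : 0 < s by rewrite !lt_min rK eC Ki.
have [s1 s2 s3] : [/\ s <= r / K / 2, s <= K^-1 & s <= e / D].
  by rewrite /s !ge_min !lexx !orbT.
have vK : `|v| <= K by rewrite lerDl.
have sv (c : R) : 0 <= c <= s -> `|z0.2 + c *: v - z0.2| <= s * K.
  move=> /andP[c0 cs]; rewrite addrAC subrr add0r normrZ ger0_norm //.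
  by rewrite ler_pM.
have sK1 : s * K <= 1 by rewrite -ler_pdivlMr // div1r.
have := hr (z0.2 + s *: v); rewrite -ball_normE /= distrC => /(_ _)/wrap[|le].
  rewrite (le_lt_trans (sv s _)) ?lexx ?(ltW s0) // -ltr_pdivlMr // (le_lt_trans s1) //.
  by rewrite ltr_pdivrMr // ltr_pMr ?divr_gt0 // ltr1n.
have dh (t : R) : is_derive t 1 (fun t => g (z0.1, z0.2 + t *: v)) (dot (F (z0.1, z0.2 + t *: v)) v).
  apply: is_derive_objective => //.
  have := @is_derive_line R _ _ (@id 'rV[R]_d) z0.2 v t (@derivable_id _ _ _ _).
  by rewrite derive_id.
have [c /andP[c0 cs]] := derive_mean_value s0 (fun t _ _ => dh t) (is_derive_cvg_right (dh 0)).
rewrite scale0r addr0 subr0 => e1.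
have c01 : 0 <= c <= s by rewrite !ltW.
have h1 : 0 <= dot (F (z0.1, z0.2 + c *: v)) v.
  by rewrite -(pmulr_lge0 _ s0) -e1 subr_ge0.
have b0 : `|z0| <= `|z0| + 1 by rewrite lerDl.
have zc : (z0.1, z0.2 + c *: v) - z0 = (0, c *: v) :> E.
  by rewrite -{2}zE; congr (_, _); rewrite /= ?subrr // addrAC subrr add0r.
have cv : `|c *: v| = c * `|v| by rewrite normrZ gtr0_norm.
have cK : c * `|v| <= s * K by rewrite ler_pM // ltW.
have bc : `|(z0.1, z0.2 + c *: v) : E| <= `|z0| + 1.
  rewrite -[X in `|X|](subrK z0) zc (le_trans (ler_normD _ _)) // addrC lerD2l norm_pair0l cv.
  exact: le_trans sK1.
have := gradient_taylor Cb bc b0; rewrite zc Fz0 subr0 norm_pair0l /= mul0mx add0r cv => h2.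
have h3 : `|dot (F (z0.1, z0.2 + c *: v) - c *: v *m H0) v| <= c * e.
  rewrite (le_trans (norm_dot _ _)) //.
  apply: (@le_trans _ _ (d%:R * (C * (c * K) ^+ 2) * K)).
    rewrite ler_pM // ?mulr_ge0 // ler_wpM2l // (le_trans h2) // ler_wpM2l ?(ltW C0) //.
    by rewrite lerXn2r ?nnegrE ?mulr_ge0 ?(ltW c0) ?(ltW K0) // ler_wpM2l // ltW.
  have -> : d%:R * (C * (c * K) ^+ 2) * K = c * (c * (d%:R * C * K ^+ 3)) by ring.
  rewrite ler_wpM2l ?(ltW c0) // (@le_trans _ _ (s * D)) //; last by rewrite -ler_pdivlMr.
  by rewrite ler_pM ?(ltW c0) ?(ltW cs) // ?lerDl // !mulr_ge0 ?exprn_ge0 // ltW.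
move: h3; rewrite dotDl dotNl -scalemxAl dotZl (dotC (v *m H0)) ler_norml => /andP[_ h3].
rewrite -(pmulr_rge0 _ c0) mulrDr; lra.
Qed.

Hypothesis gMB : parametric_Morse_Bott g.
Hypothesis Fz0 : F z0 = 0.
Local Notation P := (image_proj H0).
Local Notation Q := (kernel_proj H0).

(** The difference of two critical points is almost annihilated by [H0], so that its
    image component is at most half of it. *)
Lemma critical_lipschitz : exists2 rho : R, 0 < rho <= 1 & forall x m m',
  `|(x, m) - z0 : E| < rho -> `|(x, m') - z0 : E| < rho ->
  F (x, m) = 0 -> F (x, m') = 0 -> `|m - m'| <= 2 * `|(m - m') *m Q|.
Proof.
have [K K0 hK] := image_bound g z0.
have K20 : 0 < (2 * K)^-1 by rewrite invr_gt0 mulr_gt0.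
have [rho rho0 hr] := gradient_near_critical gC3 z0 K20.
exists rho => // x m m' mr m'r Fm Fm'.
have := hr x m m' mr m'r; rewrite Fm Fm' subrr sub0r normrN => h1.
have h2 := hK (m - m').
have h3 : `|m - m'| <= `|(m - m') *m P| + `|(m - m') *m Q|.
  by rewrite {1}(image_kernel_split H0 (m - m')) ler_normD.
have h4 : K * `|(m - m') *m H0| <= `|m - m'| / 2.
  rewrite (le_trans (ler_wpM2l (ltW K0) h1)) // invfM [2^-1 * _]mulrC !mulrA mulfV ?gt_eqF // mul1r.
  by rewrite mulrC.
by move: h2 h3 h4; clear; lra.
Qed.

(** The segment between the kernel components lifts to a Lipschitz arc [c] of
    critical points, along which the objective varies quadratically, hence not at
    all. *)
Lemma critical_value : exists2 rho : R, 0 < rho & forall m, `|m - z0.2| < rho ->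
  F (z0.1, m) = 0 -> g (z0.1, m) = g z0.
Proof.
have [r1 /andP[r10 r11] hr1] := critical_lipschitz.
have [r2 r20 hr2] := critical_projection gC3 gMB Fz0 r10.
have [C Cb] := local_bounds_ex gC3 (`|z0| + 1); have C0 := bounds_gt0 Cb.
have nz y : `|(z0.1, y) - z0 : E| = `|y - z0.2|.
  by rewrite -{2}zE pair_snd_sub norm_pair0l.
exists (Num.min r1 r2) => // [|m]; first by rewrite lt_min r10.
rewrite lt_min => /andP[mr1 mr2] Fm.
have /choice[c hc] (s : R) : exists c : 'rV[R]_d, 0 <= s <= 1 ->
    [/\ F (z0.1, c) = 0, (c - z0.2) *m Q = s *: ((m - z0.2) *m Q) & `|c - z0.2| < r1].
  have [/andP[s0 s1]|] := boolP (0 <= s <= 1); last by exists 0.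
  have [|c [Fc _ cQ cr]] := hr2 z0.1 (z0.2 + s *: (m - z0.2)).
    rewrite nz addrAC subrr add0r normrZ ger0_norm //.
    by rewrite (le_lt_trans _ mr2) // ler_piMl.
  exists c => _; split => //; by rewrite cQ addrAC subrr add0r scalemxAl.
have uniq c1 c2 : F (z0.1, c1) = 0 -> F (z0.1, c2) = 0 -> `|c1 - z0.2| < r1 -> `|c2 - z0.2| < r1 ->
    `|c1 - c2| <= 2 * `|(c1 - z0.2) *m Q - (c2 - z0.2) *m Q|.
  move=> F1 F2 n1 n2; rewrite -mulmxBl opprB addrA subrK.
  by apply: (hr1 z0.1) => //; rewrite nz.
have i0 : 0 <= (0 : R) <= 1 by rewrite lexx ler01.
have i1 : 0 <= (1 : R) <= 1 by rewrite lexx ler01.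
have c1m : c 1 = m.
  have [F1 Q1 n1] := hc 1 i1.
  have := uniq _ _ F1 Fm n1 mr1; rewrite Q1 scale1r subrr normr0 mulr0 normr_le0 subr_eq0.
  by move/eqP.
have c00 : c 0 = z0.2.
  have [F1 Q1 n1] := hc 0 i0.
  have := uniq _ z0.2 F1 _ n1 _; rewrite zE Q1 scale0r subrr mul0mx subrr !normr0 mulr0.
  by rewrite normr_le0 subr_eq0 => /(_ Fz0 r10)/eqP.
rewrite -[in RHS]zE -c00 -c1m.
pose k := (m - z0.2) *m Q.
apply: (@quadratic_modulus_cst (fun s => g (z0.1, c s)) (C * (2 * `|k|) ^+ 2)).
  by rewrite mulr_ge0 ?sqr_ge0 // ltW.
move=> s t is_ it_.
have [F1 Q1 n1] := hc s is_; have [F2 Q2 n2] := hc t it_.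
have := uniq _ _ F1 F2 n1 n2; rewrite Q1 Q2 -scalerBl normrZ -/k => le.
have bd u : `|u - z0.2| < r1 -> `|u| <= `|z0| + 1.
  move=> ur; rewrite -[u](subrK z0.2) (le_trans (ler_normD _ _)) // addrC lerD ?norm_snd //.
  by rewrite ltW // (lt_le_trans ur).
have b1 : `|z0.1| <= `|z0| + 1 by rewrite (le_trans (norm_fst z0)) // lerDl.
have := objective_taylor Cb b1 (bd _ n2) (bd _ n1); rewrite F2 dot0l subr0 => h.
rewrite (le_trans h) // -mulrA ler_wpM2l ?(ltW C0) // -exprMn.
rewrite -[X in _ <= X]real_normK ?num_real // lerXn2r ?nnegrE //.
by rewrite (le_trans le) // !normrM normr_id (ger0_norm (ler0n _ 2)) -mulrA (mulrC `|k|).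
Qed.

(** The Lojasiewicz inequality with exponent 1/2: the objective differs from its
    value at the critical point [m] of [gradient_kernel_small] by at most a multiple
    of [`|y - m| ^+ 2], and this value is that of [z0]. *)
Lemma lojasiewicz : exists2 rho : R, 0 < rho & exists2 C : R, 0 < C & forall y,
  `|y - z0.2| < rho -> `|g (z0.1, y) - g z0| <= C * `|F (z0.1, y)| ^+ 2.
Proof.
have [r1 r10 hr1] := critical_value.
have [c c0 hc] := gradient_kernel_small gC3 gMB Fz0.
have r110 : 0 < Num.min r1 1 by rewrite lt_min r10 ltr01.
have [r2 r20 hr2] := hc _ r110.
have [C Cb] := local_bounds_ex gC3 (`|z0| + 1); have C0 := bounds_gt0 Cb.
exists (Num.min r2 1); first by rewrite lt_min r20 ltr01.
exists (C * c ^+ 2) => [|y]; first by rewrite mulr_gt0 // exprn_gt0.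
rewrite lt_min => /andP[yr2 y1].
have [|m [Fm mF mr _]] := hr2 z0.1 y.
  by rewrite -zE pair_snd_sub norm_pair0l.
move: mr; rewrite lt_min => /andP[mr1 m1].
have bd u : `|u - z0.2| < 1 -> `|u| <= `|z0| + 1.
  move=> ur; rewrite -[u](subrK z0.2) (le_trans (ler_normD _ _)) // addrC lerD ?norm_snd //.
  by rewrite ltW.
have b1 : `|z0.1| <= `|z0| + 1 by rewrite (le_trans (norm_fst z0)) // lerDl.
have := objective_taylor Cb b1 (bd _ m1) (bd _ y1); rewrite Fm dot0l subr0 (hr1 m mr1 Fm) => h.
rewrite (le_trans h) // -mulrA ler_wpM2l ?(ltW C0) // -exprMn lerXn2r ?nnegrE //.
by rewrite mulr_ge0 // ltW.
Qed.

End CriticalValue.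

(** * Convergence of the gradient flow *)

Section Stay.
Context {R : realType}.

(** Continuous induction: at the supremum of the times up to which the bound [r] has
    held, the bound [r'] holds, which leaves room to go on. *)
Lemma stay_below (n : R -> R) (a r r' : R) : r' < r -> n a <= r ->
  (forall t, a <= t -> n s @[s --> t^'+] --> n t) ->
  (forall t, a < t -> n s @[s --> t^'-] --> n t) ->
  (forall t, a <= t -> (forall s, a <= s <= t -> n s <= r) -> n t <= r') ->
  forall t, a <= t -> n t <= r.
Proof.
move=> r'r nar nr nl ind b ab; rewrite leNgt; apply/negP => rnb.
pose S := [set t : R | a <= t /\ forall s, a <= s <= t -> n s <= r].
have Sa : S a by split=> // s /andP[as_ sa]; rewrite (@le_anti _ _ s a) // as_ sa.
have Sb t : S t -> t <= b.
  move=> [at_ ht]; rewrite leNgt; apply/negP => bt.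
  by have := ht b; rewrite ab ltW // => /(_ isT); rewrite leNgt rnb.
have supS : has_sup S by split; [exists a|exists b => t /Sb].
pose u := sup S.
have au : a <= u by exact: sup_upper_bound supS _ Sa.
have below s : a <= s -> s < u -> n s <= r.
  move=> as_ su.
  have [t [at_ ht] st] := @sup_adherent _ S (u - s) (ltac:(by rewrite subr_gt0)) supS.
  by apply: ht; rewrite as_ /= ltW //; rewrite subKr in st.
have nur : n u <= r.
  move: au; rewrite le_eqVlt => /predU1P[<- //|au].
  rewrite leNgt; apply/negP => ru.
  have /cvgrPdist_lt/(_ (n u - r)) := nl u au; rewrite subr_gt0 => /(_ ru) hl.
  near (u^'-) => s.
  have : n s <= r by apply: below; near: s; [exact: nbhs_left_ge|exact: nbhs_left_lt].
  have : `|n u - n s| < n u - r by near: s.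
  by rewrite ltr_norml => /andP[_ ?] ?; lra.
have Su : S u.
  split=> // s /andP[as_]; rewrite le_eqVlt => /predU1P[-> //|]; exact: below.
have nur' : n u <= r' by apply: ind => //; case: Su.
have /cvgrPdist_lt/(_ (r - r')) := nr u au; rewrite subr_gt0 => /(_ r'r) hr.
have /nbhs_ballP[e /= e0 he] : nbhs u (fun s => u < s -> `|n u - n s| < r - r') by exact: hr.
have : S (u + e / 2).
  split=> [|s /andP[as_ su]]; first by rewrite (le_trans au) // lerDl divr_ge0 // ltW.
  have [su'|us] := leP s u; first by apply: Su.2; rewrite as_.
  have : `|n u - n s| < r - r'.
    apply: he => //; rewrite -ball_normE /= distrC gtr0_norm ?subr_gt0 //.
    by rewrite ltrBlDl (le_lt_trans su) // ltrD2l ltr_pdivrMr // ltr_pMr // ltr1n.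
  by rewrite ltr_norml => /andP[? _]; lra.
move=> /(sup_upper_bound supS); rewrite -/u -subr_ge0 opprD addrA subrr add0r oppr_ge0 leNgt.
by rewrite divr_gt0.
Unshelve. all: by end_near. Qed.

Lemma amgm_weight (f q s E : R) : 0 < s -> 0 < E -> f ^+ 2 <= q ->
  f <= q * E / (2 * s) + s / (2 * E).
Proof.
move=> s0 E0 fq.
have h1 : f ^+ 2 * E / (2 * s) <= q * E / (2 * s).
  by rewrite ler_wpM2r ?invr_ge0 ?mulr_ge0 ?(ltW s0) // ler_wpM2r // ltW.
have h2 : f ^+ 2 * E / (2 * s) + s / (2 * E) - f = (f * E - s) ^+ 2 / (2 * s * E).
  by field; rewrite !gt_eqF.
have h3 : 0 <= (f * E - s) ^+ 2 / (2 * s * E).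
  by rewrite divr_ge0 ?sqr_ge0 // !mulr_ge0 // ltW.
by rewrite -h2 in h3; move: h1 h3; clear; lra.
Qed.

End Stay.

Section Flow.
Context {R : realType} {p d : nat} (g : 'rV[R]_p * 'rV[R]_d -> R).
Hypothesis gC3 : Ck_on 3 setT g.
Local Notation E := ('rV[R]_p * 'rV[R]_d)%type.
Local Notation F := (gradient g).
Variable phi : R -> 'rV[R]_p -> 'rV[R]_d -> 'rV[R]_d.
Hypothesis phiflow : is_gradient_flow g phi.

Lemma flow0 x y : phi 0 x y = y. Proof. by case: (phiflow x y). Qed.

Lemma is_derive_flow x y (t : R) : 0 < t ->
  is_derive t 1 (fun s => phi s x y) (- F (x, phi t x y)).
Proof. by move=> t0; case: (phiflow x y) => _ _; apply. Qed.

Lemma flow_cvg_right x y (t : R) : 0 <= t -> phi s x y @[s --> t^'+] --> phi t x y.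
Proof.
rewrite le_eqVlt => /predU1P[<-|t0]; last exact: is_derive_cvg_right (is_derive_flow x y t0).
have [_ h _] := phiflow x y.
have h1 : (fun s : R => s *: (s^-1 *: (phi s x y - phi 0 x y)) + phi 0 x y) @ 0^'+ --> phi 0 x y.
  rewrite -[X in _ --> X]add0r -(scale0r (- grad_y g x (phi 0 x y))).
  apply: cvgD; last exact: cvg_cst.
  by apply: cvgZ h; exact: cvg_at_right_filter.
apply: cvg_trans h1; apply: near_eq_cvg.
near=> s; have s0 : 0 < s by near: s; exact: nbhs_right_gt.
by rewrite scalerA divff ?gt_eqF // scale1r subrK.
Unshelve. all: by end_near. Qed.

Lemma flow_continuous x y (t : R) : 0 < t -> {for t, continuous (fun s => phi s x y)}.
Proof. by move=> t0; exact: is_derive_continuous (is_derive_flow x y t0). Qed.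

Lemma pair_cvg {T : Type} (x : 'rV[R]_p) (G : set_system T) (u : T -> 'rV[R]_d) l :
  Filter G -> u s @[s --> G] --> l -> (x, u s) @[s --> G] --> ((x, l) : E).
Proof.
by move=> FG ul; exact: (@cvg_pair _ _ _ _ (nbhs x) (nbhs l) _ _ _ (fun=> x) _ (cvg_cst x) ul).
Qed.

Lemma continuous_snd_le {W : normedModType R} (f : E -> W) (x : 'rV[R]_p) (l : 'rV[R]_d) (e : R) :
  continuous f -> 0 < e -> exists2 del : R, 0 < del & forall v, `|v - l| < del ->
    `|f (x, v) - f (x, l)| <= e.
Proof.
move=> cf e0; have : \forall v \near l, `|f (x, l) - f (x, v)| <= e.
  have c : (x, v) @[v --> l] --> ((x, l) : E) by exact: (@pair_cvg _ x (nbhs l) id l _ (@cvg_id _ _)).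
  by have /cvgrPdist_le/(_ e e0) := cvg_comp _ _ c (cf (x, l)).
move/nbhs_ballP => [del /= del0 hdel]; exists del => // v vl.
by rewrite distrC; apply: hdel; rewrite -ball_normE /= distrC.
Qed.

Lemma flow_comp_cvg_right {W : topologicalType} (f : E -> W) x y (t : R) : continuous f -> 0 <= t ->
  f (x, phi s x y) @[s --> t^'+] --> f (x, phi t x y).
Proof.
move=> cf t0; apply: (cvg_comp (fun s => (x, phi s x y) : E) f); last exact: cf.
by apply: pair_cvg; exact: flow_cvg_right.
Qed.

Lemma objective_continuous : continuous g.
Proof. by move=> z; apply/differentiable_continuous; have [+ _] := gC3; apply. Qed.

Lemma gradient_continuous : continuous F.
Proof. by move=> z; apply/differentiable_continuous; exact: gradient_differentiable. Qed.

Lemma is_derive_objective_flow x y (t : R) : 0 < t ->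
  is_derive t 1 (fun s => g (x, phi s x y)) (- dot (F (x, phi t x y)) (F (x, phi t x y))).
Proof.
move=> t0; have := is_derive_objective gC3 x (is_derive_flow x y t0).
by rewrite dotNr.
Qed.

Lemma objective_flow_nincr x y (a b : R) : 0 <= a -> a <= b ->
  g (x, phi b x y) <= g (x, phi a x y).
Proof.
move=> a0 ab; apply: (@derive_le0_nincr _ (fun s => g (x, phi s x y))
    (fun t => - dot (F (x, phi t x y)) (F (x, phi t x y)))) => //.
- by move=> t at_ _; apply: is_derive_objective_flow; exact: le_lt_trans at_.
- by move=> t _ _; rewrite oppr_le0 dot_ge0.
- exact: flow_comp_cvg_right objective_continuous a0.
Qed.

Lemma flow_stay x y l (T r r' : R) : 0 <= T -> r' < r -> `|phi T x y - l| <= r ->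
  (forall t, T <= t -> (forall s, T <= s <= t -> `|phi s x y - l| <= r) -> `|phi t x y - l| <= r') ->
  forall t, T <= t -> `|phi t x y - l| <= r.
Proof.
move=> T0 r'r h0 ind; apply: (stay_below r'r h0) => // t Tt.
- apply: cvg_norm; apply: cvgB; last exact: cvg_cst.
  by apply: flow_cvg_right; exact: le_trans Tt.
- have t0 : 0 < t by exact: le_lt_trans Tt.
  apply: cvg_norm; apply: cvgB; last exact: cvg_cst.
  by apply: cvg_at_left_filter; exact: flow_continuous.
Qed.

Section Convergence.
Hypothesis gMB : parametric_Morse_Bott g.
Variables (x : 'rV[R]_p) (y : 'rV[R]_d).
Hypothesis gcoercive : coercive (fun y => g (x, y)).
Local Notation u t := (phi t x y).
Local Notation h t := (g (x, phi t x y)).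

Lemma flow_bounded : exists r, forall t, 0 <= t -> `|(x, u t) : E| <= r.
Proof.
have [r hr] := gcoercive (h 0 + 1).
exists (Num.max `|x| `|r|) => t t0.
rewrite prod_normE /= ge_max !le_max lexx /=; apply/orP; right.
have er : enorm (u t) < r.
  rewrite ltNge; apply/negP => /hr; apply/negP; rewrite -ltNge.
  by rewrite (le_lt_trans (objective_flow_nincr x y (lexx 0) t0)) // ltrDl.
have e0 : 0 <= enorm (u t) by exact: sqrtr_ge0.
rewrite -ler_sqr ?nnegrE // (le_trans (norm_le_dot _)) // -enorm_sqr.
by rewrite ler_sqr ?nnegrE // (le_trans (ltW er)) // ler_norm.
Qed.

(** Far in the future the objective decreases little, so that the gradient is small
    at one point of every interval of length [tau]; and over such an interval it
    cannot vary much, as the trajectory is bounded. *)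
Lemma gradient_flow_small (eps : R) : 0 < eps ->
  exists2 T : R, 0 <= T & forall t, T <= t -> `|F (x, u t)| <= eps.
Proof.
move=> eps0; have [r hr] := flow_bounded.
have [C Cb] := local_bounds_ex gC3 r; have C0 := bounds_gt0 Cb.
pose tau := eps / 2 / (C * C).
have tau0 : 0 < tau by rewrite !divr_gt0 // mulr_gt0.
pose S := [set z | exists2 t : R, 0 <= t & z = h t].
have [K K0 hK] := continuous_bounded_ball (@compact_ball_pair R p d) r objective_continuous.
have infS : has_inf S.
  split; first by exists (h 0), 0.
  by exists (- K) => z [t t0 ->]; have := hK _ (hr t t0); rewrite ler_norml => /andP[].
have e0 : 0 < tau * (eps / 2) ^+ 2 by rewrite mulr_gt0 // exprn_gt0 // divr_gt0.
have [z [T T0 ->] hT] := inf_adherent e0 infS.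
exists T => // t Tt.
have t0 : 0 <= t by exact: le_trans Tt.
have infle s : 0 <= s -> inf S <= h s by move=> s0; apply: ge_inf; [exact: infS.2|exists s].
have ttau : t < t + tau by rewrite ltrDl.
have [c /andP[tc ct] e] := derive_mean_value ttau
  (fun s ts _ => is_derive_objective_flow x y (le_lt_trans t0 ts))
  (flow_comp_cvg_right objective_continuous t0).
have c0 : 0 <= c by rewrite ltW // (le_lt_trans t0).
have dropT : h t - h (t + tau) <= tau * (eps / 2) ^+ 2.
  have := infle (t + tau) (ltW (le_lt_trans t0 ttau)).
  by have := objective_flow_nincr x y T0 Tt; lra.
have Fc : `|F (x, u c)| <= eps / 2.
  have e2 : 0 <= eps / 2 by rewrite divr_ge0 // ltW.
  rewrite -ler_sqr ?nnegrE // (le_trans (norm_le_dot _)) //.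
  rewrite -(ler_pM2l tau0) (le_trans _ dropT) // -[h t - _]opprB e.
  by rewrite addrAC subrr add0r mulNr opprK mulrC.
have uct : `|u c - u t| <= C * (c - t).
  apply: (@speed_le _ _ (fun s => u s) (fun s => - F (x, u s)) C t c (ltW tc)).
  - by move=> s ts _; apply: is_derive_flow; exact: le_lt_trans ts.
  - exact: flow_cvg_right.
  - by move=> s ts _; rewrite normrN; apply: (gradient_bound Cb); apply: hr; rewrite ltW // (le_lt_trans t0).
rewrite -[F (x, u t)](subrK (F (x, u c))) (le_trans (ler_normD _ _)) // [leRHS]splitr lerD //.
rewrite (le_trans (gradient_lipschitz Cb (hr _ t0) (hr _ c0))) // pair_snd_sub norm_pair0l distrC.
rewrite (le_trans (ler_wpM2l (ltW C0) uct)) // mulrA.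
rewrite (@le_trans _ _ (C * C * tau)) ?ler_wpM2l ?mulr_ge0 ?(ltW C0) //; first by lra.
by rewrite /tau mulrC divfK // gt_eqF // mulr_gt0.
Qed.

Lemma flow_cluster : exists l, forall (eps T : R), 0 < eps -> exists2 t, T <= t & `|u t - l| < eps.
Proof.
have [r hr] := flow_bounded.
have hA : (u t @[t --> +oo]) [set v : 'rV[R]_d | `|v| <= r].
  have : \forall t \near +oo, `|u t| <= r; last by [].
  near=> t; rewrite (le_trans (norm_snd (x, u t))) // hr //.
have [l [_ hl]] := compact_ball_rV (fmap_proper_filter _ _) hA.
exists l => eps T eps0.
have [|v [[t Tt <-] vl]] := hl ((fun t => u t) @` [set t | T <= t]) (ball l eps) _ (nbhsx_ballx _ _ eps0).
  have : \forall t \near +oo, ((fun t => u t) @` [set t | T <= t]) (u t); last by [].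
  by near=> t; exists t => //=.
by exists t => //; move: vl; rewrite -ball_normE /= distrC.
Unshelve. all: by end_near. Qed.

(** A cluster point [l] is critical.  When the trajectory comes close enough to [l],
    the Lojasiewicz inequality bounds its remaining length by a small number, so
    that it stays close to [l] for ever. *)
Theorem flow_cvg : exists l, F (x, l) = 0 /\ u t @[t --> +oo] --> l.
Proof.
have [l hl] := flow_cluster; have [r hr] := flow_bounded; exists l.
have Fl : F (x, l) = 0.
  apply/eqP; rewrite -normr_le0; apply/ler_addgt0Pl => e e0; rewrite addr0.
  have e20 : 0 < e / 2 by rewrite divr_gt0.
  have [T T0 hT] := gradient_flow_small e20.
  have [del del0 hdel] := continuous_snd_le x l gradient_continuous e20.
  have [t Tt tl] := hl del T del0.
  rewrite -[F (x, l)](subrK (F (x, u t))) (le_trans (ler_normD _ _)) // [leRHS]splitr lerD ?hT //.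
  by rewrite distrC; exact: hdel.
split=> //.
have gl (e : R) (e0 : 0 < e) := continuous_snd_le x l objective_continuous e0.
have h_ge t : 0 <= t -> g (x, l) <= h t.
  move=> t0; apply/ler_addgt0Pr => e e0.
  have [del del0 hdel] := gl e e0; have [s ts sl] := hl del t del0.
  have := hdel _ sl; have := objective_flow_nincr x y t0 ts.
  by rewrite ler_norml => ? /andP[? _]; lra.
have [rho rho0 [C C0 hC]] := lojasiewicz gC3 gMB Fl.
apply/cvgrPdist_le => eps' eps'0.
pose eps := Num.min eps' (rho / 2).
have eps0 : 0 < eps by rewrite lt_min eps'0 divr_gt0.
have epsrho : eps < rho.
  by rewrite gt_min; apply/orP; right; rewrite ltr_pdivrMr // ltr_pMr // ltr1n.
pose a := (2 * C)^-1; have a0 : 0 < a by rewrite invr_gt0 mulr_gt0.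
pose s := a * eps / 2; have s0 : 0 < s by rewrite divr_gt0 // mulr_gt0.
have se : 0 < s * (eps / 4) by rewrite mulr_gt0 // divr_gt0.
have [del del0 hdel] := gl _ se.
have m0 : 0 < Num.min del (eps / 4) by rewrite lt_min del0 divr_gt0.
have [T T1 uT] := hl _ 1 m0.
have T0 : 0 < T by exact: lt_le_trans T1.
move: uT; rewrite lt_min => /andP[uTdel uTeps].
have hTs : h T - g (x, l) <= s * (eps / 4).
  by have := hdel _ uTdel; rewrite ler_norml => /andP[].
(* the AM-GM inequality with an exponential weight bounds the speed by [- M'], as
   the Lojasiewicz inequality reads [2 * a * (h t - g (x, l)) <= q t] *)
pose M t := (h t - g (x, l)) * expR (a * (t - T)) / s + s / (2 * a) * expR (- a * (t - T)).
suff stay t : T <= t -> `|u t - l| <= eps.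
  by near=> t; rewrite distrC (le_trans (stay t _)) // ge_min lexx.
apply: (@flow_stay _ _ _ T eps (eps * 3 / 4)) => //.
- exact: ltW.
- by lra.
- by rewrite ltW // (lt_trans uTeps) //; lra.
move=> {}t Tt near_l.
pose q t := dot (F (x, u t)) (F (x, u t)).
pose M' t := (- q t * expR (a * (t - T)) + (h t - g (x, l)) * (a * expR (a * (t - T)))) / s +
  s / (2 * a) * (- a * expR (- a * (t - T))).
have dM w : T < w -> is_derive w 1 M (M' w).
  move=> Tw; have h1 := is_derive_objective_flow x y (lt_trans T0 Tw).
  have h2 := is_derive_expR_affine a T w; have h3 := is_derive_expR_affine (- a) T w.
  have h4 : is_derive w 1 (fun v => (h v - g (x, l)) * expR (a * (v - T)))
      (- q w * expR (a * (w - T)) + (h w - g (x, l)) * (a * expR (a * (w - T)))).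
    have h5 : is_derive w 1 (fun v => h v - g (x, l)) (- q w) by apply: is_derive_eq; rewrite subr0.
    by apply: is_derive_eq; rewrite /GRing.scale /= addrC [X in X + _]mulrC.
  rewrite /M /M'; apply: is_deriveD.
  by apply: is_derive_eq; rewrite /GRing.scale /= mulr0 add0r mulrC.
have MT : M T <= eps / 2.
  rewrite /M subrr !mulr0 expR0 !mulr1.
  have -> : s / (2 * a) = eps / 4 by rewrite /s; field; rewrite gt_eqF.
  have : (h T - g (x, l)) / s <= eps / 4 by rewrite ler_pdivrMr // mulrC.
  by clear; lra.
have M0 w : T <= w -> 0 <= M w.
  move=> Tw; apply: addr_ge0.
    apply: divr_ge0; last exact: ltW.
    by apply: mulr_ge0; rewrite ?expR_ge0 // subr_ge0 h_ge // (le_trans (ltW T0)).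
  apply: mulr_ge0; last exact: expR_ge0.
  by apply: divr_ge0; [exact: ltW|apply: mulr_ge0 => //; exact: ltW].
have len : `|u t - u T| <= M T - M t.
  apply: (@length_le _ _ (fun w => u w) (fun w => - F (x, u w)) M M') => //.
  - by move=> w Tw _; apply: is_derive_flow; exact: lt_trans Tw.
  - by apply: flow_cvg_right; exact: ltW.
  - by move=> w Tw _; exact: dM.
  - rewrite /M; apply: cvgD.
      apply: cvgMl; apply: cvgM; last exact: is_derive_cvg_right (is_derive_expR_affine a T T).
      apply: cvgB; last exact: cvg_cst.
      by apply: flow_comp_cvg_right objective_continuous _; exact: ltW.
    by apply: cvgMr; exact: is_derive_cvg_right (is_derive_expR_affine (- a) T T).
  - move=> w Tw wt; rewrite normrN.
    have w0 : 0 <= w by rewrite ltW // (lt_trans T0).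
    have E0 := expR_gt0 (a * (w - T)).
    have := @amgm_weight R `|F (x, u w)| (q w) s (expR (a * (w - T))) s0 E0 (norm_le_dot _).
    have hq : (h w - g (x, l)) * a <= q w / 2.
      have := hC (u w); rewrite /= => /(_ (le_lt_trans (near_l w _) epsrho)).
      rewrite (ltW Tw) wt => /(_ isT) hh.
      have h1 : h w - g (x, l) <= C * q w.
        rewrite (le_trans (ler_norm _)) // (le_trans hh) // ler_wpM2l ?(ltW C0) //.
        exact: norm_le_dot.
      rewrite (le_trans (ler_wpM2r (ltW a0) h1)) // /a invfM.
      by rewrite [2^-1 * _]mulrC mulrA [C * _]mulrC mulfK ?gt_eqF.
    rewrite /M' (mulNr a (w - T)) expRN; move: E0 hq s0 a0.
    move: (expR _) (q w) (h w - _) (`|_|) => e qq hh f E0 hq s0' a0' am.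
    have h1 : hh * a * (e / s) <= qq / 2 * (e / s) by rewrite ler_wpM2r // divr_ge0 // ltW.
    have h2 : s / (2 * e) = s / 2 / e by field; rewrite gt_eqF.
    have h3 : s / (2 * a) * (- a * e^-1) = - (s / 2 / e) by field; rewrite !gt_eqF.
    have h4 : qq * e / (2 * s) = qq / 2 * (e / s) by field; rewrite gt_eqF.
    have h5 : (- qq * e + hh * (a * e)) / s = - 2 * (qq / 2 * (e / s)) + hh * a * (e / s).
      by field; rewrite gt_eqF.
    by rewrite h3 h5; move: am h1; rewrite h2 h4; clear; lra.
have := M0 t Tt => Mt.
have -> : u t - l = (u t - u T) + (u T - l) by rewrite addrA subrK.
rewrite (le_trans (ler_normD _ _)) //.
by move: len MT Mt uTeps; clear; lra.
Unshelve. all: by end_near. Qed.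

End Convergence.
End Flow.

(** * Differentiability through approximate affine maps *)

Section ApproxAffine.
Context {R : realType} {p d : nat}.
Implicit Types (f : 'rV[R]_p -> 'rV[R]_d) (A B : 'M[R]_(p, d)).

(** Differentiability up to a relative error.  Unlike differentiability itself, it is
    stable under Euler steps and under perturbations by maps with a small Lipschitz
    constant, at the cost of a larger error. *)
Definition approx_affine f (x : 'rV[R]_p) A (eps : R) : Prop :=
  exists2 del : R, 0 < del & forall h : 'rV[R]_p, `|h| < del ->
    `|f (x + h) - f x - h *m A| <= eps * `|h|.

Lemma approx_affineW f x A (e e' : R) : e <= e' -> approx_affine f x A e -> approx_affine f x A e'.
Proof.
by move=> ee' [del del0 hd]; exists del => // h /hd /le_trans; apply; rewrite ler_wpM2r.
Qed.

Lemma approx_affine_close f x A B (e e' : R) : 0 <= e + e' ->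
  approx_affine f x A e -> approx_affine f x B e' -> `|A - B| <= e + e'.
Proof.
move=> ee0 [r r0 hr] [s s0 hs]; apply: mx_norm_le => // i j.
pose t := Num.min r s / 2.
have m0 : 0 < Num.min r s by rewrite lt_min r0.
have t0 : 0 < t by rewrite divr_gt0.
pose h : 'rV[R]_p := t *: delta_mx ord0 i.
have ht : `|h| <= t.
  apply: mx_norm_le => [|k l]; first exact: ltW.
  rewrite !mxE normrM gtr0_norm // ger_pMr //.
  by case: andP => _; rewrite ?normr1 // normr0.
have htr : `|h| < Num.min r s.
  by rewrite (le_lt_trans ht) // ltr_pdivrMr // ltr_pMr // ltr1n.
move: htr; rewrite lt_min => /andP[/hr h1 /hs h2].
have e1 : `|h *m (A - B)| <= (e + e') * t.
  have -> : h *m (A - B) = (f (x + h) - f x - h *m B) - (f (x + h) - f x - h *m A).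
    rewrite mulmxBr; move: (f _ - f _) (h *m A) (h *m B) => u a b.
    by apply/rowP => k; rewrite !mxE; ring.
  rewrite (le_trans (ler_normB _ _)) // (le_trans (lerD h2 h1)) //.
  by rewrite -mulrDl addrC ler_wpM2l.
have := le_trans (mx_entry_le _ ord0 j) e1.
rewrite /h -scalemxAl -rowE !mxE normrM gtr0_norm // mulrC ler_pM2r //.
Qed.

Lemma approx_affine_jacobian f x (e : R) : differentiable f x -> 0 < e ->
  approx_affine f x ('J f x) e.
Proof.
move=> /diff_locallyP[_ /eqaddoP h] e0; have := h e e0.
move/nbhs_ballP => [del /= del0 hd]; exists del => // v vd.
have := hd v; rewrite -ball_normE /= sub0r normrN => /(_ vd).
rewrite -[X in `|X| <= _ -> _]/(f (v + x) - (f x + 'd f x v)).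
by rewrite /jacobian mul_rV_lin1 [v + x]addrC opprD addrA.
Qed.

Lemma mulmxr_continuous A : continuous (mulmxr A : 'rV[R]_p -> 'rV[R]_d).
Proof.
apply: bounded_linear_continuous; apply/linear_boundedP.
near=> r => u /=; rewrite (le_trans (mulmx_norm _ _)) // mulrAC ler_wpM2r //.
Unshelve. all: by end_near. Qed.

Lemma approx_affine_differentiable_eq f x A :
  (forall e : R, 0 < e -> approx_affine f x A e) -> differentiable f x.
Proof.
move=> hA.
pose L : {linear 'rV[R]_p -> 'rV[R]_d} := mulmxr A.
have fL : f \o shift x = cst (f x) + L +o_ (0 : 'rV[R]_p) id.
  apply/eqaddoP => e e0; have [del del0 hd] := hA e e0.
  apply/nbhs_ballP; exists del => // v; rewrite -ball_normE /= sub0r normrN => /hd.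
  rewrite -[X in _ -> `|X| <= _]/(f (v + x) - (f x + v *m A)).
  by rewrite [v + x]addrC opprD addrA.
have Lc : continuous L by exact: mulmxr_continuous.
by apply/diff_locallyP; rewrite (diff_unique Lc fL).
Qed.

(** Approximability up to every relative error is differentiability: the
    approximating matrices form a Cauchy sequence. *)
Lemma approx_affine_differentiable f x :
  (forall e : R, 0 < e -> exists A, approx_affine f x A e) -> differentiable f x.
Proof.
move=> hA.
pose eps (n : nat) : R := n.+1%:R^-1.
have eps0 n : 0 < eps n by rewrite invr_gt0 ltr0n.
have /choice[A A_approx] n : exists A, approx_affine f x A (eps n) by exact: hA.
have eps_small (e : R) : 0 < e -> exists N, forall n, (N <= n)%N -> eps n <= e.
  move=> e0; exists (Num.truncn e^-1) => n Nn.
  rewrite -[e]invrK lef_pV2 ?posrE ?invr_gt0 ?ltr0n //.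
  by rewrite (le_trans (ltW (truncnS_gt _))) // ler_nat ltnS.
have A_close n k : `|A n - A k| <= eps n + eps k.
  by apply: approx_affine_close (A_approx n) (A_approx k); rewrite addr_ge0 // ltW.
have cvgA : cvg (A n @[n --> \oo]).
  apply/cauchy_cvgP; apply/cauchy_ballP => e e0; near_simpl.
  have [N hN] := eps_small (e / 3) (divr_gt0 e0 (ltr0n _ 3)).
  near=> n m => /=; rewrite -ball_normE /=.
  rewrite (le_lt_trans (A_close _ _)) //.
  have h1 : eps n <= e / 3 by apply: hN; near: n; exists N.
  have h2 : eps m <= e / 3 by apply: hN; near: m; exists N.
  by move: h1 h2 (e0); clear; lra.
apply: (@approx_affine_differentiable_eq _ _ (limn A)) => e e0.
have e20 : 0 < e / 2 by rewrite divr_gt0.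
have [N hN] := eps_small _ e20.
have ep0 : 0 < e / 2 / p.+1%:R by rewrite divr_gt0.
have near_lim : \forall n \near \oo, `|limn A - A n| <= e / 2 / p.+1%:R.
  by move/cvgrPdist_le : cvgA; apply.
have [M _ hM] := near_lim.
pose n := maxn N M.
have [del del0 hd] := A_approx n.
exists del => // h /hd le.
have -> : f (x + h) - f x - h *m limn A = (f (x + h) - f x - h *m A n) - h *m (limn A - A n).
  by rewrite mulmxBr opprB addrA subrK.
rewrite (le_trans (ler_normB _ _)) // [X in _ <= X * _](splitr e) mulrDl lerD //.
  by rewrite (le_trans le) // ler_wpM2r // hN // leq_maxl.
rewrite (le_trans (mulmx_norm _ _)) // mulrAC ler_wpM2r //.
apply: (@le_trans _ _ (p.+1%:R * `|limn A - A n|)).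
  by rewrite ler_wpM2r // ler_nat.
by rewrite mulrC -ler_pdivlMr // hM //= leq_maxr.
Unshelve. all: by end_near. Qed.

End ApproxAffine.

(** * The flow on bounded time intervals *)

Section FiniteTime.
Context {R : realType} {p d : nat} (g : 'rV[R]_p * 'rV[R]_d -> R).
Hypothesis gC3 : Ck_on 3 setT g.
Local Notation E := ('rV[R]_p * 'rV[R]_d)%type.
Local Notation F := (gradient g).
Variable phi : R -> 'rV[R]_p -> 'rV[R]_d -> 'rV[R]_d.
Hypothesis phiflow : is_gradient_flow g phi.
Variable L : R.
Hypothesis L0 : 0 < L.
Hypothesis gLip : grad_y_lipschitz g L.

Lemma dot_cvg {n} {T : Type} (G : set_system T) {FG : Filter G} (u v : T -> 'rV[R]_n) a b :
  u s @[s --> G] --> a -> v s @[s --> G] --> b -> dot (u s) (v s) @[s --> G] --> dot a b.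
Proof.
move=> ua vb.
have c i : u s ord0 i * v s ord0 i @[s --> G] --> a ord0 i * b ord0 i.
  apply: cvgM.
    by apply: (@cvg_comp _ _ _ u (fun A : 'rV[R]_n => A ord0 i) _ _ _ ua); exact: coord_continuous.
  by apply: (@cvg_comp _ _ _ v (fun A : 'rV[R]_n => A ord0 i) _ _ _ vb); exact: coord_continuous.
by apply: cvg_big => [|i _]; [exact: add_continuous|exact: c].
Qed.

Lemma le_of_sqr_le (a b : R) : a ^+ 2 <= b -> a <= b + 1.
Proof. by have := sqr_ge0 (a - 1); nra. Qed.

Lemma abs_dot_le n (u v : 'rV[R]_n) : 2 * `|dot u v| <= n%:R * (`|u| ^+ 2 + `|v| ^+ 2).
Proof.
apply: (@le_trans _ _ (2 * (n%:R * `|u| * `|v|))); first by rewrite ler_wpM2l // norm_dot.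
have -> : 2 * (n%:R * `|u| * `|v|) = n%:R * (2 * (`|u| * `|v|)) by ring.
rewrite ler_wpM2l //; have := sqr_ge0 (`|u| - `|v|).
by move: `|u| `|v| => a b; nra.
Qed.

Lemma gradient_growth x y : `|F (x, y)| ^+ 2 <= 2 * L ^+ 2 * dot y y + 2 * `|F (x, 0)| ^+ 2.
Proof.
have h : `|F (x, y) - F (x, 0)| ^+ 2 <= L ^+ 2 * dot y y.
  rewrite (le_trans (norm_le_dot _)) // -!enorm_sqr -exprMn.
  have := gLip x y 0; rewrite subr0 => hL.
  by rewrite ler_sqr // nnegrE ?mulr_ge0 ?(ltW L0) // sqrtr_ge0.
rewrite -{1}[F (x, y)](subrK (F (x, 0))).
apply: (@le_trans _ _ ((`|F (x, y) - F (x, 0)| + `|F (x, 0)|) ^+ 2)).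
  by rewrite ler_sqr ?nnegrE ?addr_ge0 // ler_normD.
by rewrite (le_trans (sqrD_le _ _)) // lerD2r -mulrA ler_wpM2l.
Qed.

(** As the gradient grows at most linearly in [y], Gronwall's inequality applies to
    the square of the distance to the origin. *)
Lemma flow_locally_bounded (r T : R) y : exists r', forall x t,
  `|x| <= r -> 0 <= t -> t <= T -> `|(x, phi t x y) : E| <= r'.
Proof.
have [M M0 hM] := continuous_bounded_ball (@compact_ball_pair R p d) r (gradient_continuous gC3).
pose k : R := d%:R * (1 + 2 * L ^+ 2) + 1.
pose c : R := 2 * d%:R * M ^+ 2.
have L20 : 0 <= L ^+ 2 by exact: sqr_ge0.
have k0 : 0 < k by rewrite ltr_wpDl // mulr_ge0 // addr_ge0 // mulr_ge0.
have c0 : 0 <= c by rewrite /c !mulr_ge0 // sqr_ge0.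
pose b : R := (dot y y + c / k) * expR (k * T).
exists (Num.max r (b + 1)) => x t xr t0 tT.
rewrite prod_normE /= ge_max !le_max xr /=; apply/orP; right.
apply: le_of_sqr_le; apply: le_trans (norm_le_dot _) _.
pose f s := dot (phi s x y) (phi s x y).
pose f' s := dot (- F (x, phi s x y)) (phi s x y) + dot (phi s x y) (- F (x, phi s x y)).
have ck0 : 0 <= c / k by rewrite divr_ge0 // ltW.
have := @gronwall R f f' 0 t k c t0 k0.
rewrite subr0 {2 3}/f (flow0 phiflow) => /(_ _ _ _)/wrap[| | |le].
- by move=> s s0 _; apply: is_derive_dot; apply: is_derive_flow.
- have c1 : phi s x y @[s --> 0^'+] --> y.
    by rewrite -{2}(flow0 phiflow x y); exact: (flow_cvg_right phiflow).
  exact: (dot_cvg c1 c1).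
- move=> s s0 st; rewrite /f' dotC -mulr2n dotNr -[_ *+ 2]mulr_natl.
  have := abs_dot_le (phi s x y) (F (x, phi s x y)).
  have := ler_norm (- dot (phi s x y) (F (x, phi s x y))); rewrite normrN.
  have := gradient_growth x (phi s x y); have := norm_le_dot (phi s x y).
  have x0r : `|(x, 0) : E| <= r by rewrite prod_normE /= normr0 max_l.
  have F0 : `|F (x, 0)| ^+ 2 <= M ^+ 2 by rewrite ler_sqr ?nnegrE // hM.
  rewrite -/(f s); move: (`|dot (phi s x y) (F (x, phi s x y))|) (dot (phi s x y) (F (x, phi s x y))) (`|phi s x y|) (`|F (x, phi s x y)|) (f s) F0.
  move: (`|F (x, 0)|) => a m q w v u a2 h1 h2 h3 h4.
  have h5 : d%:R * (w ^+ 2 + v ^+ 2) <= d%:R * (u + (2 * L ^+ 2 * u + 2 * M ^+ 2)).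
    by rewrite ler_wpM2l // lerD // (le_trans h2) // lerD2l ler_wpM2l.
  have u0 : 0 <= u by rewrite (le_trans _ h1) // sqr_ge0.
  rewrite /k /c; move: h3 h4 h5 u0; clear; move: (L ^+ 2) (M ^+ 2) (w ^+ 2) (v ^+ 2).
  by move=> l2 m2 w2 v2 h3 h4 h5 u0; lra.
have f0 : f 0 = dot y y by rewrite /f (flow0 phiflow).
rewrite f0 in le; apply: (@le_trans _ _ ((dot y y + c / k) * expR (k * t))).
  by rewrite (le_trans _ le) // lerDl.
by rewrite ler_wpM2l ?addr_ge0 ?dot_ge0 // ler_expR ler_wpM2l // ltW.
Qed.

Lemma norm_pair_sum (V W : normedModType R) (a : V) (b : W) : `|(a, b) : V * W| <= `|a| + `|b|.
Proof. by rewrite prod_normE /= ge_max lerDl lerDr !normr_ge0. Qed.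

Lemma norm_pair_sqr (V W : normedModType R) (a : V) (b : W) :
  `|(a, b) : V * W| ^+ 2 <= `|a| ^+ 2 + `|b| ^+ 2.
Proof.
rewrite prod_normE /=; have [le|le] := leP `|a| `|b|.
  by rewrite lerDr sqr_ge0.
by rewrite lerDl sqr_ge0.
Qed.

Lemma is_derive_flow_sub y1 y2 x1 x2 (t : R) : 0 < t ->
  is_derive t 1 (fun s => phi s x1 y1 - phi s x2 y2) (- (F (x1, phi t x1 y1) - F (x2, phi t x2 y2))).
Proof.
move=> t0; have h1 := is_derive_flow phiflow x1 y1 t0; have h2 := is_derive_flow phiflow x2 y2 t0.
by apply: is_derive_eq; rewrite opprB opprK addrC.
Qed.

Lemma flow_sub_cvg_right y1 y2 x1 x2 (t : R) : 0 <= t ->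
  phi s x1 y1 - phi s x2 y2 @[s --> t^'+] --> phi t x1 y1 - phi t x2 y2.
Proof. by move=> t0; apply: cvgB; exact: flow_cvg_right. Qed.

(** Gronwall's inequality for the square of the distance of the two trajectories, in
    a bounded set where the gradient is Lipschitz in both variables. *)
Lemma flow_lipschitz (r T : R) y : 0 <= T -> exists2 K : R, 0 < K & forall x1 x2 t,
  `|x1| <= r -> `|x2| <= r -> 0 <= t -> t <= T ->
  `|phi t x1 y - phi t x2 y| <= K * `|x1 - x2|.
Proof.
move=> T0; have [r' hr'] := flow_locally_bounded r T y.
have [C Cb] := local_bounds_ex gC3 r'; have C0 := bounds_gt0 Cb.
pose k : R := d%:R * (1 + C ^+ 2) + 1.
have C20 : 0 <= C ^+ 2 by exact: sqr_ge0.
have k0 : 0 < k by rewrite ltr_wpDl // mulr_ge0 // addr_ge0.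
exists (expR (k * T)) => [|x1 x2 t x1r x2r t0 tT]; first exact: expR_gt0.
pose D s := phi s x1 y - phi s x2 y.
pose G s := F (x1, phi s x1 y) - F (x2, phi s x2 y).
pose c : R := d%:R * C ^+ 2 * `|x1 - x2| ^+ 2.
have c0 : 0 <= c by exact: mulr_ge0 (mulr_ge0 (ler0n _ _) C20) (sqr_ge0 _).
pose f s := dot (D s) (D s); pose f' s := dot (- G s) (D s) + dot (D s) (- G s).
have f0 : f 0 = 0 by rewrite /f /D !(flow0 phiflow) subrr dot0l.
have := @gronwall R f f' 0 t k c t0 k0.
rewrite subr0 f0 add0r => /(_ _ _ _)/wrap[| | |le].
- by move=> s s0 _; apply: is_derive_dot; exact: is_derive_flow_sub.
- by rewrite -[X in _ --> X]f0; apply: dot_cvg; exact: flow_sub_cvg_right.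
- move=> s s0 st; rewrite /f' dotC -mulr2n dotNr -[_ *+ 2]mulr_natl.
  have sT : s <= T by exact: le_trans tT.
  have := abs_dot_le (D s) (G s); have := ler_norm (- dot (D s) (G s)); rewrite normrN.
  have : `|G s| ^+ 2 <= C ^+ 2 * (`|x1 - x2| ^+ 2 + `|D s| ^+ 2).
    apply: (@le_trans _ _ ((C * `|(x1, phi s x1 y) - (x2, phi s x2 y) : E|) ^+ 2)).
      rewrite ler_sqr ?nnegrE ?mulr_ge0 ?(ltW C0) //; apply: (gradient_lipschitz Cb); apply: hr' => //; exact: ltW.
    by rewrite exprMn ler_wpM2l //; exact: norm_pair_sqr.
  have := norm_le_dot (D s); rewrite -/(f s).
  move: (`|dot (D s) (G s)|) (dot (D s) (G s)) (`|D s|) (`|G s|) (f s) => m q w v u h1 h2 h3 h4.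
  have h5 : d%:R * (w ^+ 2 + v ^+ 2) <= d%:R * (u + C ^+ 2 * (`|x1 - x2| ^+ 2 + u)).
    by rewrite ler_wpM2l // lerD // (le_trans h2) // ler_wpM2l // lerD2l.
  have u0 : 0 <= u by rewrite (le_trans _ h1) // sqr_ge0.
  by rewrite /k /c; move: h3 h4 h5 u0; clear; move: (d%:R : R) (C ^+ 2) (`|x1 - x2| ^+ 2) => n e z; lra.
have ck : c / k <= `|x1 - x2| ^+ 2.
  rewrite ler_pdivrMr // mulrC ler_wpM2r ?sqr_ge0 // /k mulrDr mulr1.
  by rewrite -addrA addrCA lerDl addr_ge0.
have e1 : 1 <= expR (k * T) by rewrite -expR0 ler_expR mulr_ge0 // ltW.
rewrite -ler_sqr ?nnegrE ?mulr_ge0 ?expR_ge0 // exprMn.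
apply: (le_trans (norm_le_dot _)); rewrite -/(D t) -/(f t).
apply: (@le_trans _ _ (c / k * expR (k * t))).
  by rewrite (le_trans _ le) // lerDl divr_ge0 // ltW.
rewrite mulrC ler_pM ?expR_ge0 ?divr_ge0 ?(ltW k0) //.
apply: (@le_trans _ _ (expR (k * T))); first by rewrite ler_expR ler_wpM2l // ltW.
by rewrite expr2 ler_peMl // expR_ge0.
Qed.

End FiniteTime.

Section EulerArithmetic.
Context {R : realType}.

Lemma euler_recursion (C tau q : R) :
  tau * (q - 1) * (1 + C * tau) + C * tau ^+ 2 = tau * ((1 + C * tau) * q - 1).
Proof. ring. Qed.

Lemma euler_defect (n1 n2 n3 n4 k h e tau C : R) :
  tau * n3 <= tau * (tau * h) -> tau * n4 <= tau * (k * (e * h)) ->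
  0 <= e * tau * h * (C + 1) -> 0 <= k * tau ^+ 2 * h ->
  n1 <= C * tau ^+ 2 * h -> n2 <= e * h ->
  n1 + n2 + tau * n3 + tau * n4 <= (e * (1 + (C + 1 + k) * tau) + (C + 1 + k) * tau ^+ 2) * h.
Proof. lra. Qed.

End EulerArithmetic.

Section FlowDifferentiable.
Context {R : realType} {p d : nat} (g : 'rV[R]_p * 'rV[R]_d -> R).
Hypothesis gC3 : Ck_on 3 setT g.
Local Notation E := ('rV[R]_p * 'rV[R]_d)%type.
Local Notation F := (gradient g).
Variable phi : R -> 'rV[R]_p -> 'rV[R]_d -> 'rV[R]_d.
Hypothesis phiflow : is_gradient_flow g phi.
Variable L : R.
Hypothesis L0 : 0 < L.
Hypothesis gLip : grad_y_lipschitz g L.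
Variables (x : 'rV[R]_p) (y : 'rV[R]_d).

(** By the bound on the second differences of the gradient, the difference of the
    speeds of the two trajectories is Lipschitz in time with a constant proportional
    to the distance of the parameters.  Hence an Euler step for the difference makes
    an error quadratic in the step and linear in this distance. *)
Lemma flow_euler_step (T : R) : 0 <= T -> exists2 C : R, 0 < C & forall x' t s,
  `|x' - x| <= 1 -> 0 <= t -> t <= s -> s <= T ->
  [/\ `|(x', phi t x' y) - (x, phi t x y) : E| <= C * `|x' - x| &
  `|phi s x' y - phi s x y - (phi t x' y - phi t x y) +
     (s - t) *: (F (x', phi t x' y) - F (x, phi t x y))| <= C * (s - t) ^+ 2 * `|x' - x|].
Proof.
move=> T0; pose r := `|x| + 1.
have [r1 hr1] := flow_locally_bounded gC3 phiflow L0 gLip r T y.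
have [K K0 hK] := flow_lipschitz gC3 phiflow L0 gLip r y T0.
pose r2 := `|r1| * 3.
have [C Cb] := local_bounds_ex gC3 r2; have C0 := bounds_gt0 Cb.
have r12 : `|r1| <= r2 by rewrite /r2 ler_peMr // ler1n.
have xr : `|x| <= r by rewrite lerDl.
have hr0 x' t : `|x'| <= r -> 0 <= t -> t <= T -> `|(x', phi t x' y) : E| <= `|r1|.
  by move=> *; apply: le_trans (ler_norm r1); exact: hr1.
have hr2 x' t : `|x'| <= r -> 0 <= t -> t <= T -> `|(x', phi t x' y) : E| <= r2.
  by move=> *; apply: le_trans r12; exact: hr0.
pose K1 : R := 1 + K; have K10 : 0 < K1 by rewrite addr_gt0.
pose C1 : R := C * C * K1 * 2.
have C10 : 0 < C1 by rewrite !mulr_gt0.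
exists (K1 + C1) => [|x' t s x'1 t0 ts sT]; first by rewrite addr_gt0.
have x'r : `|x'| <= r.
  by rewrite -[x'](subrK x) (le_trans (ler_normD _ _)) // addrC lerD2l.
have s0 : 0 <= s by exact: le_trans ts.
have tT : t <= T by exact: le_trans sT.
pose z1 w : E := (x', phi w x' y); pose z2 w : E := (x, phi w x y).
pose e := `|x' - x|; have e0 : 0 <= e by exact: normr_ge0.
have z12 w : 0 <= w -> w <= T -> `|z1 w - z2 w| <= K1 * e.
  move=> w0 wT; rewrite (le_trans (norm_pair_sum _ _)) // mulrDl mul1r lerD2l.
  exact: hK.
have delta_le w : 0 <= w -> w <= T -> `|F (z1 w) - F (z2 w)| <= C * (K1 * e).
  move=> w0 wT; rewrite (le_trans (gradient_lipschitz Cb (hr2 _ _ _ _ _) (hr2 _ _ _ _ _))) //.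
  by rewrite ler_wpM2l ?(ltW C0) // z12.
have Delta_le w : t <= w -> w <= T ->
    `|(phi w x' y - phi w x y) - (phi t x' y - phi t x y)| <= C * (K1 * e) * (w - t).
  move=> tw wT; apply: (@speed_le _ _ (fun v => phi v x' y - phi v x y)
    (fun v => - (F (z1 v) - F (z2 v)))) => //.
  - by move=> v tv vw; apply: (is_derive_flow_sub phiflow); exact: le_lt_trans tv.
  - exact: (flow_sub_cvg_right phiflow).
  - move=> v tv vw; rewrite normrN delta_le // ?(le_trans vw) //.
    by rewrite ltW // (le_lt_trans t0).
have speed w : t <= w -> w <= T -> `|phi w x y - phi t x y| <= C * (w - t).
  move=> tw wT; apply: (@speed_le _ _ (fun v => phi v x y) (fun v => - F (z2 v))) => //.
  - by move=> v tv vw; apply: (is_derive_flow phiflow); exact: le_lt_trans tv.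
  - exact: (flow_cvg_right phiflow).
  - move=> v tv vw; rewrite normrN; apply: (gradient_bound Cb); apply: hr2 => //.
      by rewrite ltW // (le_lt_trans t0).
    exact: le_trans vw wT.
have delta_lip w : t <= w -> w <= T ->
    `|(F (z1 w) - F (z2 w)) - (F (z1 t) - F (z2 t))| <= C1 * e * (w - t).
  move=> tw wT; have w0 : 0 <= w by exact: le_trans tw.
  pose u := phi w x y - phi t x y.
  have z2w : z2 t + (0, u) = z2 w by congr (_, _); rewrite /= ?addr0 // addrC subrK.
  have ur : `|u| <= `|r1| * 2.
    have n1 := le_trans (norm_snd (z2 w)) (hr0 x w xr w0 wT).
    have n2 := le_trans (norm_snd (z2 t)) (hr0 x t xr t0 tT).
    by rewrite (le_trans (ler_normB _ _)) // mulr_natr mulr2n lerD.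
  have ur2 : `|u| <= r2 by rewrite (le_trans ur) // ler_wpM2l // ler_nat.
  have z1u : `|z1 t + (0, u)| <= r2.
    rewrite (le_trans (ler_normD _ _)) // norm_pair0l /r2.
    have -> : `|r1| * 3 = `|r1| + `|r1| * 2 by ring.
    by rewrite lerD // hr0.
  have h1 := gradient_second_difference Cb (hr2 x' t x'r t0 tT) (hr2 x t xr t0 tT) ur2.
  rewrite -/(z1 t) -/(z2 t) z2w in h1.
  have h2 := gradient_lipschitz Cb (hr2 x' w x'r w0 wT) z1u.
  have -> : F (z1 w) - F (z2 w) - (F (z1 t) - F (z2 t)) =
     (F (z1 w) - F (z1 t + (0, u))) + (F (z1 t + (0, u)) - F (z2 w) - (F (z1 t) - F (z2 t))).
    by move: (F _) (F _) (F _) (F _) (F _) => a1 a2 a3 a4 a5; apply/rowP => i; rewrite !mxE; ring.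
  have h3 : `|F (z1 w) - F (z1 t + (0, u))| <= C * C * K1 * e * (w - t).
    apply: (le_trans h2); rewrite -!(mulrA C) ler_wpM2l ?(ltW C0) //.
    have -> : (x', phi w x' y) - (z1 t + (0, u)) =
        (0, (phi w x' y - phi w x y) - (phi t x' y - phi t x y)) :> E.
      congr (_, _); rewrite /= ?addr0 ?subrr // /u.
      by move: (phi w x' y) (phi t x' y) (phi w x y) (phi t x y) => a1 a2 a3 a4; apply/rowP => i; rewrite !mxE; ring.
    by rewrite norm_pair0l (le_trans (Delta_le w tw wT)) // !mulrA.
  have h4 : `|F (z1 t + (0, u)) - F (z2 w) - (F (z1 t) - F (z2 t))| <= C * C * K1 * e * (w - t).
    apply: (le_trans h1); apply: (@le_trans _ _ (C * (K1 * e) * (C * (w - t)))).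
      by rewrite ler_pM ?mulr_ge0 ?(ltW C0) // ?ler_wpM2l ?(ltW C0) ?z12 // speed.
    by rewrite le_eqVlt; apply/orP; left; apply/eqP; ring.
  rewrite (le_trans (ler_normD _ _)) // (le_trans (lerD h3 h4)) //.
  by rewrite le_eqVlt; apply/orP; left; apply/eqP; rewrite /C1; ring.
split.
  have K1le : K1 <= K1 + C1 by rewrite lerDl ltW.
  exact: le_trans (z12 t t0 tT) (ler_wpM2r (normr_ge0 _) K1le).
pose G := F (z1 t) - F (z2 t).
pose v w := phi w x' y - phi w x y + (w - t) *: G.
have -> : phi s x' y - phi s x y - (phi t x' y - phi t x y) + (s - t) *: G = v s - v t.
  by rewrite /v subrr scale0r addr0 addrAC.
have dlin (w : R) : is_derive w 1 (fun w => (w - t) *: G) G.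
  have := @is_derive_line R _ _ (@id 'rV[R]_d) (- (t *: G)) G w (@derivable_id _ _ _ _).
  rewrite derive_id; congr is_derive; apply/funext => b.
  by rewrite scalerBl addrC.
apply: (@le_trans _ _ (C1 * e * (s - t) * (s - t))); last first.
  rewrite -/e expr2 !mulrA [leRHS]mulrAC [X in _ <= X * _]mulrAC.
  by rewrite ler_wpM2r ?subr_ge0 // ler_wpM2r ?subr_ge0 // ler_wpM2r // lerDr ltW.
apply: (@speed_le _ _ v (fun w => - (F (z1 w) - F (z2 w)) + G)) => //.
- move=> w tw ws; apply: is_deriveD.
  by apply: (is_derive_flow_sub phiflow); exact: le_lt_trans tw.
- by apply: cvgD; [exact: (flow_sub_cvg_right phiflow)|exact: is_derive_cvg_right (dlin t)].
- move=> w tw ws; rewrite addrC -normrN opprB (le_trans (delta_lip w (ltW tw) _)) ?(le_trans ws) //.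
  by apply: ler_wpM2l; [exact: mulr_ge0 (ltW C10) e0|rewrite lerD2r].
Qed.

(** Linearize the difference of the gradients in the Euler step. *)
Lemma approx_affine_step (T : R) : 0 <= T -> exists2 C : R, 0 < C &
  forall A (e t tau : R), 0 <= e -> 0 <= t -> 0 < tau -> t + tau <= T ->
  approx_affine (fun x' => phi t x' y) x A e ->
  exists A', approx_affine (fun x' => phi (t + tau) x' y) x A' (e * (1 + C * tau) + C * tau ^+ 2).
Proof.
move=> T0; have [C1 C10 hC1] := flow_euler_step T0.
have [r hr] := flow_locally_bounded gC3 phiflow L0 gLip (`|x| + 1) T y.
have [C2 Cb] := local_bounds_ex gC3 r; have C20 := bounds_gt0 Cb.
have dC2 : 0 <= d%:R * C2 by rewrite mulr_ge0 // ltW.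
exists (C1 + 1 + d%:R * C2) => [|A e t tau e0 t0 tau0 tT [del del0 hdel]].
  by rewrite ltr_pwDl // addr_gt0.
pose z := (x, phi t x y) : E.
pose B := cross_hessian g z; pose H := hessian g z.
have tT' : t <= T by rewrite (le_trans _ tT) // lerDl ltW.
have zb : `|z| <= r by apply: hr => //; rewrite lerDl.
have M0 : 0 < C2 * C1 ^+ 2 by rewrite mulr_gt0 // exprn_gt0.
exists (A - tau *: (B + A *m H)), (Num.min (Num.min del 1) (tau / (C2 * C1 ^+ 2))).
  by rewrite !lt_min del0 ltr01 divr_gt0.
move=> h; rewrite !lt_min => /andP[/andP[hd h1] hM].
have xh : x + h - x = h by rewrite addrAC subrr add0r.
have xh1 : `|x + h - x| <= 1 by rewrite xh ltW.
have ttau : t <= t + tau by rewrite lerDl ltW.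
have [z12 euler] := hC1 (x + h) t (t + tau) xh1 t0 ttau tT.
have := hdel h hd; rewrite xh (addrAC t) subrr add0r in z12 euler *.
pose D := phi t (x + h) y - phi t x y; pose G := F (x + h, phi t (x + h) y) - F z.
pose S := phi (t + tau) (x + h) y - phi (t + tau) x y.
rewrite -/D in euler *; rewrite -/z -/G -/S in euler * => appr.
have taylor : `|G - (h *m B + D *m H)| <= tau * `|h|.
  have xhb : `|x + h| <= `|x| + 1 by rewrite (le_trans (ler_normD _ _)) // lerD2l ltW.
  have := gradient_taylor Cb (hr (x + h) t xhb t0 tT') zb.
  rewrite /= xh -/B -/H -/D -/G => le; apply: (le_trans le).
  apply: (@le_trans _ _ (C2 * (C1 * `|h|) ^+ 2)).
    by rewrite ler_wpM2l ?(ltW C20) // ler_sqr ?nnegrE // mulr_ge0 // ltW.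
  have -> : C2 * (C1 * `|h|) ^+ 2 = (C2 * C1 ^+ 2) * `|h| * `|h| by ring.
  by rewrite ler_wpM2r // mulrC -ler_pdivlMr // ltW.
have DH : `|(D - h *m A) *m H| <= d%:R * C2 * (e * `|h|).
  apply: le_trans (mulmx_norm_le (hessian_bound Cb zb) _) _.
  by rewrite ler_wpM2l.
have -> : S - h *m (A - tau *: (B + A *m H)) =
    (S - D + tau *: G) + (D - h *m A) - tau *: (G - (h *m B + D *m H)) - tau *: ((D - h *m A) *m H).
  rewrite mulmxBr -scalemxAr mulmxDr mulmxA (mulmxBl D (h *m A)).
  move: (h *m A) (h *m B) (D *m H) (h *m A *m H) => a1 a2 a3 a4.
  by apply/rowP => i; rewrite !mxE; ring.
rewrite (le_trans (ler_normB _ _)) // (le_trans (lerD (ler_normB _ _) (lexx _))) //.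
rewrite (le_trans (lerD (lerD (ler_normD _ _) (lexx _)) (lexx _))) //.
rewrite !(normrZ tau) (gtr0_norm tau0).
have l1 : tau * `|G - (h *m B + D *m H)| <= tau * (tau * `|h|) by rewrite ler_wpM2l // ltW.
have l2 : tau * `|(D - h *m A) *m H| <= tau * (d%:R * C2 * (e * `|h|)) by rewrite ler_wpM2l // ltW.
have p1 : 0 <= e * tau * `|h| * (C1 + 1) by rewrite !mulr_ge0 ?addr_ge0 // ltW.
have p2 : 0 <= d%:R * C2 * tau ^+ 2 * `|h| by rewrite !mulr_ge0 ?sqr_ge0 // ltW.
exact: euler_defect l1 l2 p1 p2 euler appr.
Qed.

(** Over [n] Euler steps of length [t / n] the relative errors add up to a multiple of
    [1 / n]. *)
Theorem flow_differentiable (t : R) : 0 <= t -> differentiable (fun x' => phi t x' y) x.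
Proof.
rewrite le_eqVlt => /predU1P[<-|t0].
  rewrite (_ : (fun x' => _) = cst y); first exact: differentiable_cst.
  by apply/funext => x'; rewrite (flow0 phiflow).
have [C C0 hC] := approx_affine_step (ltW t0).
apply: approx_affine_differentiable => e e0.
pose n := (Num.truncn (t * expR (C * t) / e)).+1.
have n0 : 0 < n%:R :> R by rewrite ltr0n.
pose tau : R := t / n%:R.
have tau0 : 0 < tau by rewrite divr_gt0.
have ntau : n%:R * tau = t by rewrite mulrC divfK // gt_eqF.
(* solution of the recursion e' = e (1 + C tau) + C tau^2 starting from 0 *)
have step j : (j <= n)%N -> exists A, approx_affine (fun x' => phi (j%:R * tau) x' y) x A
    (tau * ((1 + C * tau) ^+ j - 1)).
  elim: j => [_|j ih jn].
    exists 0, 1 => // h _; rewrite mul0r !(flow0 phiflow) subrr mulmx0 subrr normr0.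
    by rewrite expr0 subrr mulr0 mul0r.
  have [A hA] := ih (ltnW jn).
  have q1 : 1 <= (1 + C * tau) ^+ j by rewrite exprn_ege1 // lerDl mulr_ge0 // ltW.
  have [||||A' hA'] := hC A (tau * ((1 + C * tau) ^+ j - 1)) (j%:R * tau) tau _ _ _ _ hA.
  - by rewrite mulr_ge0 ?subr_ge0 // ltW.
  - by rewrite mulr_ge0 // ltW.
  - by [].
  - by rewrite -{2}[tau]mul1r -mulrDl natr1 -[leRHS]ntau ler_wpM2r ?ler_nat // ltW.
  exists A'; rewrite -natr1 mulrDl mul1r; apply: approx_affineW hA'.
  by rewrite le_eqVlt; apply/orP; left; apply/eqP; rewrite [_ ^+ j.+1]exprS; exact: euler_recursion.
have [A hA] := step n (leqnn n); exists A; rewrite ntau in hA; apply: approx_affineW hA.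
apply: (@le_trans _ _ (tau * expR (C * t))).
  rewrite ler_wpM2l ?(ltW tau0) // (@le_trans _ _ ((1 + C * tau) ^+ n)) ?gerBl //.
  have -> : C * t = n%:R * (C * tau) by rewrite mulrCA ntau.
  rewrite expRM_natl lerXn2r ?nnegrE ?expR_ge0 ?expR_ge1Dx //.
  by rewrite addr_ge0 // mulr_ge0 // ltW.
rewrite /tau mulrAC ler_pdivrMr // [leRHS]mulrC -ler_pdivrMr // ltW //.
exact: truncnS_gt.
Qed.

End FlowDifferentiable.

(** * The flow near a local minimizer *)

Section EnergyArithmetic.
Context {R : realType}.

(** Young's inequality absorbs the cross term [n * (D * X)] in half of the
    coercivity. *)
Lemma pair_energy_arith (a b q u v n C1 X D : R) : 0 < a -> 2 * b <= a -> 0 <= q ->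
  a * q - C1 * X ^+ 2 <= u -> - (n * (D * X)) <= v -> n ^+ 2 <= q ->
  2 * b * q - 2 * (u + v) <= (2 * C1 + D ^+ 2 / a) * X ^+ 2.
Proof.
move=> a0 ba q0 hu hv hn.
have h1 : 2 * (n * (D * X)) <= a * n ^+ 2 + D ^+ 2 / a * X ^+ 2.
  have -> : a * n ^+ 2 + D ^+ 2 / a * X ^+ 2 = (a * n - D * X) ^+ 2 / a + 2 * (n * (D * X)).
    by field; rewrite gt_eqF.
  by rewrite lerDr divr_ge0 ?sqr_ge0 // ltW.
have h2 : a * n ^+ 2 <= a * q by rewrite ler_wpM2l // ltW.
have h3 : 2 * b * q <= a * q by rewrite ler_wpM2r.
lra.
Qed.

Lemma young (w u v k : R) : 0 < w -> `|k| <= u * v -> 2 * `|k| <= w * (u ^+ 2 + v ^+ 2 / w ^+ 2).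
Proof.
move=> w0 kuv.
have -> : w * (u ^+ 2 + v ^+ 2 / w ^+ 2) = (w * u - v) ^+ 2 / w + 2 * (u * v).
  by field; rewrite gt_eqF.
have : 0 <= (w * u - v) ^+ 2 / w by rewrite divr_ge0 ?sqr_ge0 // ltW.
by move: kuv; move: (`|k|) (u * v) (_ / w) => k' m s; lra.
Qed.

Lemma weight_arith (k m w N S : R) : 0 <= m -> 0 < w -> w <= 1 -> 0 <= N -> N <= S -> 0 <= k ->
  k * (m * ((w ^+ 2) ^+ 2 * N)) <= k * m * (w * S) * w ^+ 2.
Proof.
move=> m0 w0 w1 N0 NS k0.
have -> : k * (m * ((w ^+ 2) ^+ 2 * N)) = k * m * w ^+ 3 * (w * N) by ring.
have -> : k * m * (w * S) * w ^+ 2 = k * m * w ^+ 3 * S by ring.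
rewrite ler_wpM2l ?mulr_ge0 ?exprn_ge0 ?(ltW w0) //.
by rewrite (le_trans _ NS) // ler_piMl.
Qed.

Lemma double_le (v k m : R) : `|v| <= k * m -> - 2 * v <= k * (2 * m).
Proof. by rewrite ler_norml => /andP[h _]; lra. Qed.

Lemma le_sqr_succ (x : R) : 0 <= x -> x <= (x + 1) ^+ 2.
Proof. by nra. Qed.

Lemma compatible_rates (a a' : R) : 0 < a -> 0 < a' ->
  exists2 b, 0 < b & 2 * b <= a /\ 2 * b <= a'.
Proof.
move=> a0 a'0; exists (Num.min a a' / 2); first by rewrite divr_gt0 // lt_min a0.
by rewrite mulrC divfK // !ge_min !lexx orbT.
Qed.

Lemma length_exp (n : nat) (u u' : R -> 'rV[R]_n) (T t M a : R) : 0 < a -> 0 <= M -> T <= t ->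
  (forall s, T < s -> s <= t -> is_derive s 1 u (u' s)) ->
  u s @[s --> T^'+] --> u T ->
  (forall s, T < s -> s <= t -> `|u' s| <= M * expR (- a * (s - T))) ->
  `|u t - u T| <= M / a.
Proof.
move=> a0 M0 Tt du uT le.
have dN (s : R) : is_derive s 1 (fun s => M / a * expR (- a * (s - T))) (M / a * (- a * expR (- a * (s - T)))).
  have h := is_derive_expR_affine (- a) T s.
  by apply: is_derive_eq; rewrite /GRing.scale /= ?mulr0 ?addr0.
have := length_le Tt du uT (fun s _ _ => dN s) (is_derive_cvg_right (dN T)).
rewrite subrr mulr0 expR0 mulr1 => /(_ _)/wrap[s Ts st|h].
  by rewrite mulNr mulrN opprK mulrA divfK ?gt_eqF // le.
by rewrite (le_trans h) // gerBl mulr_ge0 ?expR_ge0 // divr_ge0 // ltW.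
Qed.

(** The function [f t * expR (c / b * expR (- b * (t - T)))] is nonincreasing. *)
Lemma gronwall_integrable (f f' : R -> R) (T t c b : R) : 0 < b -> 0 <= c -> T <= t -> 0 <= f T ->
  (forall s, T < s -> s <= t -> is_derive s 1 f (f' s)) ->
  f s @[s --> T^'+] --> f T ->
  (forall s, T < s -> s <= t -> f' s <= c * expR (- b * (s - T)) * f s) ->
  f t <= f T * expR (c / b).
Proof.
move=> b0 c0 Tt fT df fTc le.
pose w s := c / b * expR (- b * (s - T)).
have dw (s : R) : is_derive s 1 w (c / b * (- b * expR (- b * (s - T)))).
  have h := is_derive_expR_affine (- b) T s.
  by apply: is_derive_eq; rewrite /GRing.scale /= ?mulr0 ?addr0.
have dE (s : R) : is_derive s 1 (fun s => expR (w s)) (expR (w s) * (c / b * (- b * expR (- b * (s - T))))).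
  exact: (@is_derive1_comp R expR w s _ _).
pose h s := f s * expR (w s).
have : h t <= h T.
  apply: (@derive_le0_nincr _ h (fun s => f' s * expR (w s) +
     f s * (expR (w s) * (c / b * (- b * expR (- b * (s - T))))))) => //.
  - move=> s Ts st; have h1 := df s Ts st; have h2 := dE s.
    by apply: is_derive_eq; rewrite /GRing.scale /= addrC [X in X + _]mulrC.
  - move=> s Ts st; have := le s Ts st; have := expR_gt0 (w s).
    have -> : c / b * (- b * expR (- b * (s - T))) = - (c * expR (- b * (s - T))).
      by rewrite mulNr mulrN mulrA divfK // gt_eqF.
    move: (expR (w s)) (c * _) => u v u0 h1.
    have -> : f' s * u + f s * (u * - v) = - (u * (v * f s - f' s)) by ring.
    by rewrite oppr_le0 mulr_ge0 ?(ltW u0) // subr_ge0.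
  - by apply: cvgM => //; exact: is_derive_cvg_right (dE T).
rewrite /h /w subrr mulr0 expR0 mulr1 => h1.
have w0 : 0 <= w t by rewrite mulr_ge0 ?expR_ge0 // divr_ge0 // ltW.
have e1 : 1 <= expR (w t) by rewrite -expR0 ler_expR.
have [f0|f0] := leP 0 (f t); first by rewrite (le_trans _ h1) // ler_peMr.
by rewrite (le_trans (ltW f0)) // mulr_ge0 // expR_ge0.
Qed.

End EnergyArithmetic.

Section NearMinimum.
Context {R : realType} {p d : nat} (g : 'rV[R]_p * 'rV[R]_d -> R).
Hypothesis gC3 : Ck_on 3 setT g.
Hypothesis gMB : parametric_Morse_Bott g.
Local Notation E := ('rV[R]_p * 'rV[R]_d)%type.
Local Notation F := (gradient g).
Local Notation H := (hessian g).
Variable phi : R -> 'rV[R]_p -> 'rV[R]_d -> 'rV[R]_d.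
Hypothesis phiflow : is_gradient_flow g phi.
Variable z0 : E.
Hypothesis Fz0 : F z0 = 0.
Hypothesis H0_pos : forall v : 'rV[R]_d, 0 <= dot v (v *m H z0).

Lemma mulmx_pair_sub (m n : nat) (u v : 'rV[R]_m) (A B : 'M[R]_(m, n)) :
  - (u *m A) - - (v *m B) = - ((u - v) *m A + v *m (A - B)).
Proof. by rewrite mulmxBl mulmxBr addrA subrK opprD !opprK. Qed.

Lemma gradient_flow_derive x y (t : R) : 0 < t ->
  is_derive t 1 (fun s => F (x, phi s x y)) (- (F (x, phi t x y) *m H (x, phi t x y))).
Proof.
by move=> t0; have := is_derive_gradient gC3 x (is_derive_flow phiflow x y t0); rewrite mulNmx.
Qed.

(** While the trajectory is near [z0], [H] is coercive on the gradient, which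
    therefore decays; and then the length of the trajectory is bounded by a multiple
    of its initial gradient, so that it remains near [z0]. *)
Lemma flow_decay : exists2 a : R, 0 < a & exists2 K : R, 0 < K & forall eps : R, 0 < eps ->
  exists2 r : R, 0 < r & forall x y T, 0 <= T -> `|(x, phi T x y) - z0 : E| < r ->
  forall t, T <= t -> `|(x, phi t x y) - z0 : E| < eps /\
    `|F (x, phi t x y)| <= K * expR (- a * (t - T)) * `|F (x, phi T x y)|.
Proof.
have [rho /andP[rho0 rho1] [a a0 [C1 C10 coer]]] := gradient_difference_coercive gC3 gMB Fz0 H0_pos.
have [C Cb] := local_bounds_ex gC3 (`|z0| + 1); have C0 := bounds_gt0 Cb.
pose K : R := d%:R + 1; have K0 : 0 < K by rewrite ltr_wpDl.
exists a => //; exists K => // eps' eps'0.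
pose eps := Num.min eps' rho.
have eps0 : 0 < eps by rewrite lt_min eps'0.
have [ee' er] : eps <= eps' /\ eps <= rho by rewrite /eps !ge_min !lexx orbT.
pose r := Num.min (eps / 4) (eps * a / (4 * (K * C))).
have KC0 : 0 < 4 * (K * C) by rewrite !mulr_gt0.
have r0 : 0 < r by rewrite lt_min !divr_gt0 // mulr_gt0.
have [r1 r2] : r <= eps / 4 /\ r <= eps * a / (4 * (K * C)) by rewrite /r !ge_min !lexx orbT.
exists r => // x y T T0 zTr.
pose z t : E := (x, phi t x y); pose q t := dot (F (z t)) (F (z t)).
have coer1 t : `|z t - z0| < rho -> a * q t <= dot (F (z t)) (F (z t) *m H (z t)).
  move=> zr; have z0r : `|z0 - z0| < rho by rewrite subrr normr0.
  by have := coer (z t) z0 zr z0r; rewrite Fz0 normr0 mul0r expr0n mulr0 !subr0.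
have decay t : T <= t -> (forall s, T <= s -> s <= t -> `|z s - z0| < rho) ->
    `|F (z t)| <= K * expR (- a * (t - T)) * `|F (z T)|.
  move=> Tt near_z.
  pose f s := q s * expR (2 * a * (s - T)).
  pose f' s := - (2 * dot (F (z s)) (F (z s) *m H (z s))) * expR (2 * a * (s - T)) +
    q s * (2 * a * expR (2 * a * (s - T))).
  have fle : f t <= f T.
    apply: (@derive_le0_nincr _ f f') => //.
    - move=> s Ts st; have s0 : 0 < s by exact: le_lt_trans Ts.
      have h1 := is_derive_dot (gradient_flow_derive x y s0) (gradient_flow_derive x y s0).
      have h2 := is_derive_expR_affine (2 * a) T s.
      rewrite /f /q; apply: is_derive_eq; rewrite /GRing.scale /= /f' /q -/(z s).
      rewrite dotNl dotNr (dotC (F (z s) *m H (z s))).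
      by move: (dot _ _) (dot _ _) (expR _) => u v w; ring.
    - move=> s Ts st; have := coer1 s (near_z s (ltW Ts) st).
      have := expR_gt0 (2 * a * (s - T)); rewrite /f'.
      move: (dot _ _) (q s) (expR _) => u v w w0 h.
      have -> : - (2 * u) * w + v * (2 * a * w) = - (2 * w * (u - a * v)) by ring.
      by rewrite oppr_le0 mulr_ge0 ?mulr_ge0 ?(ltW w0) // subr_ge0.
    - have FT : F (z s) @[s --> T^'+] --> F (z T).
        exact: (flow_comp_cvg_right phiflow (gradient_continuous gC3) T0).
      by apply: cvgM; [exact: dot_cvg|exact: is_derive_cvg_right (is_derive_expR_affine (2 * a) T T)].
  have e2 : expR (2 * a * (t - T)) = (expR (a * (t - T))) ^+ 2.
    by rewrite -mulrA expRM_natl.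
  rewrite /f e2 subrr mulr0 expR0 mulr1 in fle.
  have Ep := expR_gt0 (a * (t - T)).
  rewrite mulNr expRN mulrAC ler_pdivlMr //.
  rewrite -ler_sqr ?nnegrE ?mulr_ge0 ?(ltW K0) ?expR_ge0 // !exprMn.
  apply: (@le_trans _ _ (q t * expR (a * (t - T)) ^+ 2)).
    by rewrite ler_wpM2r ?sqr_ge0 // norm_le_dot.
  apply: (le_trans fle); apply: (le_trans (dot_le_norm _)).
  rewrite ler_wpM2r ?sqr_ge0 // /K; have : 0 <= d%:R :> R by [].
  by move: (d%:R : R) => n n0; nra.
have zTb : `|z T| <= `|z0| + 1.
  by apply: norm_near zTr _; rewrite (le_trans r1) //; lra.
have z0b : `|z0| <= `|z0| + 1 by rewrite lerDl.
have FT : `|F (z T)| <= C * r.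
  have := gradient_lipschitz Cb zTb z0b; rewrite Fz0 subr0 => /le_trans; apply.
  by rewrite ler_wpM2l ?(ltW C0) // ltW.
have near_x w : `|w - z0.2| <= eps * 3 / 4 -> `|(x, w) - z0 : E| < eps.
  move=> wr; rewrite prod_normE /= gt_max; apply/andP; split; last by rewrite (le_lt_trans wr) //; lra.
  by rewrite (le_lt_trans (norm_fst ((x, phi T x y) - z0))) // (lt_le_trans zTr) // (le_trans r1) //; lra.
have yT : `|phi T x y - z0.2| <= eps / 4.
  by rewrite (le_trans (norm_snd (z T - z0))) // ltW // (lt_le_trans zTr).
have stay t : T <= t -> `|phi t x y - z0.2| <= eps * 3 / 4.
  apply: (@flow_stay _ _ _ g phi phiflow x y z0.2 T (eps * 3 / 4) (eps / 2) T0) => //.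
  - lra.
  - by rewrite (le_trans yT) //; lra.
  - move=> {}t Tt near_y.
    have near_z s : T <= s -> s <= t -> `|z s - z0| < rho.
      by move=> Ts st; apply: (lt_le_trans _ er); apply: near_x; apply: near_y; rewrite Ts.
    have := @length_exp _ d (fun s => phi s x y) (fun s => - F (z s)) T t (K * `|F (z T)|) a a0 _ Tt.
    move=> /(_ _ _ _ _)/wrap[||||h].
    + by rewrite mulr_ge0 // ltW.
    + by move=> s Ts _; apply: (is_derive_flow phiflow); exact: le_lt_trans Ts.
    + exact: (flow_cvg_right phiflow).
    + move=> s Ts st; rewrite normrN mulrAC; apply: decay; first exact: ltW.
      by move=> v Tv vs; apply: near_z => //; exact: le_trans st.
    have h2 : K * `|F (z T)| / a <= eps / 4.
      rewrite ler_pdivrMr // (le_trans (ler_wpM2l (ltW K0) FT)) // mulrA.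
      have : r * (4 * (K * C)) <= eps * a by rewrite -ler_pdivlMr.
      by move: (K * C) => u; clear; lra.
    rewrite -(subrK (phi T x y) (phi t x y)) -addrA (le_trans (ler_normD _ _)) //.
    by move: h h2 yT; clear; lra.
move=> t Tt; split; first by apply: (lt_le_trans _ ee'); apply: near_x; exact: stay.
apply: decay => // s Ts st; apply: (lt_le_trans _ er); apply: near_x; exact: stay.
Qed.


(** The energy [S] adds the square of the distance of the two points and the square
    of the distance of the gradients with the weight [expR (2 * b * (s - T))].  The
    coercivity of [gradient_difference_coercive] absorbs the growth of the weight.
    The error term of the latter contains the gradient at [z2], which decays, so that
    the growth rate of [S] is integrable. *)
Lemma gradient_pair_decay : exists2 r : R, 0 < r & exists2 b : R, 0 < b & exists2 K : R, 0 < K &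
  forall x1 x2 y T, 0 <= T ->
  `|(x1, phi T x1 y) - z0 : E| < r -> `|(x2, phi T x2 y) - z0 : E| < r ->
  forall t, T <= t ->
  `|F (x1, phi t x1 y) - F (x2, phi t x2 y)| <=
    K * expR (- b * (t - T)) * `|(x1, phi T x1 y) - (x2, phi T x2 y) : E|.
Proof.
have [rho /andP[rho0 rho1] [a a0 [C1 C10 coer]]] := gradient_difference_coercive gC3 gMB Fz0 H0_pos.
have [C Cb] := local_bounds_ex gC3 (`|z0| + 1); have C0 := bounds_gt0 Cb.
have [a' a'0 [K K0 decay]] := flow_decay.
have [r r0 hr] := decay rho rho0.
have [b b0 [ba ba']] := compatible_rates a0 a'0.
pose D : R := d%:R * d%:R * C.
have D0 : 0 <= D by exact: mulr_ge0 (mulr_ge0 (ler0n _ _) (ler0n _ _)) (ltW C0).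
pose c : R := (2 * C1 + D ^+ 2 / a) * (K * C) ^+ 2.
have c0 : 0 <= c by exact: mulr_ge0 (addr_ge0 (mulr_ge0 (ler0n _ _) C10) (divr_ge0 (sqr_ge0 _) (ltW a0))) (sqr_ge0 _).
pose cS : R := c + d%:R.
have cS0 : 0 <= cS by exact: addr_ge0.
pose M1 : R := 1 + d%:R + d%:R * C ^+ 2.
have M10 : 0 <= M1 by exact: addr_ge0 (addr_ge0 ler01 (ler0n _ _)) (mulr_ge0 (ler0n _ _) (sqr_ge0 _)).
pose M : R := M1 * expR (cS / b).
have M0 : 0 <= M by exact: mulr_ge0 M10 (expR_ge0 _).
exists r => //; exists b => //; exists (M + 1) => [|x1 x2 y T T0 z1T z2T t Tt].
  by rewrite ltr_wpDl.
pose z1 s : E := (x1, phi s x1 y); pose z2 s : E := (x2, phi s x2 y).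
have near1 s (Ts : T <= s) := (hr x1 y T T0 z1T s Ts).1.
have near2 s (Ts : T <= s) := (hr x2 y T T0 z2T s Ts).1.
have decay2 s (Ts : T <= s) := (hr x2 y T T0 z2T s Ts).2.
pose e := `|z1 T - z2 T|; have e0 : 0 <= e by exact: normr_ge0.
pose del s := F (z1 s) - F (z2 s); pose Del s := phi s x1 y - phi s x2 y.
have bnd z : `|z - z0| < rho -> `|z| <= `|z0| + 1 by move=> h; exact: norm_near h rho1.
pose N s := `|x1 - x2| ^+ 2 + dot (Del s) (Del s).
pose w s := expR (- b * (s - T)).
have w0 s : 0 < w s by exact: expR_gt0.
pose Eh s := expR (2 * b * (s - T)) * dot (del s) (del s).
have w2 s : expR (2 * b * (s - T)) = (w s ^+ 2)^-1.
  by rewrite /w -expRM_natl -expRN; congr expR; ring.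
pose S s := N s + Eh s.
pose dd' s := del s *m H (z1 s) + F (z2 s) *m (H (z1 s) - H (z2 s)).
have ddel (s : R) : 0 < s -> is_derive s 1 del (- dd' s).
  move=> s0; have h1 := gradient_flow_derive x1 y s0; have h2 := gradient_flow_derive x2 y s0.
  exact: is_derive_eq (is_deriveB h1 h2) (mulmx_pair_sub _ _ _ _).
pose S' s := - 2 * dot (Del s) (del s) +
  (2 * b * expR (2 * b * (s - T)) * dot (del s) (del s) - expR (2 * b * (s - T)) * (2 * dot (del s) (dd' s))).
have dS (s : R) : T < s -> is_derive s 1 S (S' s).
  move=> Ts; have s0 : 0 < s by exact: le_lt_trans Ts.
  have hD := is_derive_flow_sub phiflow y y x1 x2 s0.
  have h1 := is_derive_dot hD hD.
  have h2 := is_derive_dot (ddel s s0) (ddel s s0).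
  have h3 := is_derive_expR_affine (2 * b) T s.
  have h4 : is_derive s 1 Eh (2 * b * expR (2 * b * (s - T)) * dot (del s) (del s)
     - expR (2 * b * (s - T)) * (2 * dot (del s) (dd' s))).
    rewrite /Eh; apply: is_derive_eq; rewrite /GRing.scale /= dotNl dotNr (dotC (dd' s)).
    by move: (dot _ _) (dot _ _) (expR _) => u v k; ring.
  have h5 : is_derive s 1 N (- 2 * dot (Del s) (del s)).
    rewrite /N /Del; apply: is_derive_eq; rewrite add0r dotNl dotNr -/(z1 s) -/(z2 s) -/(del s) -/(Del s).
    by rewrite (dotC (del s)); move: (dot _ _) => u; ring.
  by rewrite /S /S'; apply: is_deriveD.
have key (s : R) : T < s -> S' s <= cS * w s * S s.
  move=> Ts; have n1 := near1 s (ltW Ts); have n2 := near2 s (ltW Ts).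
  have hc := coer _ _ n1 n2; rewrite -/(z1 s) -/(z2 s) -/(del s) in hc.
  pose X := `|F (z2 s)| * `|z1 s - z2 s|; rewrite -/X in hc.
  have X0 : 0 <= X by exact: mulr_ge0.
  have l1 : `|dot (del s) (F (z2 s) *m (H (z1 s) - H (z2 s)))| <= `|del s| * (D * X).
    apply: (le_trans (norm_dot _ _)).
    have hm := mulmx_norm_le (hessian_lipschitz Cb (bnd _ n1) (bnd _ n2)) (F (z2 s)).
    apply: (@le_trans _ _ (d%:R * `|del s| * (d%:R * (C * `|z1 s - z2 s|) * `|F (z2 s)|))).
      by rewrite ler_wpM2l // mulr_ge0.
    by rewrite le_eqVlt; apply/orP; left; apply/eqP; rewrite /D /X; ring.
  have l2 : `|del s| ^+ 2 <= dot (del s) (del s) := norm_le_dot _.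
  have N0 : 0 <= N s by rewrite addr_ge0 ?sqr_ge0 ?dot_ge0.
  have l3 : X ^+ 2 <= (K * C) ^+ 2 * ((w s ^+ 2) ^+ 2 * N s).
    rewrite /X exprMn [_ ^+ 2 * (_ * N s)]mulrA; apply: ler_pM; rewrite ?sqr_ge0 //.
      rewrite -exprMn ler_sqr ?nnegrE ?mulr_ge0 ?(ltW K0) ?(ltW C0) ?sqr_ge0 ?(ltW (w0 s)) //.
      apply: (le_trans (decay2 s (ltW Ts))).
      have l4 : expR (- a' * (s - T)) <= w s ^+ 2.
        by rewrite /w -expRM_natl ler_expR mulrA mulrN !mulNr lerN2 ler_wpM2r // subr_ge0 ltW.
      have l5 : `|F (z2 T)| <= C.
        by apply: (gradient_bound Cb); apply: bnd; exact: near2.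
      rewrite mulrAC; apply: ler_pM; rewrite ?mulr_ge0 ?expR_ge0 ?(ltW K0) //.
      by rewrite ler_wpM2l // ltW.
    by apply: (le_trans (norm_pair_sqr (x1 - x2) (Del s))); rewrite lerD2l norm_le_dot.
  have l6 : `|dot (Del s) (del s)| <= d%:R * (`|Del s| * `|del s|).
    by rewrite mulrA norm_dot.
  have l7 : 2 * `|Del s| * `|del s| <= w s * (dot (Del s) (Del s) + Eh s).
    have := @young _ (w s) `|Del s| `|del s| (`|Del s| * `|del s|) (w0 s).
    rewrite ger0_norm ?mulr_ge0 // => /(_ (lexx _)) l7; rewrite -mulrA (le_trans l7) //.
    rewrite ler_wpM2l ?(ltW (w0 s)) // lerD ?norm_le_dot // /Eh w2 mulrC.
    by rewrite ler_wpM2l ?norm_le_dot // invr_ge0 sqr_ge0.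
  have Eh0 : 0 <= Eh s by rewrite mulr_ge0 ?expR_ge0 ?dot_ge0.
  have w1 : w s <= 1 by rewrite -expR0 ler_expR mulNr oppr_le0 mulr_ge0 ?(ltW b0) // subr_ge0 ltW.
  have part1 : - 2 * dot (Del s) (del s) <= d%:R * (w s * S s).
    apply: (le_trans (double_le l6)); rewrite [2 * (`|Del s| * _)]mulrA.
    rewrite ler_wpM2l // (le_trans l7) // ler_wpM2l ?(ltW (w0 s)) // /S /N.
    by rewrite lerD2r lerDr sqr_ge0.
  have part2 : 2 * b * dot (del s) (del s) - 2 * dot (del s) (dd' s) <= (2 * C1 + D ^+ 2 / a) * X ^+ 2.
    rewrite [dot (del s) (dd' s)]dotDr; move: hc l1 l2; rewrite ler_norml => hc /andP[l1 _] l2.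
    exact: (pair_energy_arith a0 ba (dot_ge0 (del s)) hc l1 l2).
  have part3 : 2 * b * expR (2 * b * (s - T)) * dot (del s) (del s) -
      expR (2 * b * (s - T)) * (2 * dot (del s) (dd' s)) <= c * (w s * S s).
    have -> : 2 * b * expR (2 * b * (s - T)) * dot (del s) (del s) -
      expR (2 * b * (s - T)) * (2 * dot (del s) (dd' s)) =
      expR (2 * b * (s - T)) * (2 * b * dot (del s) (del s) - 2 * dot (del s) (dd' s)) by ring.
    apply: (le_trans (ler_wpM2l (expR_ge0 _) part2)).
    rewrite w2 mulrC ler_pdivrMr ?exprn_gt0 //.
    have cc : 0 <= 2 * C1 + D ^+ 2 / a.
      by exact: addr_ge0 (mulr_ge0 (ler0n _ _) C10) (divr_ge0 (sqr_ge0 _) (ltW a0)).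
    apply: (le_trans (ler_wpM2l cc l3)).
    have NS : N s <= S s by rewrite lerDl.
    exact: (weight_arith (sqr_ge0 _) (w0 s) w1 N0 NS cc).
  have -> : cS * w s * S s = d%:R * (w s * S s) + c * (w s * S s).
    by rewrite /cS -mulrA mulrDl addrC.
  exact: lerD part1 part3.
have S_bound : S t <= S T * expR (cS / b).
  apply: (gronwall_integrable b0 cS0 Tt _ (fun s Ts _ => dS s Ts)) => //.
  - by rewrite /S /N /Eh !addr_ge0 ?sqr_ge0 ?dot_ge0 // mulr_ge0 ?expR_ge0 ?dot_ge0.
  - apply: cvgD; first apply: cvgD; first exact: cvg_cst.
      by apply: dot_cvg; exact: flow_sub_cvg_right.
    apply: cvgM; first exact: is_derive_cvg_right (is_derive_expR_affine (2 * b) T T).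
    have dT : del s @[s --> T^'+] --> del T.
      by apply: cvgB; exact: (flow_comp_cvg_right phiflow (gradient_continuous gC3) T0).
    exact: dot_cvg.
  - by move=> s Ts st; apply: key.
have ST : S T <= M1 * e ^+ 2.
  rewrite /S /N /Eh subrr mulr0 expR0 mul1r /M1 !mulrDl mul1r; apply: lerD; first apply: lerD.
  - by rewrite ler_sqr ?nnegrE // (norm_fst (z1 T - z2 T)).
  - apply: (le_trans (dot_le_norm _)); rewrite ler_wpM2l // ler_sqr ?nnegrE //.
    exact: (norm_snd (z1 T - z2 T)).
  - apply: (le_trans (dot_le_norm _)); rewrite -mulrA ler_wpM2l // -exprMn.
    rewrite ler_sqr ?nnegrE ?mulr_ge0 ?(ltW C0) //.
    by apply: (gradient_lipschitz Cb); apply: bnd; [exact: near1|exact: near2].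
have Nt0 : 0 <= N t by rewrite addr_ge0 ?sqr_ge0 ?dot_ge0.
have dle : `|del t| ^+ 2 <= w t ^+ 2 * (M * e ^+ 2).
  apply: (le_trans (norm_le_dot _)).
  have -> : dot (del t) (del t) = w t ^+ 2 * Eh t.
    by rewrite /Eh w2 mulrA divff ?mul1r // expf_neq0 // gt_eqF.
  rewrite ler_wpM2l ?sqr_ge0 //; apply: (@le_trans _ _ (S t)); first by rewrite lerDr.
  by rewrite (le_trans S_bound) // mulrAC ler_wpM2r ?expR_ge0.
rewrite -ler_sqr ?nnegrE ?mulr_ge0 ?expR_ge0 ?addr_ge0 //.
apply: (le_trans dle); rewrite -/(w t) -/e.
have -> : ((M + 1) * w t * e) ^+ 2 = w t ^+ 2 * ((M + 1) ^+ 2 * e ^+ 2) by ring.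
by rewrite ler_wpM2l ?sqr_ge0 // ler_wpM2r ?sqr_ge0 // le_sqr_succ.
Qed.

End NearMinimum.

(** * The flow selection *)

Section LimitBounds.
Context {R : realType}.

Lemma lim_dist_le (n : nat) (f : R -> 'rV[R]_n) (l c : 'rV[R]_n) (t0 M : R) :
  f t @[t --> +oo] --> l -> (forall t, t0 <= t -> `|f t - c| <= M) -> `|l - c| <= M.
Proof.
move=> /cvgrPdist_le fl le; apply/ler_addgt0Pl => e e0.
near +oo_R => t.
have h1 : `|l - f t| <= e by near: t; exact: fl.
have h2 : t0 <= t by near: t; apply: nbhs_pinfty_ge; exact: num_real.
rewrite -(subrK (f t) l) -addrA (le_trans (ler_normD _ _)) // lerD //; exact: le.
Unshelve. all: by end_near. Qed.

Lemma exp_decay_small (c b T e : R) : 0 < b -> 0 <= c -> 0 < e ->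
  exists2 s0, T <= s0 & forall s, s0 <= s -> c * expR (- b * (s - T)) <= e.
Proof.
move=> b0 c0 e0; exists (T + c / (b * e)); first by rewrite lerDl divr_ge0 // mulr_ge0 ?ltW.
move=> s; rewrite -lerBrDl ler_pdivrMr ?mulr_gt0 // => h.
rewrite mulNr expRN ler_pdivrMr ?expR_gt0 //.
have := expR_ge1Dx (b * (s - T)); move: (expR _) h => E h h2.
apply: (@le_trans _ _ (e * (1 + b * (s - T)))); last by rewrite ler_wpM2l // ltW.
by move: h e0; move: (s - T) => u; nra.
Qed.

Lemma thirds_le (e u : R) : u <= e / 3 -> e / 3 + (e / 3 + u) <= e.
Proof. lra. Qed.

Lemma norm_close {V : normedModType R} (v w : V) (r : R) : `|v - w| < r -> `|v| <= `|w| + r.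
Proof. by move=> /ltW h; rewrite addrC -lerBlDr (le_trans (lerB_dist _ _)). Qed.

Lemma approx_affine_perturb {p d} (f h : 'rV[R]_p -> 'rV[R]_d) x A (e e' : R) :
  approx_affine f x A e ->
  (exists2 del, 0 < del & forall k, `|k| < del ->
     `|(h (x + k) - h x) - (f (x + k) - f x)| <= e' * `|k|) ->
  approx_affine h x A (e + e').
Proof.
move=> [r r0 hr] [s s0 hs]; exists (Num.min r s) => [|k]; first by rewrite lt_min r0.
rewrite lt_min => /andP[/hr h1 /hs h2].
have -> : h (x + k) - h x - k *m A =
  (f (x + k) - f x - k *m A) + ((h (x + k) - h x) - (f (x + k) - f x)).
  by rewrite [RHS]addrC addrA subrK.
by rewrite mulrDl (le_trans (ler_normD _ _)) // lerD.
Qed.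

End LimitBounds.

Section Selection.
Context {R : realType} {p d : nat} (g : 'rV[R]_p * 'rV[R]_d -> R).
Hypothesis gC3 : Ck_on 3 setT g.
Hypothesis gMB : parametric_Morse_Bott g.
Local Notation E := ('rV[R]_p * 'rV[R]_d)%type.
Local Notation F := (gradient g).
Local Notation H := (hessian g).
Variable phi : R -> 'rV[R]_p -> 'rV[R]_d -> 'rV[R]_d.
Hypothesis phiflow : is_gradient_flow g phi.
Hypothesis gcoercive : forall x : 'rV[R]_p, coercive (fun y => g (x, y)).
Local Notation sel := (flow_selection phi).

Lemma flow_selectionP x y : F (x, sel x y) = 0 /\ phi t x y @[t --> +oo] --> sel x y.
Proof.
have [l [Fl hl]] := flow_cvg gC3 phiflow gMB y (gcoercive x).
by have -> : sel x y = l by exact: cvg_lim hl.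
Qed.

Section NearMinimum.
Variable z0 : E.
Hypothesis Fz0 : F z0 = 0.
Hypothesis H0_pos : forall v : 'rV[R]_d, 0 <= dot v (v *m H z0).

(** Integrate the bound of [gradient_pair_decay] from [s] to infinity. *)
Lemma selection_pair_decay : exists2 r : R, 0 < r & exists2 b : R, 0 < b & exists2 K : R, 0 < K &
  forall x1 x2 y T s, 0 <= T -> T <= s ->
  `|(x1, phi T x1 y) - z0 : E| < r -> `|(x2, phi T x2 y) - z0 : E| < r ->
  `|(sel x1 y - sel x2 y) - (phi s x1 y - phi s x2 y)| <=
    K * expR (- b * (s - T)) * `|(x1, phi T x1 y) - (x2, phi T x2 y) : E|.
Proof.
have [r r0 [b b0 [K K0 hK]]] := gradient_pair_decay gC3 gMB phiflow Fz0 H0_pos.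
exists r => //; exists b => //; exists (K / b); first by rewrite divr_gt0.
move=> x1 x2 y T s T0 Ts z1r z2r; have s0 : 0 <= s by exact: le_trans Ts.
set e := `|_ - _ : E|; have e0 : 0 <= e by exact: normr_ge0.
have cv : phi t x1 y - phi t x2 y @[t --> +oo] --> sel x1 y - sel x2 y.
  by apply: cvgB; exact: (flow_selectionP _ _).2.
apply: (lim_dist_le cv (t0 := s)) => t st.
have := @length_exp _ d (fun v => phi v x1 y - phi v x2 y)
  (fun v => - (F (x1, phi v x1 y) - F (x2, phi v x2 y))) s t (K * expR (- b * (s - T)) * e) b b0 _ st.
move=> /(_ _ _ _ _)/wrap[||||h].
- by rewrite !mulr_ge0 ?expR_ge0 // ltW.
- by move=> v sv _; apply: is_derive_flow_sub => //; exact: le_lt_trans sv.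
- exact: flow_sub_cvg_right.
- move=> v sv vt; rewrite normrN.
  have Tv : T <= v by exact: le_trans Ts (ltW sv).
  apply: (le_trans (hK x1 x2 y T T0 z1r z2r v Tv)); rewrite -/e.
  have -> : - b * (v - T) = - b * (s - T) + - b * (v - s) by ring.
  by rewrite expRD !mulrA (mulrAC _ e).
by rewrite (le_trans h) // mulrAC [_ * b^-1]mulrAC.
Qed.

End NearMinimum.

Variable L : R.
Hypothesis L0 : 0 < L.
Hypothesis gLip : grad_y_lipschitz g L.

Section Differentiability.
Variables (x0 : 'rV[R]_p) (y0 : 'rV[R]_d).
Hypothesis sel_min : is_local_minimizer (fun y => g (x0, y)) (sel x0 y0).

(** At a large time [T] the trajectory of [x0] is close to its limit, and by
    continuity those of the parameters near [x0] are close to it too: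
    [selection_pair_decay] applies from this time on. *)
Lemma selection_lipschitz_defect : exists2 del : R, 0 < del &
  exists T b c, [/\ 0 <= T, 0 < b, 0 <= c & forall x1 x2 s,
    `|x1 - x0| < del -> `|x2 - x0| < del -> T <= s ->
    `|(sel x1 y0 - sel x2 y0) - (phi s x1 y0 - phi s x2 y0)| <=
      c * expR (- b * (s - T)) * `|x1 - x2| ].
Proof.
pose z0 : E := (x0, sel x0 y0).
have Fz0 : F z0 = 0 by exact: (flow_selectionP x0 y0).1.
have [r r0 [b b0 [K K0 hK]]] := selection_pair_decay Fz0 (local_min_psd gC3 (z0 := z0) sel_min).
have r20 : 0 < r / 2 by rewrite divr_gt0.
have [T T0 hT] : exists2 T : R, 0 <= T & `|sel x0 y0 - phi T x0 y0| <= r / 2.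
  have /cvgrPdist_le cv := (flow_selectionP x0 y0).2.
  near +oo_R => t; exists t; first by near: t; apply: nbhs_pinfty_ge; exact: num_real.
  by near: t; exact: cv.
have /differentiable_continuous cphi := flow_differentiable gC3 phiflow L0 gLip x0 y0 T0.
have [del1 /= del10 hdel1] : nbhs_ball x0 (fun x => `|phi T x0 y0 - phi T x y0| < r / 2).
  by apply/nbhs_ballP; move/cvgrPdist_lt : cphi; apply.
pose del := Num.min del1 r.
have del0 : 0 < del by rewrite lt_min del10.
have near_z0 x : `|x - x0| < del -> `|(x, phi T x y0) - z0 : E| < r.
  rewrite lt_min => /andP[h1 h2]; rewrite prod_normE /= gt_max h2 /=.
  have := hdel1 x; rewrite -ball_normE /= distrC => /(_ h1) h3.
  rewrite -(subrK (phi T x0 y0) (phi T x y0)) -addrA (le_lt_trans (ler_normD _ _)) //.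
  by rewrite (splitr r) ltr_leD // distrC.
have [KT KT0 hKT] := flow_lipschitz gC3 phiflow L0 gLip (`|x0| + del) y0 T0.
exists del => //; exists T, b, (K * (1 + KT)); split => //.
  by rewrite mulr_ge0 ?addr_ge0 // ltW.
move=> x1 x2 s d1 d2 Ts; have h := hK x1 x2 y0 T s T0 Ts (near_z0 _ d1) (near_z0 _ d2).
apply: (le_trans h).
have h2 : `|(x1, phi T x1 y0) - (x2, phi T x2 y0) : E| <= (1 + KT) * `|x1 - x2|.
  rewrite (le_trans (norm_pair_sum _ _)) // mulrDl mul1r lerD2l hKT //.
    exact: norm_close d1.
  exact: norm_close d2.
have -> : K * (1 + KT) * expR (- b * (s - T)) * `|x1 - x2| =
  K * expR (- b * (s - T)) * ((1 + KT) * `|x1 - x2|) by ring.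
by rewrite ler_wpM2l // mulr_ge0 ?expR_ge0 // ltW.
Unshelve. all: by end_near. Qed.

(** The Jacobian of the flow at time [s] approximates the selection up to a relative
    error that is exponentially small in [s]. *)
Theorem selection_differentiable : exists2 del : R, 0 < del & forall x, `|x - x0| < del ->
  differentiable (fun x' => sel x' y0) x /\ ('J (fun x' => phi t x' y0) x @[t --> +oo] --> 'J (fun x' => sel x' y0) x).
Proof.
have [del del0 [T [b [c [T0 b0 c0 hdel]]]]] := selection_lipschitz_defect.
exists del => // x xdel.
have approx s e : T <= s -> 0 < e -> approx_affine (fun x' => sel x' y0) x
    ('J (fun x' => phi s x' y0) x) (e + c * expR (- b * (s - T))).
  move=> Ts e0; have s0 : 0 <= s by exact: le_trans Ts.
  have dphi := flow_differentiable gC3 phiflow L0 gLip x y0 s0.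
  apply: (approx_affine_perturb (approx_affine_jacobian dphi e0)).
  exists (del - `|x - x0|) => [|k kd]; first by rewrite subr_gt0.
  have xk : `|x + k - x0| < del.
    by rewrite addrAC (le_lt_trans (ler_normD _ _)) // -ltrBrDl.
  by have := hdel (x + k) x s xk xdel Ts; rewrite [x + k - x]addrC addKr.
have dsel : differentiable (fun x' => sel x' y0) x.
  apply: approx_affine_differentiable => e e0.
  have e20 : 0 < e / 2 by rewrite divr_gt0.
  have [s Ts hs] := exp_decay_small T b0 c0 e20.
  exists ('J (fun x' => phi s x' y0) x).
  apply: (approx_affineW _ (approx s (e / 2) Ts e20)).
  by rewrite [X in _ <= X]splitr lerD2l hs.
split=> //; apply/cvgrPdist_le => e e0.
have e30 : 0 < e / 3 by rewrite divr_gt0.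
have [s1 Ts1 hs1] := exp_decay_small T b0 c0 e30.
near=> s.
have s1s : s1 <= s by near: s; apply: nbhs_pinfty_ge; exact: num_real.
have := approx_affine_close _ (approx_affine_jacobian dsel e30) (approx s (e / 3) (le_trans Ts1 s1s) e30).
have cp : 0 <= c * expR (- b * (s - T)) by rewrite mulr_ge0 ?expR_ge0.
move=> /(_ _)/wrap[|/le_trans]; first by rewrite !addr_ge0 // ltW.
by apply; apply: thirds_le; exact: hs1.
Unshelve. all: by end_near. Qed.

End Differentiability.
End Selection.

(** * The differential at a local minimizer *)

Section LinearImage.
Context {R : realType} {p d : nat}.

Lemma is_derive_mulmxr (u : R -> 'rV[R]_p) (t : R) du (Q : 'M[R]_(p, d)) :
  is_derive t 1 u du -> is_derive t 1 (fun s => u s *m Q) (du *m Q).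
Proof.
pose L : {linear 'rV[R]_p -> 'rV[R]_d} := mulmxr Q.
have Lc : continuous L by exact: mulmxr_continuous.
move=> hu; have dL : differentiable L (u t) by exact: linear_differentiable.
by have := is_derive_comp dL hu; rewrite deriveE // diff_lin.
Qed.

Lemma approx_affine_mulmx {n} (f : 'rV[R]_n -> 'rV[R]_p) x A (Q : 'M[R]_(p, d)) (e : R) :
  approx_affine f x A e ->
  approx_affine (fun x' => f x' *m Q) x (A *m Q) (p%:R * `|Q| * e).
Proof.
move=> [del del0 hd]; exists del => // h /hd le.
rewrite mulmxA -!mulmxBl -mulrA.
rewrite (le_trans (mulmx_norm_le (lexx _) _)) // -!mulrA.
by do 2![rewrite ler_wpM2l //].
Qed.

Lemma jacobian_mulmx {n m} (f : 'rV[R]_n -> 'rV[R]_m) x h : h *m 'J f x = 'd f x h.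
Proof. by rewrite /jacobian mul_rV_lin1. Qed.

Lemma norm_eq0_le (A : 'M[R]_(p, d)) (c : R) : 0 <= c ->
  (forall e, 0 < e -> `|A| <= c * e) -> A = 0.
Proof.
move=> c0 le; apply/eqP; rewrite -normr_le0; apply/ler_addgt0Pl => e e0; rewrite addr0.
have c10 : 0 < c + 1 by rewrite ltr_wpDl.
have := le (e / (c + 1)) (divr_gt0 e0 c10) => /le_trans; apply.
by rewrite mulrCA ger_pMr // ler_pdivrMr // mul1r lerDl.
Qed.

End LinearImage.

Section AtMinimum.
Context {R : realType} {p d : nat} (g : 'rV[R]_p * 'rV[R]_d -> R).
Hypothesis gC3 : Ck_on 3 setT g.
Hypothesis gMB : parametric_Morse_Bott g.
Local Notation E := ('rV[R]_p * 'rV[R]_d)%type.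
Local Notation F := (gradient g).
Local Notation H := (hessian g).
Variable phi : R -> 'rV[R]_p -> 'rV[R]_d -> 'rV[R]_d.
Hypothesis phiflow : is_gradient_flow g phi.
Hypothesis gcoercive : forall x : 'rV[R]_p, coercive (fun y => g (x, y)).
Local Notation sel := (flow_selection phi).
Variables (x0 : 'rV[R]_p) (y0 : 'rV[R]_d).
Hypothesis y0_min : is_local_minimizer (fun y => g (x0, y)) y0.
Local Notation z0 := ((x0, y0) : E).
Local Notation Q := (kernel_proj (H z0)).

Let Fz0 : F z0 = 0 := local_min_critical gC3 (z0 := z0) y0_min.
Let H0_pos := local_min_psd gC3 (z0 := z0) y0_min.

(** A trajectory with vanishing initial gradient has vanishing gradient for ever, by
    [flow_decay]. *)
Lemma flow_fixed (t : R) : 0 <= t -> phi t x0 y0 = y0.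
Proof.
move=> t0; have [a a0 [K K0 hK]] := flow_decay gC3 gMB phiflow Fz0 H0_pos.
have [r r0 hr] := hK 1 ltr01.
have start : `|(x0, phi 0 x0 y0) - z0 : E| < r by rewrite (flow0 phiflow) subrr normr0.
have FT (s : R) : 0 <= s -> F (x0, phi s x0 y0) = 0.
  move=> s0; have [_] := hr x0 y0 0 (lexx 0) start s s0.
  by rewrite (flow0 phiflow) Fz0 normr0 mulr0 normr_le0 => /eqP.
have := @length_exp _ d (fun s => phi s x0 y0) (fun s => - F (x0, phi s x0 y0)) 0 t 0 1 ltr01 (lexx 0) t0.
move=> /(_ _ _ _)/wrap[|||h].
- by move=> s s0 _; exact: (is_derive_flow phiflow).
- exact: (flow_cvg_right phiflow).
- by move=> s s0 _; rewrite mul0r FT ?oppr0 ?normr0 // ltW.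
by move: h; rewrite mul0r normr_le0 subr_eq0 (flow0 phiflow) => /eqP.
Qed.

Lemma selection_fixed : sel x0 y0 = y0.
Proof.
have := @lim_dist_le _ _ (fun t => phi t x0 y0) _ y0 0 0 (flow_selectionP gC3 gMB phiflow gcoercive x0 y0).2.
move=> /(_ _)/wrap[t t0|h]; first by rewrite flow_fixed // subrr normr0.
by apply/eqP; rewrite -subr_eq0 -normr_le0.
Qed.

Hypothesis dsel : differentiable (fun x => sel x y0) x0.
Local Notation J := ('J (fun x => sel x y0) x0).

(** Differentiate the equation of the critical set along the selection. *)
Lemma selection_critical_jacobian : J *m H z0 = - cross_hessian g z0.
Proof.
pose G x : E := (x, sel x y0).
have dG : differentiable G x0 by exact: differentiable_pair.
have FG : F \o G = cst 0.
  by apply/funext => x; exact: (flow_selectionP gC3 gMB phiflow gcoercive x y0).1.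
have Gz : G x0 = z0 by rewrite /G selection_fixed.
have dF : differentiable F (G x0) by exact: gradient_differentiable gC3 _.
have did : 'd (fun x : 'rV[R]_p => x) x0 = id :> ('rV[R]_p -> 'rV[R]_p) by exact: diff_val.
have main (h : 'rV[R]_p) : h *m cross_hessian g z0 + h *m J *m H z0 = 0.
  have : 'd (F \o G) x0 h = 0 by rewrite FG diff_cst.
  rewrite (diff_comp dG dF) /= (diff_pair _ dsel) //= did.
  by rewrite -jacobian_mulmx -deriveE // (derive_gradientE gC3) Gz.
apply/eqP; rewrite -addr_eq0 addrC; apply/eqP/row_matrixP => i.
by rewrite row0 rowE mulmxDr mulmxA main.
Qed.

(** Along the trajectories the gradient is almost in the image of the Hessian, so that
    the selection moves, to first order, inside this image. *)
Lemma selection_kernel_jacobian : J *m Q = 0.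
Proof.
have [r1 r10 [b b0 [K K0 hK]]] := gradient_pair_decay gC3 gMB phiflow Fz0 H0_pos.
have [a a0 [K' K'0 hdecay]] := flow_decay gC3 gMB phiflow Fz0 H0_pos.
have [c c0 hc] := gradient_kernel_small gC3 gMB Fz0.
have approx0 (e : R) : 0 < e -> approx_affine (fun x => sel x y0 *m Q) x0 0 (K / b * e).
  move=> e0; have [rho rho0 hrho] := hc e e0.
  have [r2 r20 hr2] := hdecay rho rho0.
  exists (Num.min r1 r2) => [|h]; first by rewrite lt_min r10.
  rewrite lt_min => /andP[hr1 hr2'].
  have start : (x0 + h, phi 0 (x0 + h) y0) - z0 = (h, 0) :> E.
    by rewrite (flow0 phiflow); congr (_, _); rewrite /= ?subrr // addrC addKr.
  have nh : `|(h, 0) : E| = `|h| by rewrite prod_normE /= normr0 max_l.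
  rewrite mulmx0 subr0 selection_fixed.
  have cv : phi t (x0 + h) y0 *m Q @[t --> +oo] --> sel (x0 + h) y0 *m Q.
    apply: (@cvg_comp _ _ _ (fun t => phi t (x0 + h) y0) (mulmxr Q) _ _ _
      (flow_selectionP gC3 gMB phiflow gcoercive (x0 + h) y0).2).
    exact: mulmxr_continuous.
  apply: (lim_dist_le cv (t0 := 0)) => t t0.
  have := @length_exp _ d (fun s => phi s (x0 + h) y0 *m Q)
    (fun s => - F (x0 + h, phi s (x0 + h) y0) *m Q) 0 t (e * (K * `|h|)) b b0 _ t0.
  move=> /(_ _ _ _ _)/wrap[||||le].
  - by rewrite !mulr_ge0 // ltW.
  - by move=> s s0 _; apply: is_derive_mulmxr; exact: (is_derive_flow phiflow).
  - have c1 : phi s (x0 + h) y0 @[s --> (0 : R)^'+] --> phi 0 (x0 + h) y0 by exact: flow_cvg_right.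
    have := @cvg_comp _ _ _ (fun t => phi t (x0 + h) y0) (mulmxr Q) _ _ _ c1.
    by apply; exact: mulmxr_continuous.
  - move=> s s0 st; rewrite mulNmx normrN.
    have start1 : `|(x0 + h, phi 0 (x0 + h) y0) - z0 : E| < r1 by rewrite start nh.
    have start2 : `|(x0 + h, phi 0 (x0 + h) y0) - z0 : E| < r2 by rewrite start nh.
    have start3 : `|(x0, phi 0 x0 y0) - z0 : E| < r1 by rewrite (flow0 phiflow) subrr normr0.
    have [near_z _] := hr2 (x0 + h) y0 0 (lexx 0) start2 s (ltW s0).
    have [m [_ _ _ small]] := hrho _ _ near_z.
    have := hK (x0 + h) x0 y0 0 (lexx 0) start1 start3 s (ltW s0).
    rewrite (flow_fixed (ltW s0)) Fz0 subr0 [phi 0 x0 y0](flow0 phiflow) start nh => decay.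
    by rewrite (le_trans small) // -mulrA ler_wpM2l ?(ltW e0) // mulrAC.
  move: le; rewrite (flow0 phiflow) => /le_trans; apply.
  by rewrite le_eqVlt; apply/orP; left; apply/eqP; ring.
apply: (@norm_eq0_le _ _ _ _ (d%:R * `|Q| + K / b)) => [|e e0].
  by rewrite addr_ge0 ?mulr_ge0 ?invr_ge0 ?(ltW K0) ?(ltW b0).
have h := approx_affine_close _ (approx_affine_mulmx Q (approx_affine_jacobian dsel e0)) (approx0 e e0).
move: h; rewrite subr0 -mulrDl; apply.
by rewrite mulr_ge0 ?(ltW e0) // addr_ge0 ?mulr_ge0 ?invr_ge0 ?(ltW K0) ?(ltW b0).
Qed.

Lemma selection_jacobian : J = - (cross_hessian g z0 *m pseudo_inverse (H z0)).
Proof.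
have e := image_kernel_split (H z0) J.
rewrite selection_kernel_jacobian addr0 /image_proj mulmxA selection_critical_jacobian mulNmx in e.
exact: e.
Qed.

End AtMinimum.

(** * The differential of the flow selection *)

Theorem theorem2 (R : realType) (p d : nat) (hp : (0 < p)%N) (hd : (0 < d)%N)
    (g : 'rV[R]_p * 'rV[R]_d -> R)
    (gC3 : Ck_on 3 setT g)
    (gMB : parametric_Morse_Bott g)
    (gLip : exists L : R, 0 < L /\ grad_y_lipschitz g L)
    (gcoercive : forall x : 'rV[R]_p, coercive (fun y => g (x, y)))
    (phi : R -> 'rV[R]_p -> 'rV[R]_d -> 'rV[R]_d)
    (phiflow : is_gradient_flow g phi)
    (x0 : 'rV[R]_p) (y0 : 'rV[R]_d) :
  (is_local_minimizer (fun y => g (x0, y)) (flow_selection phi x0 y0) ->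
   exists U : set 'rV[R]_p, nbhs x0 U /\
     forall x, U x ->
       [/\ differentiable (fun x' => flow_selection phi x' y0) x,
           forall t : R, 0 <= t -> differentiable (fun x' => phi t x' y0) x
         & 'J (fun x' => phi t x' y0) x @[t --> +oo]
             --> 'J (fun x' => flow_selection phi x' y0) x])
  /\
  (is_local_minimizer (fun y => g (x0, y)) y0 ->
   differentiable (fun x' => flow_selection phi x' y0) x0 /\
   'J (fun x' => flow_selection phi x' y0) x0
     = - (hess_xy g x0 y0 *m pseudo_inverse (hess_yy g x0 y0))).
Proof.
have [L [L0 gL]] := gLip.
have near_min := selection_differentiable gC3 gMB phiflow gcoercive L0 gL.
split=> [sel_min|y0_min].
  have [del del0 hdel] := near_min x0 y0 sel_min.
  exists (ball x0 del); split=> [|x]; first exact: nbhsx_ballx.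
  rewrite -ball_normE /= distrC => /hdel[dsel cJ]; split=> // t t0.
  exact: (flow_differentiable gC3 phiflow L0 gL x y0 t0).
have selE := selection_fixed gC3 gMB phiflow gcoercive y0_min.
have [|del del0 hdel] := near_min x0 y0; first by rewrite selE.
have [|dsel _] := hdel x0; first by rewrite subrr normr0.
by split=> //; exact: (selection_jacobian gC3 gMB phiflow gcoercive y0_min dsel).
Qed.
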